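(* For all integers $k\ge1$, $s$ and $r$ with $0\le s\le k$ and $0\le r\le k$ (and $s+r\le k$), \[GR_k((k-s-r)P_3,sK_3,rH_3)=\begin{cases} 5^{s/2}\cdot\lfloor21\cdot17^{(r-2)/2}\rfloor+1, & s,r \text{ both even and } s+r=k,\\ 2\cdot5^{s/2}\cdot17^{r/2}+1, & s,r \text{ both even and } s+r<k,\\ 5^{(s-1)/2}\cdot\lfloor42\cdot17^{(r-2)/2}\rfloor+1, & s \text{ odd}, r \text{ even and } s+r=k,\\ 4\cdot5^{(s-1)/2}\cdot17^{r/2}+1, & s \text{ odd}, r \text{ even and } s+r<k,\\ 10\cdot5^{(s-1)/2}\cdot17^{(r-1)/2}+1, & s,r \text{ both odd and } s+r=k,\\ 16\cdot5^{(s-1)/2}\cdot17^{(r-1)/2}+1, & s,r \text{ both odd and } s+r<k,\\ 4\cdot5^{s/2}\cdot17^{(r-1)/2}+1, & s \text{ even}, r \text{ odd and } s+r=k,\\ \lfloor32\cdot5^{(s-2)/2}\rfloor\cdot17^{(r-1)/2}+1, & s \text{ even}, r \text{ odd and } s+r<k. \end{cases}\]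
   Context: All graphs are finite, simple and undirected. $K_n$ denotes the complete graph and $P_n$ the path on $n$ vertices. $H_3$ is the graph $K_5$ minus one edge. An edge coloring of a complete graph is a Gallai coloring if it contains no rainbow triangle (a triangle whose three edges receive three distinct colors). For graphs $F_1,\dots,F_k$, $GR(F_1,\dots,F_k)$ is the minimum integer $n$ such that every Gallai coloring of $K_n$ with colors $1,\dots,k$ contains, for some $i\in\{1,\dots,k\}$, a monochromatic copy of $F_i$ in color $i$. The notation $GR_k((k-s-r)P_3,sK_3,rH_3)$ means $GR(F_1,\dots,F_k)$ with $F_1=\dots=F_r=H_3$, $F_{r+1}=\dots=F_{r+s}=K_3$ and $F_{r+s+1}=\dots=F_k=P_3$; i.e., the first $r$ colors are assigned to $H_3$, the next $s$ colors to $K_3$, and the last $k-s-r$ colors to $P_3$. *)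

(* Defs.v *)
From mathcomp Require Import all_boot all_order all_algebra.
Set Implicit Arguments.
Unset Strict Implicit.
Unset Printing Implicit Defensive.
Import Order.TTheory GRing.Theory Num.Theory.

Record sgraph := SGraph {
  vert :> finType;
  adj : rel vert;
  adj_sym : symmetric adj;
  adj_irr : irreflexive adj
}.

Section Graphs.

Lemma complete_sym n : symmetric (fun i j : 'I_n => i != j).
Proof. by move=> i j; rewrite eq_sym. Qed.

Lemma complete_irr n : irreflexive (fun i j : 'I_n => i != j).
Proof. by move=> i; rewrite eqxx. Qed.

Definition complete_graph n : sgraph :=
  SGraph (@complete_sym n) (@complete_irr n).

Lemma path_sym n :
  symmetric (fun i j : 'I_n => (i.+1 == j :> nat) || (j.+1 == i :> nat)).
Proof. by move=> i j; rewrite orbC. Qed.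

Lemma path_irr n :
  irreflexive (fun i j : 'I_n => (i.+1 == j :> nat) || (j.+1 == i :> nat)).
Proof. by move=> i; rewrite orbb eqn_leq ltnn. Qed.

Definition path_graph n : sgraph := SGraph (@path_sym n) (@path_irr n).

Variables (G : sgraph) (x y : G).

Lemma del_edge_sym :
  symmetric (fun u v : G => adj u v && ([set u; v] != [set x; y])).
Proof. by move=> u v; rewrite adj_sym setUC. Qed.

Lemma del_edge_irr :
  irreflexive (fun u v : G => adj u v && ([set u; v] != [set x; y])).
Proof. by move=> u; rewrite adj_irr. Qed.

Definition del_edge : sgraph := SGraph del_edge_sym del_edge_irr.

End Graphs.

Definition K3 : sgraph := complete_graph 3.
Definition P3 : sgraph := path_graph 3.
Definition H3 : sgraph :=
  @del_edge (complete_graph 5) (ord0 : 'I_5) (ord_max : 'I_5).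

(* The edge joining distinct vertices x and y of K_n is the set [set x; y].
   A coloring is a total function on {set 'I_n}; its values on sets that do
   not have exactly two elements are never used.  The colors 1, ..., k are
   represented by the elements 0, ..., k-1 of 'I_k. *)
Definition edge_coloring (n k : nat) : Type := {set 'I_n} -> 'I_k.

Section Colorings.

Variables (n k : nat) (c : edge_coloring n k).

Definition rainbow_triangle (x y z : 'I_n) : Prop :=
  uniq [:: x; y; z] /\ uniq [:: c [set x; y]; c [set y; z]; c [set x; z]].

Definition gallai_coloring : Prop :=
  forall x y z : 'I_n, ~ rainbow_triangle x y z.

Definition mono_copy (F : sgraph) (i : 'I_k) : Prop :=
  exists2 f : F -> 'I_n, injective f &
    forall u v : F, adj u v -> c [set f u; f v] = i.

End Colorings.

Definition GR_arrows (k : nat) (F : 'I_k -> sgraph) (n : nat) : Prop :=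
  forall c : edge_coloring n k,
    gallai_coloring c -> exists i : 'I_k, mono_copy c (F i) i.

Definition is_GR (k : nat) (F : 'I_k -> sgraph) (n : nat) : Prop :=
  GR_arrows F n /\ forall m : nat, GR_arrows F m -> n <= m.

Definition GR_family (k s r : nat) (i : 'I_k) : sgraph :=
  if i < r then H3 else if i < r + s then K3 else P3.

(* The exponents (r-2)/2 and (s-2)/2 are equal to -1 when r = 0, resp. s = 0,
   hence the integer powers of rationals; the integer division by 2 is exact
   in every case where it is used. *)
Definition GR_value (k s r : nat) : nat :=
  match odd s, odd r, s + r == k with
  | false, false, true =>
      5 ^ (s./2) * Num.truncn (21%:Q * 17%:Q ^ ((r%:Z - 2) %/ 2)%Z)%R + 1
  | false, false, false =>
      2 * 5 ^ (s./2) * 17 ^ (r./2) + 1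
  | true, false, true =>
      5 ^ ((s - 1)./2) * Num.truncn (42%:Q * 17%:Q ^ ((r%:Z - 2) %/ 2)%Z)%R + 1
  | true, false, false =>
      4 * 5 ^ ((s - 1)./2) * 17 ^ (r./2) + 1
  | true, true, true =>
      10 * 5 ^ ((s - 1)./2) * 17 ^ ((r - 1)./2) + 1
  | true, true, false =>
      16 * 5 ^ ((s - 1)./2) * 17 ^ ((r - 1)./2) + 1
  | false, true, true =>
      4 * 5 ^ (s./2) * 17 ^ ((r - 1)./2) + 1
  | false, true, false =>
      Num.truncn (32%:Q * 5%:Q ^ ((s%:Z - 2) %/ 2)%Z)%R * 17 ^ ((r - 1)./2) + 1
  end.

(* Main.v *)
(** Upper bound, by induction on the number of vertices, for Gallai colourings in
    which every colour i avoids all edges, P3, K3 or H3.  A vertex whose edges to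
    all remaining vertices have one colour (of type H3, used once) is peeled off and
    later added for free to sets on which the other colours are counted.  If the
    remaining set R splits into two sets joined by a single colour, the constraint
    on that colour drops on both sides and induction applies to both.  Otherwise
    Gallai's theorem partitions R into parts joined homogeneously by two colours r
    and b, each part having neighbours of both colours; the constraints on r and b
    drop inside the parts and inside their neighbourhoods, and two-colour Ramsey
    bounds limit the number of parts.

    The Ramsey bounds come from an exhaustive generation of the (K4-e)-free graphs
    with H3-free complement: there are none on 13 vertices.  For R(H3, H3) <= 22,
    some vertex of a colouring of K_22 has 11 or 12 neighbours in one colour; they
    span such a graph, and a search shows that none of those on 11 or 12 vertices
    extends to 22 vertices.

    Lower bound: lexicographic products with two-coloured complete graphs on 5, 8
    and 17 vertices, started from small colourings, the largest on 21 vertices. *)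

(* A join of two sets with at least two vertices each lowers an H3 constraint to constraints of the
   same family. A single vertex joined to the rest in one colour lowers it only to K4 minus an edge,
   which is outside the family; peeling avoids adding this constraint to the induction, and it
   enters only through the Ramsey bounds. A colour is peeled at most once because a peeled vertex of
   colour j enlarges one side of any later join in j to two vertices.

   The factors 5, 8 and 17 are R(K3, K3) - 1, R(K3, K4) - 1 and R(K4, K4) - 1: blowing up a K4
   produces an H3, so between parts with several vertices H3 behaves like K4. In the upper bound 17
   arises as 1 + 8 + 8, from a part with two vertices and its neighbourhoods in the two colours.
   Partitions into single vertices are limited by R(H3, H3) instead. They reach 21, but this step
   cannot be iterated, which explains the irregular start 1, 21, 21 * 17 of the formula. The other
   irregularity, 6 followed by 32 instead of 30, comes from the octahedron with a perfect matching
   on 6 vertices and from 32 = 2 * 8 * 2. *)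
From Stdlib Require Import BinNat.
Require Import Defs.
From mathcomp Require Import all_boot all_order all_algebra zify.
Set Implicit Arguments.
Unset Strict Implicit.
Unset Printing Implicit Defensive.

(** * Generation of graphs up to isomorphism *)

(* Graphs are lists of rows of the adjacency matrix; [if] is used instead of [&&]
   because virtual machine evaluation is strict in function arguments. *)
Fixpoint meet_rows (a b : seq bool) : seq bool :=
  match a, b with
  | x :: a', y :: b' => (if x then y else false) :: meet_rows a' b'
  | _, _ => [::]
  end.
Fixpoint some_true (a : seq bool) : bool :=
  if a is x :: a' then if x then true else some_true a' else false.

(* Can a new vertex with partial neighbourhood [s] be joined to the vertex with row
   [rx] as well?  Here [s] only covers the vertices preceding that vertex. *)
Definition extends_diamond_free (rows : seq (seq bool)) (s rx : seq bool) : bool :=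
  match mask (meet_rows rx s) rows with
  | [::] => true
  | [:: ry] => if some_true (meet_rows rx ry) then false else ~~ some_true (meet_rows ry s)
  | _ => false
  end.

Fixpoint lazy_all (T : Type) (p : T -> bool) (l : seq T) : bool :=
  if l is x :: l' then if p x then lazy_all p l' else false else true.

Definition extends_H3_free (rows : seq (seq bool)) (s rx : seq bool) : bool :=
  let n1 := meet_rows rx s in
  lazy_all (fun ry =>
    match mask (meet_rows ry n1) rows with
    | [::] => true
    | [:: rz] => let c := meet_rows ry rz in
        if some_true (meet_rows c rx) then false else ~~ some_true (meet_rows c s)
    | _ => false
    end) (mask n1 rows).

Section Gen.
Variables (ok1 ok2 : seq bool -> seq bool -> bool).
(* [s] is the part of the neighbourhood of the new vertex decided so far, [t] its
   complement; [ok1] and [ok2] filter edges and non-edges. *)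
Fixpoint neighbourhoods (R B : seq (seq bool)) (s t : seq bool) : seq (seq bool) :=
  match R, B with
  | rx :: R', bx :: B' =>
      (if ok1 s rx then neighbourhoods R' B' (rcons s true) (rcons t false) else [::]) ++
      (if ok2 t bx then neighbourhoods R' B' (rcons s false) (rcons t true) else [::])
  | _, _ => [:: s]
  end.
End Gen.

Fixpoint add_column (rows : seq (seq bool)) (s : seq bool) : seq (seq bool) :=
  match rows, s with
  | r :: rows', b :: s' => rcons r b :: add_column rows' s'
  | _, _ => [::]
  end.
Definition add_vertex rows s := rcons (add_column rows s) (rcons s false).

Fixpoint complement_row (i : nat) (r : seq bool) : seq bool :=
  match r with
  | [::] => [::]
  | b :: r' => match i with
      | 0 => false :: map negb r'
      | i'.+1 => negb b :: complement_row i' r'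
      end
  end.
Fixpoint complement_from (i : nat) (rows : seq (seq bool)) :=
  if rows is r :: rows' then complement_row i r :: complement_from i.+1 rows' else [::].
Definition complement rows := complement_from 0 rows.

(* Colour refinement with arbitrary weights.  The result need not be canonical: only
   the fact that it is a relabelling is used, and it is tested by [is_perm]. *)
Local Open Scope N_scope.
Definition weights : seq N :=
  [:: 1; 397; 1451; 2903; 731; 3557; 1987; 89; 2287; 3301; 1109; 613; 3001; 197].
Fixpoint weighted_sum (r : seq bool) (w : seq N) : N :=
  match r, w with
  | b :: r', x :: w' => if b then N.add x (weighted_sum r' w') else weighted_sum r' w'
  | _, _ => 0
  end.
Definition colour_offsets : seq N :=
  [:: 0; 65536; 131072; 196608; 262144; 327680; 393216; 458752; 524288; 589824;
      655360; 720896; 786432; 851968].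
Fixpoint count_below (k : N) (l : seq N) : nat :=
  if l is x :: l' then if N.ltb x k then S (count_below k l') else count_below k l' else O.
Definition refine (rows : seq (seq bool)) (col : seq nat) : seq nat :=
  let w := map (nth N0 weights) col in
  let keys := map (fun rc => N.add (nth N0 colour_offsets rc.2) (weighted_sum rc.1 w)) (zip rows
    col) in
  map (fun k => count_below k keys) keys.
Fixpoint occurrences (i : nat) (l : seq nat) : nat :=
  if l is x :: l' then if eqn x i then S (occurrences i l') else occurrences i l' else O.
Fixpoint individualize (c : nat) (l : seq nat) : seq nat :=
  if l is x :: l' then
    if eqn x c then x :: map (fun y => if eqn y c then S y else y) l'
    else x :: individualize c l'
  else [::].
Fixpoint first_tie (fuel i : nat) (l : seq nat) : option nat :=
  if fuel is S f then
    if leq (S (S O)) (occurrences i l) then Some i else first_tie f (S i) l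
  else None.
Fixpoint labels (fuel n : nat) rows (col : seq nat) : seq nat :=
  if fuel is S f then
    let c2 := refine rows (refine rows col) in
    if first_tie n O c2 is Some i then labels f n rows (individualize i c2) else c2
  else col.
Fixpoint position (i : nat) (l : seq nat) : nat :=
  if l is x :: l' then if eqn x i then O else S (position i l') else O.
Local Close Scope N_scope.
Definition canon_perm (rows : seq (seq bool)) : seq nat :=
  let n := size rows in
  let l := labels n n rows (refine rows (nseq n 0)) in
  map (fun i => position i l) (iota 0 n).
Definition is_perm (n : nat) (p : seq nat) : bool :=
  lazy_all (fun i => eqn (occurrences i p) 1) (iota 0 n) && eqn (size p) n.
Definition relabel (p : seq nat) (rows : seq (seq bool)) : seq (seq bool) :=
  map (fun i => let r := nth [::] rows i in map (nth false r) p) p.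
Definition canon rows :=
  let p := canon_perm rows in
  if is_perm (size rows) p then relabel p rows else rows.

Fixpoint eq_row (a b : seq bool) : bool :=
  match a, b with
  | [::], [::] => true
  | x :: a', y :: b' => if x then (if y then eq_row a' b' else false)
                        else if y then false else eq_row a' b'
  | _, _ => false
  end.
Fixpoint eq_graph (a b : seq (seq bool)) : bool :=
  match a, b with
  | [::], [::] => true
  | x :: a', y :: b' => if eq_row x y then eq_graph a' b' else false
  | _, _ => false
  end.
Fixpoint mem_graph (a : seq (seq bool)) l : bool :=
  if l is b :: l' then if eq_graph a b then true else mem_graph a l' else false.
Fixpoint insert_all (l acc : seq (seq (seq bool))) :=
  if l is a :: l' then insert_all l' (if mem_graph a acc then acc else a :: acc) else acc.

Fixpoint degree (r : seq bool) : nat :=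
  if r is b :: r' then if b then (degree r').+1 else degree r' else 0.
Fixpoint min_degree (d : nat) (rows : seq (seq bool)) : bool :=
  if rows is r :: rows' then if leq d (degree r) then min_degree d rows' else false else true.

(* The last vertex may be taken of minimum degree before relabelling. *)
Definition one_vertex_extensions (rows : seq (seq bool)) : seq (seq (seq bool)) :=
  let B := complement rows in
  map canon (filter (fun g => min_degree (degree (last [::] g)) g)
    (map (add_vertex rows) (neighbourhoods (extends_diamond_free rows) (extends_H3_free B) rows B
      [::] [::]))).

Fixpoint next_level (l acc : seq (seq (seq bool))) :=
  if l is g :: l' then next_level l' (insert_all (one_vertex_extensions g) acc) else acc.
Fixpoint canonical_graphs (n : nat) : seq (seq (seq bool)) :=
  if n is n'.+1 then next_level (canonical_graphs n') [::] else [:: [::]].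

(** * Search for a vertex with a given neighbourhood *)

Definition no_triangle_in (B : seq (seq bool)) (L : seq bool) : bool :=
  lazy_all (fun bx => let c := meet_rows bx L in lazy_all (fun b => ~~ some_true (meet_rows b c))
    (mask c B)) (mask L B).

(* Compatibility of a vertex with rows [rw] (edges) and [bw] (non-edges) and a vertex with
   neighbourhood [c] in A, neither joined to the centre: no common triangle of
   non-neighbours, and at least one of edge and non-edge between them is possible. *)
Definition compatible (R B : seq (seq bool)) (rw bw : seq bool) (c : seq bool) : bool :=
  let d := map negb c in
  if no_triangle_in B (meet_rows d bw) then
    if extends_H3_free R c rw then true else extends_H3_free B d bw
  else false.

Fixpoint count_at (b : bool) (u : nat) (cs : seq (seq bool)) : nat :=
  if cs is c :: cs' then
    if nth false c u then (if b then S (count_at b u cs') else count_at b u cs')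
    else (if b then count_at b u cs' else S (count_at b u cs'))
  else O.

(* All degrees in both colours are at least 9 = 21 - 12, so a vertex [u] of A with fewer
   than 9 neighbours (or non-neighbours) so far has another one among the vertices still
   to be added.  Choose the [u] leaving the fewest candidates. *)
Fixpoint best_split (cs : seq (seq bool)) (R B : seq (seq bool)) (u n : nat) (best : option (nat *
  bool)) (bk : nat)
  : option (nat * bool) :=
  match n, R, B with
  | S n', r :: R', b :: B' =>
      let kr := if leq 9 (degree r) then 1000 else count_at true u cs in
      let: (best, bk) := if leq bk kr then (best, bk) else (Some (u, true), kr) in
      let kb := if leq 9 (degree b) then 1000 else count_at false u cs in
      let: (best, bk) := if leq bk kb then (best, bk) else (Some (u, false), kb) in
      best_split cs R' B' (S u) n' best bk
  | _, _, _ => best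
  end.
Definition has_val (u : nat) (b : bool) (c : seq bool) := if nth false c u then b else ~~ b.

(** Once a branch is refuted, no remaining vertex has the trace [c]; this is why [c] leaves the
    candidates of the later branches. *)
Fixpoint refute_all (go : seq (seq bool) -> seq bool -> bool) (br cs : seq (seq bool)) : bool :=
  if br is c :: br' then
    if go cs c then refute_all go br' (filter (fun c' => ~~ eq_row c c') cs) else false
  else true.

(** [best_split] is an untrusted heuristic: the conditions on [u] that justify a restriction are
    tested here again, and if they fail all traces are tried. A split is proposed only if it leaves
    fewer than 500 candidates; the weight 1000 of a vertex whose degree is large enough rules it
    out. *)
Definition branch (sizeA : nat) (R B cs : seq (seq bool)) : seq (seq bool) :=
  if best_split cs R B 0 sizeA None 500 is Some (u, b) then
    if leq sizeA u then cs else
    if leq 9 (degree (nth [::] (if b then R else B) u)) then cs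
    else filter (has_val u b) cs
  else cs.

(* [R] and [B] list first the [sizeA] vertices of A, then the centre, then the vertices
   added so far; [cs] lists the traces on A allowed for the remaining vertices. *)
Fixpoint gluing_fails (fuel sizeA : nat) (R B : seq (seq bool)) (cs : seq (seq bool)) : bool :=
  if fuel is S f then
    refute_all (fun cs c =>
         lazy_all (fun s =>
              let t := map negb s in
              let R' := add_vertex R s in let B' := add_vertex B t in
              gluing_fails f sizeA R' B' (filter (compatible R' B' (rcons s false) (rcons t
                false)) cs))
            (neighbourhoods (extends_H3_free R) (extends_H3_free B) (drop sizeA.+1 R) (drop
              sizeA.+1 B)
               (rcons c false) (rcons (map negb c) true)))
      (branch sizeA R B cs) cs
  else false.

(** The centre is joined to all of [A], and in the other colour to everything added later; [21 - n]
    such vertices complete a colouring on 22 vertices. *)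
Definition not_neighbourhood (A : seq (seq bool)) : bool :=
  let n := size A in
  let R := add_vertex A (nseq n true) in
  let B := add_vertex (complement A) (nseq n false) in
  let cones := neighbourhoods (extends_H3_free R) (extends_H3_free B) (take n R) (take n B) [::]
    [::] in
  gluing_fails (21 - n) n R B cones.

(** * Soundness of the generation and of the search *)

Definition K3_free (T : Type) (e : rel T) : Prop :=
  forall x y z, e x y -> e x z -> e y z -> False.

Definition diamond_free (T : Type) (e : rel T) : Prop :=
  forall x y z w, e x y -> e x z -> e y z -> e x w -> e y w -> z = w.

(** The missing edge of H3 joins [u] and [w], the two common neighbours of a triangle. Copies need
    not be induced, so nothing is asked of this pair except that it be distinct. *)
Definition H3_free (T : Type) (e : rel T) : Prop :=
  forall x y z u w, e x y -> e x z -> e y z ->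
    e x u -> e y u -> e z u -> e x w -> e y w -> e z w -> u = w.

Lemma lazy_allE (T : Type) (p : T -> bool) l : lazy_all p l = all p l.
Proof. by elim: l => //= x l ->; case: (p x). Qed.

Lemma some_true_map (T : Type) (P : pred T) s : some_true (map P s) = has P s.
Proof. by elim: s => //= x s ->; case: (P x). Qed.

Lemma meet_rows_mapl (T : Type) (P Q : pred T) s t :
  meet_rows (map P (s ++ t)) (map Q s) = map (predI P Q) s.
Proof.
elim: s => [|x s /= ->]; first by case: t.
by congr cons; case: (P x).
Qed.

Lemma meet_rows_mapr (T : Type) (P Q : pred T) s t :
  meet_rows (map P s) (map Q (s ++ t)) = map (predI P Q) s.
Proof. by elim: s => //= x s ->; congr cons; case: (P x). Qed.

Lemma meet_rows_map (T : Type) (P Q : pred T) s :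
  meet_rows (map P s) (map Q s) = map (predI P Q) s.
Proof. by rewrite -{1}[s]cats0 meet_rows_mapl. Qed.

Lemma mask_map (T U : Type) (P : pred T) (h : T -> U) s t :
  mask (map P s) (map h (s ++ t)) = map h (filter P s).
Proof. by elim: s => [|x s /= ->]; [case: t | case: (P x)]. Qed.

Section Mat.

Variables (T : eqType).

Definition adjacency (e : rel T) (xs : seq T) : seq (seq bool) :=
  [seq [seq e x y | y <- xs] | x <- xs].

Lemma filter2_neq (P : pred T) (s : seq T) y y' l :
  uniq s -> filter P s = [:: y, y' & l] ->
  [/\ y \in s, y' \in s, P y, P y' & y != y'].
Proof.
move=> us E.
have [iy iy'] : y \in filter P s /\ y' \in filter P s by rewrite E !inE !eqxx orbT.
have := filter_uniq P us; rewrite E /= inE negb_or => /andP[/andP[nyy' _] _].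
by move: iy iy'; rewrite !mem_filter => /andP[-> ->] /andP[-> ->].
Qed.

Lemma filter1_mem (P : pred T) (s : seq T) y l :
  filter P s = y :: l -> P y && (y \in s).
Proof. by move=> E; rewrite -mem_filter E mem_head. Qed.

(** The filters must not reject a neighbourhood that occurs; accepting an impossible one only
    enlarges the enumeration. *)
Lemma extends_diamond_freeP (e : rel T) pre post x w :
  symmetric e -> diamond_free e -> uniq (pre ++ post) -> w \notin pre ++ post ->
  x \notin pre -> e w x ->
  extends_diamond_free (adjacency e (pre ++ post)) (map (e w) pre) (map (e x) (pre ++ post)).
Proof.
move=> es eD u wz xp ewx; rewrite /extends_diamond_free meet_rows_mapl mask_map.
have up : uniq pre by move: u; rewrite cat_uniq => /andP[].
case E : (filter _ _) => [|y [|y' l]] //=.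
  case/filter1_mem/andP: E => /andP[/= exy ewy] yp.
  rewrite meet_rows_map some_true_map meet_rows_mapl some_true_map.
  case: hasP => [[z zz /andP[/= exz eyz]]|_].
    by move: wz; rewrite (eD x y w z) ?zz // es.
  apply/hasPn => z zp; apply/negP => /andP[/= eyz ewz].
  by move: xp; rewrite (eD w y x z) ?zp // es.
case/(filter2_neq up): E => yp yp' /andP[/= exy ewy] /andP[/= exy' ewy'] /eqP[].
exact: (eD w x).
Qed.

Lemma extends_H3_freeP (e : rel T) pre post x w :
  symmetric e -> H3_free e -> uniq (pre ++ post) -> w \notin pre ++ post ->
  x \notin pre -> e w x ->
  extends_H3_free (adjacency e (pre ++ post)) (map (e w) pre) (map (e x) (pre ++ post)).
Proof.
move=> es eH u wz xp ewx; rewrite /extends_H3_free lazy_allE meet_rows_mapl mask_map.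
have up : uniq pre by move: u; rewrite cat_uniq => /andP[].
apply/allP => ry /mapP[y]; rewrite mem_filter => /andP[/andP[/= exy ewy] yp] ->{ry}.
rewrite meet_rows_mapl mask_map.
case E : (filter _ _) => [|z [|z' l]] //=.
  case/filter1_mem/andP: E => /andP[/= eyz /andP[/= exz ewz]] zp.
  rewrite !(meet_rows_map, meet_rows_mapl, some_true_map).
  case: hasP => [[t tt /andP[/= /andP[/= eyt ezt] ext]]|_].
    by move: wz; rewrite (eH x y z w t) ?tt // es.
  apply/hasPn => t tp; apply/negP => /andP[/= /andP[/= eyt ezt] ewt].
  by move: xp; rewrite (eH w y z x t) ?tp // es.
case/(filter2_neq up): E => zp zp' /andP[/= eyz /andP[/= exz ewz]].
case/andP => /= eyz' /andP[/= exz' ewz'] /eqP[].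
exact: (eH w x y).
Qed.

(** The vertices of [pre] are decided already, those of [suf] by the recursion, and [rest] stays
    undecided; [rest] is the centre when traces on its neighbourhood are enumerated. Following the
    actual colours of [w] leads to the leaf in question. *)
Lemma neighbourhoods_sound (e f : rel T) (ok1 ok2 : seq bool -> seq bool -> bool) w suf : forall
  pre rest,
  (forall pre' x post, pre ++ suf ++ rest = pre' ++ x :: post -> e w x ->
     ok1 (map (e w) pre') (map (e x) (pre ++ suf ++ rest))) ->
  (forall pre' x post, pre ++ suf ++ rest = pre' ++ x :: post -> f w x ->
     ok2 (map (f w) pre') (map (f x) (pre ++ suf ++ rest))) ->
  {in suf, forall x, f w x = ~~ e w x} ->
  map (e w) (pre ++ suf) \in
    neighbourhoods ok1 ok2 [seq map (e x) (pre ++ suf ++ rest) | x <- suf]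
      [seq map (f x) (pre ++ suf ++ rest) | x <- suf] (map (e w) pre) (map (f w) pre).
Proof.
elim: suf => [|x suf IH] pre rest h1 h2 ef /=; first by rewrite cats0 mem_head.
have E : pre ++ (x :: suf) ++ rest = rcons pre x ++ suf ++ rest by rewrite cat_rcons.
have fx := ef x (mem_head _ _).
have ef' : {in suf, forall x, f w x = ~~ e w x}.
  by move=> y ys; apply: ef; rewrite inE ys orbT.
have := IH (rcons pre x) rest; rewrite -E => /(_ h1 h2 ef').
rewrite !map_rcons mem_cat fx cat_rcons.
case exw : (e w x) => I.
  by rewrite (h1 pre x (suf ++ rest)) // I.
by rewrite (h2 pre x (suf ++ rest)) ?I ?orbT // fx exw.
Qed.

Lemma add_column_adjacency (e : rel T) x zs xs : symmetric e ->
  add_column [seq map (e y) zs | y <- xs] (map (e x) xs) = [seq map (e y) (rcons zs x) | y <- xs].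
Proof. by move=> es; elim: xs => //= y xs ->; rewrite map_rcons es. Qed.

Lemma add_vertex_adjacency (e : rel T) x zs : symmetric e -> irreflexive e ->
  add_vertex (adjacency e zs) (map (e x) zs) = adjacency e (rcons zs x).
Proof.
move=> es ei; rewrite /add_vertex add_column_adjacency // /adjacency map_rcons; congr rcons.
by rewrite map_rcons ei.
Qed.

Lemma complement_row_adjacency (e f : rel T) y zs : forall xs pre, zs = pre ++ y :: xs ->
  irreflexive f -> uniq zs -> {in zs, forall x, x != y -> f y x = ~~ e y x} ->
  complement_row (size pre) (map (e y) zs) = map (f y) zs.
Proof.
move=> xs pre -> fi; elim: pre => [|x pre IH] /=.
  move=> /andP[yx _] ef; rewrite fi; congr cons; rewrite -map_comp.
  apply/eq_in_map => x xx /=; rewrite ef ?inE ?xx ?orbT //.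
  by apply: contraNneq yx => <-.
rewrite mem_cat inE => /andP[/norP[xpre /norP[xy _]] u] ef.
rewrite ef ?mem_head // IH // => z zp; apply: ef; by rewrite inE zp orbT.
Qed.

Lemma complement_adjacency (e f : rel T) zs : irreflexive f -> uniq zs ->
  {in zs &, forall x y, x != y -> f x y = ~~ e x y} ->
  complement (adjacency e zs) = adjacency f zs.
Proof.
move=> fi u ef; rewrite /complement /adjacency.
suff H : forall xs pre, zs = pre ++ xs ->
   complement_from (size pre) [seq map (e y) zs | y <- xs] = [seq map (f y) zs | y <- xs].
  exact: (H zs [::]).
elim=> //= y xs IH pre E.
rewrite (complement_row_adjacency (f := f) (xs := xs)) //; last first.
  by move=> x xz xy; rewrite ef // ?E ?mem_cat ?mem_head ?orbT // eq_sym.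
by congr cons; rewrite -(size_rcons pre y) IH // cat_rcons.
Qed.

Lemma deg_map (P : pred T) s : degree (map P s) = count P s.
Proof. by elim: s => //= x s ->; case: (P x). Qed.

Lemma mindegE d rows : min_degree d rows = all (fun r => d <= degree r) rows.
Proof. by elim: rows => //= r rows ->; case: leq. Qed.

Lemma eqmP a b : reflect (a = b) (eq_row a b).
Proof.
suff -> : eq_row a b = (a == b) by exact: eqP.
elim: a b => [|x a IH] [|y b] //=; rewrite eqseq_cons -IH.
by case: x; case: y.
Qed.

Lemma eqrE a b : eq_graph a b = (a == b).
Proof.
by elim: a b => [|x a IH] [|y b] //=; rewrite eqseq_cons -IH; case: eqmP => [->|/eqP/negbTE->] //;
  rewrite eqxx.
Qed.

Lemma memE a l : mem_graph a l = (a \in l).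
Proof. by elim: l => //= b l ->; rewrite inE eqrE; case: eqP. Qed.

Lemma insert_all_sub l acc a :
  (a \in l) || (a \in acc) -> a \in insert_all l acc.
Proof.
elim: l acc => //= b l IH acc; rewrite inE -orbA => h; apply: IH.
rewrite memE; case: ifP => // [ba|_].
  by case/or3P: h => [/eqP->|->|->]; rewrite ?ba ?orbT.
by rewrite inE; case/or3P: h => ->; rewrite ?orbT.
Qed.

Lemma step_all_sub l acc g a :
  (a \in acc) || (g \in l) && (a \in one_vertex_extensions g) -> a \in next_level l acc.
Proof.
elim: l acc => [|b l IH] acc /=; first by rewrite orbF.
move=> h; apply: IH; case/orP: h => [h|]; first by rewrite insert_all_sub ?h ?orbT.
rewrite inE => /andP[/orP[/eqP <-|gl] ag]; first by rewrite insert_all_sub ?ag.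
by rewrite gl ag orbT.
Qed.

Lemma relabel_adjacency (e : rel T) x0 p zs : all (fun i => i < size zs) p ->
  relabel p (adjacency e zs) = adjacency e [seq nth x0 zs i | i <- p].
Proof.
move=> /allP h; rewrite /relabel /adjacency -map_comp; apply/eq_in_map => i ip /=.
rewrite (nth_map x0) ?h // -map_comp; apply/eq_in_map => j jp /=.
by rewrite (nth_map x0) ?h.
Qed.

Lemma occE i l : occurrences i l = count_mem i l.
Proof. by elim: l => //= x l ->; rewrite -eqnE; case: eqn. Qed.

Lemma is_permP n p : is_perm n p -> perm_eq p (iota 0 n).
Proof.
rewrite /is_perm lazy_allE => /andP[/allP h /eqP sp].
have sub : {subset iota 0 n <= p}.
  by move=> i /h; rewrite occE -has_pred1 has_count => /eqP->.
have ui := iota_uniq 0 n.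
have sz : size p <= size (iota 0 n) by rewrite size_iota sp.
apply: uniq_perm => //; first exact: leq_size_uniq ui sub sz.
by case: (uniq_min_size ui sub sz) => _ E i; rewrite E.
Qed.

Lemma canon_adjacency (e : rel T) zs :
  exists2 ys, perm_eq ys zs & canon (adjacency e zs) = adjacency e ys.
Proof.
rewrite /canon; case: ifP => [|_]; last by exists zs.
case: zs => [|x0 zs]; first by exists [::] => //=.
rewrite size_map => /is_permP pp; set z := x0 :: zs in pp *.
exists [seq nth x0 z i | i <- canon_perm (adjacency e z)].
  by rewrite -[X in perm_eq _ X](mkseq_nth x0) perm_map.
apply: relabel_adjacency; apply/allP => i; by rewrite (perm_mem pp) mem_iota.
Qed.

End Mat.

Lemma seq_min (T : eqType) (F : T -> nat) x0 (s : seq T) :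
  exists2 x, x \in x0 :: s & {in x0 :: s, forall y, F x <= F y}.
Proof.
elim: s x0 => [|y s IH] x0.
  by exists x0; rewrite ?mem_head // => y; rewrite inE => /eqP->.
have [x xs xm] := IH y; case: (leqP (F x) (F x0)) => [le|lt].
  by exists x => [|z]; rewrite inE ?xs ?orbT // => /orP[/eqP->|/xm].
exists x0 => [|z]; first exact: mem_head.
rewrite inE => /orP[/eqP->//|/xm]; apply: leq_trans; exact: ltnW.
Qed.

(** A vertex of minimum degree is deleted and put back as the last one, which passes the degree
    filter. Isomorphism appears only as a reordering of the list of vertices, so [e] and [f] stay
    fixed throughout. *)
Lemma canonical_graphs_complete n : forall (T : eqType) (e f : rel T) (xs : seq T),
  symmetric e -> symmetric f -> irreflexive e -> irreflexive f ->
  diamond_free e -> H3_free f ->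
  {in xs &, forall x y, x != y -> f x y = ~~ e x y} ->
  uniq xs -> size xs = n ->
  exists2 ys, perm_eq ys xs & adjacency e ys \in canonical_graphs n.
Proof.
elim: n => [|n IH] T e f xs es fs ei fi eD fH ef u sz.
  by case: xs sz {u ef} => // _; exists [::].
case: xs sz ef u => // x0 xs0; set xs := x0 :: xs0 => sz ef u.
have [x xx xm] := seq_min (fun x => count (e x) xs) x0 xs0.
have prem : perm_eq (x :: rem x xs) xs by rewrite perm_sym perm_to_rem.
have [||| ys pys ysL] := IH T e f (rem x xs) es fs ei fi eD fH.
- by move=> y z /mem_rem yx /mem_rem zx; apply: ef.
- exact: rem_uniq.
- by rewrite size_rem // sz.
have pxy : perm_eq (rcons ys x) xs.
  by rewrite perm_rcons -(perm_cons x) in pys *; apply: perm_trans pys prem.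
have uy : uniq (rcons ys x) by rewrite (perm_uniq pxy).
have [xny uys] : x \notin ys /\ uniq ys by move: uy; rewrite rcons_uniq => /andP.
have ef' : {in rcons ys x &, forall y z, y != z -> f y z = ~~ e y z}.
  by move=> y z; rewrite !(perm_mem pxy); apply: ef.
have efy : {in ys &, forall y z, y != z -> f y z = ~~ e y z}.
  by move=> y z yy zy; apply: ef'; rewrite mem_rcons inE ?yy ?zy orbT.
have [zs pzs zsE] := canon_adjacency e (rcons ys x).
exists zs; first exact: perm_trans pzs pxy.
rewrite (_ : canonical_graphs n.+1 = next_level (canonical_graphs n) [::]) //.
apply: (@step_all_sub _ _ (adjacency e ys)); apply/orP; right; rewrite ysL /= -zsE.
apply: map_f; rewrite mem_filter; apply/andP; split.
  rewrite mindegE; apply/allP => r /mapP[y yy ->].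
  have -> : last [::] (adjacency e (rcons ys x)) = map (e x) (rcons ys x).
    by rewrite /adjacency map_rcons last_rcons.
  rewrite !deg_map !(permP pxy); apply: xm.
  by rewrite -(perm_mem pxy).
rewrite -add_vertex_adjacency //; apply: map_f.
rewrite (complement_adjacency fi uys efy).
have := @neighbourhoods_sound T e f (extends_diamond_free (adjacency e ys)) (extends_H3_free
  (adjacency f ys)) x ys [::] [::].
rewrite /= cats0; apply.
- move=> pre y post E exy; rewrite E in uys xny *.
  apply: extends_diamond_freeP => //; move: uys; rewrite uniq_catC /= mem_cat negb_or.
  by case/andP => /andP[].
- move=> pre y post E exy; rewrite E in uys xny *.
  apply: extends_H3_freeP => //; move: uys; rewrite uniq_catC /= mem_cat negb_or.
  by case/andP => /andP[].
move=> y yy; apply: ef'; rewrite ?mem_rcons ?mem_head // ?inE ?yy ?orbT //.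
by apply: contraNneq xny => ->.
Qed.

(** * Soundness of the gluing search *)

Section SearchSound.

Variables (T : eqType) (e f : rel T) (V ys : seq T) (v : T).
Hypotheses (es : symmetric e) (fs : symmetric f) (ei : irreflexive e) (fi : irreflexive f).
Hypotheses (eH : H3_free e) (fH : H3_free f).
Hypothesis ef : {in V &, forall x y, x != y -> f x y = ~~ e x y}.
Hypothesis edeg : {in V, forall x, 9 <= count (e x) V}.
Hypothesis fdeg : {in V, forall x, 9 <= count (f x) V}.

(** The colour between [w] and [w'] is still open and does not matter: a triangle with two common
    neighbours contains H3 with or without the edge between them. *)
Lemma no_triangle_in_sound (xs : seq T) (w w' : T) :
  w \in ys ++ xs -> w' \notin ys ++ xs ->
  no_triangle_in (adjacency f (ys ++ xs)) (meet_rows (map (f w') ys) (map (f w) (ys ++ xs))).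
Proof.
move=> wz wz'; rewrite meet_rows_mapr /no_triangle_in lazy_allE /adjacency mask_map.
apply/allP => r /mapP[x]; rewrite mem_filter => /andP[/andP[/= fwx' fwx] xy] ->{r}.
rewrite meet_rows_mapl lazy_allE mask_map.
apply/allP => r /mapP[y]; rewrite mem_filter => /andP[/andP[/= fxy /andP[/= fwy' fwy]] yy] ->{r}.
rewrite meet_rows_mapl some_true_map; apply/hasPn => z zy; apply/negP.
case/and3P => /= fyz fxz /andP[fwz' fwz].
by move: wz'; rewrite (fH (x := x) (y := y) (z := z) (u := w') (w := w)) ?wz // fs.
Qed.

Lemma compatible_sound (zs xs : seq T) (w w' : T) :
  zs = ys ++ xs -> uniq zs -> w \in zs -> w \notin ys -> w' \notin zs ->
  {subset w' :: zs <= V} ->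
  compatible (adjacency e zs) (adjacency f zs) (map (e w) zs) (map (f w) zs) (map (e w') ys).
Proof.
move=> E u wz wy wz' sV; rewrite /compatible.
have efy : {in ys, forall y, ~~ e w' y = f w' y}.
  move=> y yy; rewrite ef ?sV ?mem_head // ?inE ?E ?mem_cat ?yy ?orbT //.
  by apply: contraNneq wz' => ->; rewrite E mem_cat yy.
have -> : map negb (map (e w') ys) = map (f w') ys.
  by rewrite -map_comp; apply/eq_in_map => y /efy.
rewrite {1 2}E no_triangle_in_sound -?E //; case: ifP => // /negP nok.
have : f w' w.
  rewrite ef ?sV ?mem_head // ?inE ?wz ?orbT //; last first.
    by apply: contraNneq wz' => ->.
  apply/negP => ew; apply: nok; rewrite E in u wz' *.
  exact: extends_H3_freeP.
move=> fw; rewrite E in u wz' *; exact: extends_H3_freeP.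
Qed.

(** Traces listed before the first one carried by a vertex of [ws] are carried by none, so dropping
    them keeps all traces of [ws] among the candidates; at that first one [go] answers [false]. *)
Lemma refute_all_sound go (ws : seq T) :
  (forall cs w, {in ws, forall w, map (e w) ys \in cs} -> w \in ws ->
     go cs (map (e w) ys) = false) ->
  forall br cs, {in ws, forall w, map (e w) ys \in cs} ->
  (exists2 w, w \in ws & map (e w) ys \in br) -> refute_all go br cs = false.
Proof.
move=> goP; elim=> [|c br IH] cs csP [w ww] //=; rewrite inE => wbr.
case: (boolP (has (fun w => map (e w) ys == c) ws)) => [/hasP[w' ww' /eqP <-]|/hasPn h].
  by rewrite goP.
case: ifP => // _; apply: IH => [w' ww'|].
  rewrite mem_filter csP // andbT; apply: contraNN (h _ ww') => /eqmP ->.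
  exact: eqxx.
by exists w => //; move: wbr; rewrite (negbTE (h _ ww)).
Qed.

(** A vertex of [ys] with at least 9 neighbours in [V] but fewer than 9 in [zs] has a neighbour in
    [ws], and the trace of this neighbour survives the restriction. *)
Lemma branch_sound (zs ws : seq T) (cs : seq (seq bool)) :
  perm_eq (zs ++ ws) V -> prefix ys zs -> 0 < size ws ->
  {in ws, forall w, map (e w) ys \in cs} ->
  {in ws & ys, forall w y, f w y = ~~ e w y} ->
  exists2 w, w \in ws & map (e w) ys \in branch (size ys) (adjacency e zs) (adjacency f zs) cs.
Proof.
move=> pV /prefixP[xs E] ws0 csP efy.
have all_cs : exists2 w, w \in ws & map (e w) ys \in cs.
  case: ws ws0 csP {pV efy} => // w ws _ csP.
  by exists w; rewrite ?csP ?mem_head.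
rewrite /branch; case: best_split => [[u b]|] //; case: (leqP (size ys) u) => // uy.
set g := if b then e else f.
have -> : (if b then adjacency e zs else adjacency f zs) = adjacency g zs by rewrite /g; case: (b).
have uz : u < size zs by rewrite E size_cat ltn_addr.
have [y0 _] : exists y0, y0 \in ys by case: ys uy => // y0 s _; exists y0; rewrite mem_head.
set y := nth y0 ys u; have yy : y \in ys by rewrite mem_nth.
have -> : nth [::] (adjacency g zs) u = map (g y) zs.
  by rewrite (nth_map y0) // E nth_cat uy.
rewrite deg_map; case: leqP => // lt9.
have yV : y \in V by rewrite -(perm_mem pV) E !mem_cat yy.
have gdeg : 9 <= count (g y) V by rewrite /g; case: (b); [apply: edeg | apply: fdeg].
have : has (g y) ws.
  move: gdeg; rewrite -(permP pV) count_cat has_count => h.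
  by rewrite -(ltn_add2l (count (g y) zs)) addn0; apply: leq_ltn_trans lt9 h.
case/hasP => w ww gw; exists w => //; rewrite mem_filter csP // andbT.
rewrite /has_val (nth_map y0) // -/y.
move: gw; rewrite /g; case: (b); first by rewrite es => ->.
by rewrite fs efy // => /negbTE->.
Qed.

(** An existing colouring of [V] traces a path through the search tree, with [ws1] already placed
    and [ws2] still to come. No filter cuts this path, and it ends at fuel 0, where the answer is
    [false]. *)
Lemma gluing_fails_sound fuel : forall ws1 ws2 cs,
  size ws2 = fuel -> perm_eq (ys ++ v :: ws1 ++ ws2) V -> uniq V ->
  {in ws1 ++ ws2, forall w, f w v} ->
  {in ws2, forall w, map (e w) ys \in cs} ->
  gluing_fails fuel (size ys) (adjacency e (ys ++ v :: ws1)) (adjacency f (ys ++ v :: ws1)) cs =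
    false.
Proof.
elim: fuel => [|n IH] ws1 ws2 cs sz pV uV fv csP //=.
set zs := ys ++ v :: ws1.
have pV' : perm_eq (zs ++ ws2) V by rewrite /zs -catA cat_cons.
have uz : uniq (zs ++ ws2) by rewrite (perm_uniq pV').
have sV : {subset zs ++ ws2 <= V} by move=> x; rewrite (perm_mem pV').
have nz w : w \in ws2 -> w \notin zs.
  move=> ww; apply/negP => wz.
  by move: uz; rewrite cat_uniq => /and3P[_ /hasPn /(_ _ ww)]; rewrite /= wz.
have efz : {in ws2 & zs, forall w y, f w y = ~~ e w y}.
  move=> w y ww yz.
  have wV : w \in V by apply: sV; rewrite mem_cat ww orbT.
  have yV : y \in V by apply: sV; rewrite mem_cat yz.
  by rewrite ef //; apply: contraNneq (nz _ ww) => ->.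
have yz : {subset ys <= zs} by move=> y yy; rewrite mem_cat yy.
apply: (@refute_all_sound _ ws2) => //; last first.
  apply: branch_sound => //; rewrite ?prefix_prefix ?sz //.
  by move=> w y ww /yz; apply: efz.
move=> {}cs w {}csP ww; rewrite lazy_allE; apply/negbTE/allPn.
exists (map (e w) zs).
  have fwv : f w v by rewrite fv // mem_cat ww orbT.
  have nwv : e w v = false by apply/negbTE; rewrite -efz // mem_cat mem_head orbT.
  have E1 : rcons (map (e w) ys) false = map (e w) (rcons ys v).
    by rewrite map_rcons nwv.
  have E2 : rcons (map negb (map (e w) ys)) true = map (f w) (rcons ys v).
    rewrite map_rcons fwv -map_comp; congr rcons; apply/eq_in_map => y /yz yy /=.
    by rewrite efz.
  have zE : zs = rcons ys v ++ ws1 ++ [::] by rewrite cats0 cat_rcons.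
  have D g : drop (size ys).+1 (adjacency g zs) = [seq map (g x) zs | x <- ws1].
    have -> : adjacency g zs = map (fun x => map (g x) zs) (rcons ys v) ++
                         map (fun x => map (g x) zs) ws1.
      by rewrite -map_cat cat_rcons.
    by rewrite drop_size_cat // size_map size_rcons.
  have uz' : uniq zs by move: uz; rewrite cat_uniq => /and3P[].
  have wz := nz _ ww.
  have := @neighbourhoods_sound T e f (extends_H3_free (adjacency e zs)) (extends_H3_free
    (adjacency f zs)) w ws1 (rcons ys v) [::].
  rewrite -zE E1 E2 !D [rcons ys v ++ ws1]cat_rcons; apply.
  - move=> pre x post E exy; rewrite E in uz' wz *.
    apply: extends_H3_freeP => //; move: uz'; rewrite uniq_catC /= mem_cat negb_or.
    by case/andP => /andP[].
  - move=> pre x post E exy; rewrite E in uz' wz *.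
    apply: extends_H3_freeP => //; move: uz'; rewrite uniq_catC /= mem_cat negb_or.
    by case/andP => /andP[].
  by move=> x xw; apply: efz; rewrite // mem_cat inE xw !orbT.
apply/negbT.
have -> : map negb (map (e w) zs) = map (f w) zs.
  by rewrite -map_comp; apply/eq_in_map => y yy /=; rewrite efz.
rewrite !add_vertex_adjacency // -{1}(ei w) -{1}(fi w) -!map_rcons.
have [p1 [p2 ws2E]] : exists p1 p2, ws2 = p1 ++ w :: p2.
  by case/splitPr: ww => p1 p2; exists p1, p2.
have zE : rcons zs w = ys ++ v :: rcons ws1 w by rewrite /zs rcons_cat.
have pw : perm_eq (ys ++ v :: rcons ws1 w ++ (p1 ++ p2)) V.
  apply: perm_trans pV; rewrite perm_cat2l perm_cons cat_rcons perm_cat2l ws2E.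
  by rewrite perm_sym -[w :: p2]cat1s perm_catCA.
have uz2 : uniq (rcons zs w ++ (p1 ++ p2)) by rewrite zE -catA cat_cons (perm_uniq pw).
rewrite zE; apply: IH pw uV _ _.
- by move: sz; rewrite ws2E !size_cat /= addnS => -[].
- move=> x xx; apply: fv; move: xx.
  rewrite ws2E !mem_cat mem_rcons !inE; case/orP=> [/orP[/eqP->|->]|/orP[]->];
  by rewrite ?eqxx ?orbT.
move=> x xx; have x2 : x \in ws2.
  by rewrite ws2E mem_cat inE; move: xx; rewrite mem_cat => /orP[]->; rewrite ?orbT.
rewrite mem_filter csP // andbT -zE.
have nw : x \notin rcons zs w.
  apply/negP => xz; move: uz2; rewrite cat_uniq => /and3P[_ /hasPn /(_ _ xx)].
  by rewrite /= xz.
apply: (compatible_sound (xs := rcons (v :: ws1) w)).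
- by rewrite zE.
- by move: uz2; rewrite cat_uniq => /and3P[].
- by rewrite mem_rcons mem_head.
- by apply: contra (yz w) _; apply: nz.
- exact: nw.
move=> y; rewrite inE => /orP[/eqP->|]; first by rewrite sV // mem_cat x2 orbT.
by rewrite mem_rcons inE => /orP[/eqP->|yy]; rewrite sV // mem_cat ?ww ?yy ?orbT.
Qed.
End SearchSound.

(** * Two-colour Ramsey bounds *)

Definition has_tri (rows : seq (seq bool)) : bool :=
  has (fun rx => has (fun ry => some_true (meet_rows rx ry)) (mask rx rows)) rows.

Definition has_K4 (rows : seq (seq bool)) : bool :=
  has (fun rx => has (fun ry =>
    let c := meet_rows rx ry in has (fun rz => some_true (meet_rows rz c)) (mask c rows))
    (mask rx rows)) rows.

(** Triangle-free graphs are diamond-free and diamond-free graphs are H3-free, so one generation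
    serves every bound. The entries give R(K3, K3) <= 6, R(K4 - e, K3) <= 7, a K4 in the second
    colour from 9 vertices on if the first is triangle-free, R(K3, H3) <= 11, the refutation of
    neighbourhoods with 11 and 12 vertices, and R(K4 - e, H3) <= 13. The [let]s make each level
    computed once. *)
Definition certificate : bool :=
  let L6 := canonical_graphs 6 in
  let L7 := next_level L6 [::] in
  let L9 := next_level (next_level L7 [::]) [::] in
  let L11 := next_level (next_level L9 [::]) [::] in
  let L12 := next_level L11 [::] in
  [&& lazy_all (fun g => has_tri g || has_tri (complement g)) L6,
      lazy_all (fun g => has_tri (complement g)) L7,
      lazy_all (fun g => has_tri g || has_K4 (complement g)) L9,
      lazy_all has_tri L11, lazy_all not_neighbourhood L11, lazy_all not_neighbourhood L12 &
      lazy_all (fun=> false) (next_level L12 [::])].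

Lemma certificateP : certificate.
Proof. vm_cast_no_check (erefl true). Qed.

Lemma certificateE :
  [/\ all (fun g => has_tri g || has_tri (complement g)) (canonical_graphs 6),
      all (fun g => has_tri (complement g)) (canonical_graphs 7),
      all (fun g => has_tri g || has_K4 (complement g)) (canonical_graphs 9),
      all has_tri (canonical_graphs 11) &
      [/\ all not_neighbourhood (canonical_graphs 11), all not_neighbourhood (canonical_graphs 12) &
          all (fun=> false) (canonical_graphs 13)]].
Proof.
have lS n : canonical_graphs n.+1 = next_level (canonical_graphs n) [::] by [].
rewrite (lS 12) (lS 11) (lS 10) (lS 9) (lS 8) (lS 7) (lS 6).
have := certificateP; rewrite /certificate.
(* The levels become variables, so that the boolean manipulation below cannot evaluate them
   again. *)
move: (canonical_graphs 6) => L6; move: (next_level L6 [::]) => L7.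
move: (next_level (next_level L7 [::]) [::]) => L9.
move: (next_level (next_level L9 [::]) [::]) => L11.
rewrite !lazy_allE => /and5P[? ? ? ? /and3P[? ? ?]].
by split => //; split.
Qed.

Opaque canonical_graphs.

Lemma K3_diamond_free (T : Type) (e : rel T) : K3_free e -> diamond_free e.
Proof. by move=> h x y z w exy exz eyz; case: (h x y z). Qed.

Lemma diamond_H3_free (T : Type) (e : rel T) :
  symmetric e -> diamond_free e -> H3_free e.
Proof.
move=> es h x y z u w exy exz eyz exu eyu ezu exw eyw ezw.
exact: (h x y u w).
Qed.

Lemma mask_map0 (T U : Type) (P : pred T) (h : T -> U) s :
  mask (map P s) (map h s) = map h (filter P s).
Proof. by have := mask_map P h s [::]; rewrite cats0. Qed.

Lemma has_tri_sound (T : eqType) (e : rel T) zs :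
  K3_free e -> ~~ has_tri (adjacency e zs).
Proof.
move=> h; apply/hasPn => r /mapP[x xz ->{r}]; apply/hasPn => r.
rewrite /adjacency mask_map0 => /mapP[y]; rewrite mem_filter => /andP[exy yz] ->{r}.
rewrite meet_rows_map some_true_map; apply/hasPn => z zz; apply/negP => /andP[/= exz eyz].
exact: (h x y z).
Qed.

Lemma has_K4_sound (T : eqType) (e : rel T) zs : has_K4 (adjacency e zs) ->
  exists x y z w, [/\ [/\ x \in zs, y \in zs, z \in zs & w \in zs],
    [/\ e x y, e x z & e x w] & [/\ e y z, e y w & e z w]].
Proof.
case/hasP => r /mapP[x xz ->{r}] /hasP[r].
rewrite /adjacency mask_map0 => /mapP[y]; rewrite mem_filter => /andP[exy yz] ->{r}.
rewrite meet_rows_map => /hasP[r].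
rewrite /adjacency mask_map0 => /mapP[z]; rewrite mem_filter => /andP[/andP[/= exz eyz] zz] ->{r}.
rewrite meet_rows_map some_true_map => /hasP[w wz /and3P[/= ezw exw eyw]].
by exists x, y, z, w.
Qed.

(** The freeness predicates quantify over the whole type; restricting the relation lets a property
    of a neighbourhood be stated with them. *)
Definition restr (T : Type) (P : pred T) (e : rel T) : rel T :=
  fun x y => [&& P x, P y & e x y].

Section Restr.
Variables (T : Type) (P : pred T) (e : rel T).
Lemma restr_sym : symmetric e -> symmetric (restr P e).
Proof. by move=> es x y; rewrite /restr es andbCA. Qed.
Lemma restr_irr : irreflexive e -> irreflexive (restr P e).
Proof. by move=> ei x; rewrite /restr ei !andbF. Qed.
Lemma restr_H3 : H3_free e -> H3_free (restr P e).
Proof.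
move=> h x y z u w /and3P[_ _ xy] /and3P[_ _ xz] /and3P[_ _ yz] /and3P[_ _ xu].
move=> /and3P[_ _ yu] /and3P[_ _ zu] /and3P[_ _ xw] /and3P[_ _ yw] /and3P[_ _ zw].
exact: (h x y z).
Qed.
End Restr.

Section Ramsey.

Variables (T : finType) (e f : rel T) (S : {set T}).
Hypotheses (es : symmetric e) (fs : symmetric f) (ei : irreflexive e) (fi : irreflexive f).
Hypothesis ef : {in S &, forall x y, x != y -> f x y = ~~ e x y}.

Lemma canonical_subgraph n : n <= #|S| -> diamond_free e -> H3_free f ->
  exists ys : seq T, [/\ uniq ys, size ys = n, {subset ys <= S},
    adjacency e ys \in canonical_graphs n & complement (adjacency e ys) = adjacency f ys].
Proof.
move=> nS eD fH; pose xs := take n (enum S).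
have sx : {subset xs <= S} by move=> x /mem_take; rewrite mem_enum.
have ux : uniq xs by rewrite take_uniq // enum_uniq.
have zx : size xs = n by rewrite size_takel // -cardE.
have efx : {in xs &, forall x y, x != y -> f x y = ~~ e x y}.
  by move=> x y /sx xS /sx yS; apply: ef.
have [ys py yL] := canonical_graphs_complete es fs ei fi eD fH efx ux zx.
exists ys; split=> //; first by rewrite (perm_uniq py).
- by rewrite (perm_size py).
- by move=> y; rewrite (perm_mem py) => /sx.
rewrite (@complement_adjacency _ e f) ?(perm_uniq py) // => x y.
by rewrite !(perm_mem py); apply: efx.
Qed.

Lemma ramsey_K3_K3 : K3_free e -> K3_free f -> #|S| <= 5.
Proof.
move=> e3 f3; rewrite leqNgt; apply/negP => lt.
have fH := diamond_H3_free fs (K3_diamond_free f3).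
have [ys [_ _ _ yL E]] := canonical_subgraph lt (K3_diamond_free e3) fH.
have [/allP/(_ _ yL) h _ _ _ _] := certificateE; clear yL; move: h.
by rewrite E (negbTE (has_tri_sound _ e3)) (negbTE (has_tri_sound _ f3)).
Qed.

Lemma ramsey_diamond_K3 : diamond_free e -> K3_free f -> #|S| <= 6.
Proof.
move=> eD f3; rewrite leqNgt; apply/negP => lt.
have fH := diamond_H3_free fs (K3_diamond_free f3).
have [ys [_ _ _ yL E]] := canonical_subgraph lt eD fH.
have [_ /allP/(_ _ yL) h _ _ _] := certificateE; clear yL; move: h.
by rewrite E (negbTE (has_tri_sound _ f3)).
Qed.

Lemma ramsey_K3_H3 : K3_free e -> H3_free f -> #|S| <= 10.
Proof.
move=> e3 fH; rewrite leqNgt; apply/negP => lt.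
have [ys [_ _ _ yL E]] := canonical_subgraph lt (K3_diamond_free e3) fH.
have [_ _ _ /allP/(_ _ yL) h _] := certificateE; clear yL; move: h.
by rewrite (negbTE (has_tri_sound _ e3)).
Qed.

Lemma ramsey_diamond_H3 : diamond_free e -> H3_free f -> #|S| <= 12.
Proof.
move=> eD fH; rewrite leqNgt; apply/negP => lt.
have [ys [_ _ _ yL E]] := canonical_subgraph lt eD fH.
by have [_ _ _ _ [_ _ /allP/(_ _ yL)]] := certificateE.
Qed.

Lemma ramsey_K3_K4 : K3_free e -> H3_free f -> 9 <= #|S| ->
  exists x y z w, [/\ [/\ x \in S, y \in S, z \in S & w \in S],
    [/\ f x y, f x z & f x w] & [/\ f y z, f y w & f z w]].
Proof.
move=> e3 fH le; have [ys [_ _ sy yL E]] := canonical_subgraph le (K3_diamond_free e3) fH.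
have [_ _ /allP/(_ _ yL) h _ _] := certificateE; clear yL; move: h.
rewrite E (negbTE (has_tri_sound _ e3)) => /has_K4_sound[x [y [z [w [[? ? ? ?] A B]]]]].
by exists x, y, z, w; split=> //; split; apply: sy.
Qed.

End Ramsey.

Lemma map_const_in (T : eqType) (P : pred T) b (s : seq T) :
  {in s, forall x, P x = b} -> map P s = nseq (size s) b.
Proof.
move=> h; rewrite -(size_map P); apply/all_pred1P; rewrite all_map.
by apply/allP => x /h /= ->.
Qed.

Lemma not_neighbourhood_sound (T : eqType) (e f : rel T) (ys ws : seq T) (v : T) :
  symmetric e -> symmetric f -> irreflexive e -> irreflexive f ->
  H3_free e -> H3_free f -> let V := ys ++ v :: ws in uniq V ->
  {in V &, forall x y, x != y -> f x y = ~~ e x y} ->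
  {in V, forall x, 9 <= count (e x) V} -> {in V, forall x, 9 <= count (f x) V} ->
  {in ys, forall y, e v y} -> {in ws, forall w, f w v} -> size ys + size ws = 21 ->
  not_neighbourhood (adjacency e ys) = false.
Proof.
move=> es fs ei fi eH fH V uV ef ed fd ev fv sz.
have uyv : uniq (rcons ys v).
  by move: uV; rewrite /V -cat_rcons cat_uniq => /and3P[].
have [vy uy] : v \notin ys /\ uniq ys by move: uyv; rewrite rcons_uniq => /andP.
have yV : {subset ys <= V} by move=> y yy; rewrite mem_cat yy.
have efy : {in ys &, forall x y, x != y -> f x y = ~~ e x y}.
  by move=> x y /yV xV /yV yV'; apply: ef.
have efz : {in ws & rcons ys v, forall w y, f w y = ~~ e w y}.
  move=> w y ww yy.
  have wV : w \in V by rewrite mem_cat inE ww !orbT.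
  have yV' : y \in V by rewrite /V -cat_rcons mem_cat yy.
  rewrite ef //; apply/eqP => wy; move: uV; rewrite /V -cat_rcons cat_uniq.
  by case/and3P => _ /hasPn/(_ _ ww); rewrite wy /= yy.
rewrite /not_neighbourhood (complement_adjacency fi uy efy).
have sm : size (adjacency e ys) = size ys by rewrite size_map.
have -> : nseq (size (adjacency e ys)) true = map (e v) ys.
  by rewrite sm; apply/esym/map_const_in => y yy; rewrite ev.
have -> : nseq (size (adjacency e ys)) false = map (f v) ys.
  rewrite sm; apply/esym/map_const_in => y yy.
  rewrite ef ?ev // ?(yV _ yy) // ?mem_cat ?mem_head ?orbT //.
  by apply: contraNneq vy => ->.
rewrite !add_vertex_adjacency // sm.
have -> : 21 - size ys = size ws by rewrite -sz addKn.
have Eg g : take (size ys) (adjacency g (rcons ys v)) = [seq map (g x) (rcons ys v) | x <- ys].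
  have -> : adjacency g (rcons ys v) = [seq map (g x) (rcons ys v) | x <- ys ++ [:: v]].
    by rewrite cats1.
  by rewrite map_cat take_size_cat // size_map.
rewrite !Eg -cats1.
apply: (gluing_fails_sound es fs ei fi eH fH ef ed fd (ws1 := [::])) => // w ww.
have := @neighbourhoods_sound T e f (extends_H3_free (adjacency e (rcons ys v))) (extends_H3_free
  (adjacency f (rcons ys v))) w ys [::] [:: v].
rewrite /= cats1; apply.
- move=> pre x post E ex; rewrite E in uyv *.
  apply: extends_H3_freeP => //; first by rewrite -E; apply/negP => wy; move: (efz _ _ ww wy);
    rewrite ei fi.
  by move: uyv; rewrite uniq_catC /= mem_cat negb_or => /andP[/andP[]].
- move=> pre x post E ex; rewrite E in uyv *.
  apply: extends_H3_freeP => //; first by rewrite -E; apply/negP => wy; move: (efz _ _ ww wy);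
    rewrite ei fi.
  by move: uyv; rewrite uniq_catC /= mem_cat negb_or => /andP[/andP[]].
by move=> x xy; rewrite efz // mem_rcons inE xy orbT.
Qed.

(** * The bound R(H3, H3) <= 22 *)

Section RamseyHH.

Variables (T : finType).

(** A diamond among the neighbours of [v] forms an H3 with [v], so the neighbourhood satisfies the
    hypotheses of the generation. *)
Lemma neighbours_restr (e f : rel T) (S : {set T}) v : let N := [set x in S | e v x] in
  symmetric e -> v \in S -> H3_free e ->
  {in S &, forall x y, x != y -> f x y = ~~ e x y} ->
  diamond_free (restr (mem N) e) /\
  {in N &, forall x y, x != y -> restr (mem N) f x y = ~~ restr (mem N) e x y}.
Proof.
move=> N es vS eH ef; split.
  move=> x y z w /and3P[/= xN yN exy] /and3P[_ /= zN exz] /and3P[_ _ eyz].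
  move=> /and3P[_ /= wN exw] /and3P[_ _ eyw]; move: xN yN zN wN.
  by rewrite !inE => /andP[_ vx] /andP[_ vy] /andP[_ vz] /andP[_ vw]; apply: (eH v x y).
move=> x y xN yN xy; rewrite /restr /= xN yN /=; apply: ef => //.
  by move: xN; rewrite inE => /andP[].
by move: yN; rewrite inE => /andP[].
Qed.

Lemma degree_le (e f : rel T) (S : {set T}) v :
  symmetric e -> symmetric f -> irreflexive e -> irreflexive f ->
  {in S &, forall x y, x != y -> f x y = ~~ e x y} ->
  H3_free e -> H3_free f -> v \in S -> #|[set x in S | e v x]| <= 12.
Proof.
move=> es fs ei fi ef eH fH vS; have [eD efN] := neighbours_restr es vS eH ef.
set N := [set x in S | e v x] in eD efN *.
apply: (@ramsey_diamond_H3 _ (restr (mem N) e) (restr (mem N) f)) => //.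
- exact: restr_sym.
- exact: restr_sym.
- exact: restr_irr.
- exact: restr_irr.
exact: restr_H3.
Qed.

Lemma neighbours_canonical (e f : rel T) (S : {set T}) v : let N := [set x in S | e v x] in
  symmetric e -> symmetric f -> irreflexive e -> irreflexive f ->
  {in S &, forall x y, x != y -> f x y = ~~ e x y} ->
  H3_free e -> H3_free f -> v \in S ->
  exists2 ys, perm_eq ys (enum N) & adjacency e ys \in canonical_graphs #|N|.
Proof.
move=> N es fs ei fi ef eH fH vS; have [eD efN] := neighbours_restr es vS eH ef.
rewrite -/N in eD efN.
have efl : {in enum N &, forall x y, x != y ->
    restr (mem N) f x y = ~~ restr (mem N) e x y}.
  by move=> x y; rewrite !mem_enum; apply: efN.
have [ys py yL] := canonical_graphs_complete (restr_sym _ es) (restr_sym _ fs) (restr_irr _ ei)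
  (restr_irr _ fi) eD (@restr_H3 _ (mem N) f fH) efl (enum_uniq _) (esym (cardE _)).
exists ys => //; suff <- : adjacency (restr (mem N) e) ys = adjacency e ys by exact: yL.
clear yL; apply/eq_in_map => x xy.
apply/eq_in_map => y yy; rewrite /restr /=; move: xy yy.
by rewrite !(perm_mem py) !mem_enum => -> ->.
Qed.

(** Every vertex has at most 12 neighbours in each colour, hence at least 9 in the other; a
    neighbourhood of more than 10 vertices is then on one of the two lists refuted by the search. *)
Lemma big_degree (e f : rel T) (S : {set T}) v :
  symmetric e -> symmetric f -> irreflexive e -> irreflexive f ->
  {in S &, forall x y, x != y -> f x y = ~~ e x y} ->
  H3_free e -> H3_free f -> #|S| = 22 -> v \in S ->
  #|[set x in S | e v x]| <= 10.
Proof.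
move=> es fs ei fi ef eH fH S22 vS; rewrite leqNgt; apply/negP => lt.
have le12 := degree_le es fs ei fi ef eH fH vS.
have fe : {in S &, forall x y, x != y -> e x y = ~~ f x y}.
  by move=> x y xS yS xy; rewrite ef // negbK.
have split x : x \in S -> #|[set y in S | e x y]| + #|[set y in S | f x y]| = 21.
  move=> xS; have := cardsD1 x S; rewrite xS S22 add1n => -[->].
  rewrite -(cardsID [set y | e x y] (S :\ x)); congr (_ + _); apply: eq_card => y.
    by rewrite !inE; case: eqP => [->|_]; rewrite ?ei ?andbF.
  rewrite !inE; case: (altP (y =P x)) => [->|yx] /=; first by rewrite fi !andbF.
  by case yS: (y \in S); rewrite ?andbF //= andbT ef // eq_sym.
have [ys py yL] := neighbours_canonical es fs ei fi ef eH fH vS.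
have yE x : (x \in ys) = (x \in S) && e v x.
  by rewrite (perm_mem py) mem_enum inE.
pose ws := enum [set x in S | f v x].
pose V := ys ++ v :: ws.
have uV : uniq V.
  rewrite /V cat_uniq /= (perm_uniq py) !enum_uniq yE !mem_enum !inE fi ei !andbF /= !andbT.
  apply/hasPn => x; rewrite !mem_enum !inE => /andP[xS fx] /=; rewrite yE xS /=.
  by rewrite -ef //; apply: contraTneq fx => <-; rewrite fi.
have VS : V =i S.
  move=> x; rewrite mem_cat inE yE !mem_enum !inE.
  case: (altP (x =P v)) => [->|xv]; rewrite ?vS ?orbT //=.
  case xS: (x \in S) => //=; rewrite ef ?orbN //; by rewrite eq_sym.
have pV : perm_eq V (enum S).
  by apply: uniq_perm; rewrite ?enum_uniq // => x; rewrite mem_enum VS.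
have cnt (g : rel T) x : count (g x) V = #|[set y in S | g x y]|.
  rewrite (permP pV) -size_filter cardE /enum_mem -filter_predI; congr size.
  by apply: eq_filter => y; rewrite !inE andbC.
have st : not_neighbourhood (adjacency e ys) = false.
  apply: (@not_neighbourhood_sound T e f ys ws v) => //.
  - by move=> x y; rewrite !VS; apply: ef.
  - move=> x; rewrite VS cnt => xS; have := split x xS.
    have := degree_le fs es fi ei fe fH eH xS; lia.
  - move=> x; rewrite VS cnt => xS; have := split x xS.
    have := degree_le es fs ei fi ef eH fH xS; lia.
  - by move=> y; rewrite yE => /andP[].
  - by move=> w; rewrite mem_enum inE fs => /andP[].
  - by rewrite (perm_size py) -!cardE split.
have [_ _ _ _ [/allP l11 /allP l12 _]] := certificateE.
have [N11|N12] : #|[set x in S | e v x]| = 11 \/ #|[set x in S | e v x]| = 12 by lia.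
  by have := l11 (adjacency e ys); rewrite st -N11 yL => /(_ isT).
by have := l12 (adjacency e ys); rewrite st -N12 yL => /(_ isT).
Qed.

Lemma ramsey_H3_H3 (e f : rel T) (S : {set T}) :
  symmetric e -> symmetric f -> irreflexive e -> irreflexive f ->
  {in S &, forall x y, x != y -> f x y = ~~ e x y} ->
  H3_free e -> H3_free f -> #|S| <= 21.
Proof.
move=> es fs ei fi ef eH fH; rewrite leqNgt; apply/negP => lt.
pose S' := [set x in take 22 (enum S)].
have uS : uniq (take 22 (enum S)) by rewrite take_uniq // enum_uniq.
have S22 : #|S'| = 22 by rewrite cardsE (card_uniqP uS) size_takel // -cardE.
have S'S : {subset S' <= S} by move=> x; rewrite inE => /mem_take; rewrite mem_enum.
have ef' : {in S' &, forall x y, x != y -> f x y = ~~ e x y}.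
  by move=> x y /S'S xS /S'S yS; apply: ef.
have fe' : {in S' &, forall x y, x != y -> e x y = ~~ f x y}.
  by move=> x y xS yS xy; rewrite ef' // negbK.
have /card_gt0P[v vS] : 0 < #|S'| by rewrite S22.
(* With at most 10 neighbours in each colour, [v] accounts for only 1 + 10 + 10 = 21 vertices. *)
have h1 := big_degree es fs ei fi ef' eH fH S22 vS.
have h2 := big_degree fs es fi ei fe' fH eH S22 vS.
have : #|S'| <= #|[set v] :|: ([set x in S' | e v x] :|: [set x in S' | f v x])|.
  apply: subset_leq_card; apply/subsetP => x xS; rewrite !inE -!andb_orr.
  case: (altP (x =P v)) => //= xv; rewrite ef' // 1?eq_sym // orbN andbT.
  by move: xS; rewrite inE.
rewrite S22 => h3.
have h4 := (leq_card_setU [set v] ([set x in S' | e v x] :|: [set x in S' | f v x])).1.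
have h5 := (leq_card_setU [set x in S' | e v x] [set x in S' | f v x]).1.
by move: h4 h5; rewrite cards1; lia.
Qed.

End RamseyHH.

(** * The extremal function *)

(* [gmax p t h + 1] is the Gallai-Ramsey number for [t] colours K3, [h] colours H3 and
   some number of colours P3, positive if and only if [p] holds. *)
Definition gmax (p : bool) (t h : nat) : nat :=
  if p then
    match odd t, odd h with
    | false, false => 2 * 5 ^ t./2 * 17 ^ h./2
    | true, false => 4 * 5 ^ t./2 * 17 ^ h./2
    | true, true => 16 * 5 ^ t./2 * 17 ^ h./2
    | false, true => (if t == 0 then 6 else 32 * 5 ^ (t./2).-1) * 17 ^ h./2
    end
  else
    match odd h with
    | false => (if odd t then 2 else 1) * 5 ^ t./2 *
        (if h == 0 then 1 else 21 * 17 ^ (h./2).-1)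
    | true => (if odd t then 10 else 4) * 5 ^ t./2 * 17 ^ h./2
    end.

Arguments gmax : simpl never.

(** In the excluded case the values are 6 and 32, up to a power of 17, and 32 exceeds 5 * 6. *)
Lemma gmaxS5 p t h : ~~ [&& p, t == 0 & odd h] -> gmax p t.+2 h = 5 * gmax p t h.
Proof.
rewrite /gmax /= !negbK expnS.
have [->|t0] := eqVneq t 0; first by case: p; case: (odd h) => //=; lia.
move=> _; case: p; last by case: (odd h); lia.
case ot: (odd t); first by case: (odd h); lia.
case: (odd h); last lia.
have -> : t./2 = (t./2).-1.+1 by rewrite prednK // half_gt0; lia.
by rewrite expnS /=; lia.
Qed.

(** In the excluded case the factor is 21, owing to the special colouring on 21 vertices. *)
Lemma gmaxS17 p t h : p || (h != 0) -> gmax p t h.+2 = 17 * gmax p t h.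
Proof.
rewrite /gmax /= !negbK expnS; case: p => /=.
  by move=> _; case: (odd t); case: (odd h); lia.
move=> h0; case oh: (odd h); first by lia.
have -> : h./2 = (h./2).-1.+1 by rewrite prednK // half_gt0; lia.
by rewrite (negbTE h0) expnS /=; lia.
Qed.

(* All the inequalities that close the cases of the upper bound.  They are periodic
   in [t] and [h], by [gmaxS5] and [gmaxS17]. *)
Definition gmax_ineqs p t h : bool :=
  let a := gmax p t h in let c := gmax true t h in let d := gmax p t.+1 h in
  let e := gmax true t.+1 h in let tt := gmax p t.+2 h in let g := gmax p t h.+1 in
  let g1 := gmax true t h.+1 in let k := gmax p t.+1 h.+1 in let hh := gmax p t h.+2 in
  all id [:: 1 <= a; 2 <= c; a <= c; c <= d; 2 * a <= d; a + d <= g; 2 * c <= g; 5 * a <= tt;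
    d + 2 * a + 2 * c <= k; d + 5 * a <= k; 2 * d + 3 * a <= k; 2 * d + 2 * a + 1 <= k;
    5 * c <= k; 3 * c + 3 * a <= k; 8 * a <= k; 9 + a <= k; 6 * a + 1 <= k;
    tt + 4 * c <= hh; tt + 6 * a <= hh; tt + 2 * d + 2 <= hh; tt + 2 * (a + d) <= hh;
    e + 2 * c + g1 <= hh; e + 3 * a + g1 <= hh; e + d + 1 + g1 <= hh; e + a + d + g1 <= hh;
    d + 3 * a + k <= hh; d + 2 * c + k <= hh; 2 * d + 1 + k <= hh;
    2 * d + 2 * c + tt <= hh; 2 * d + 3 * a + tt <= hh; 3 * d + 1 + tt <= hh; 3 * d + a + tt <= hh;
    7 * c <= hh; 4 * c + k <= hh; 17 * a <= hh; 20 + a <= hh; 12 * a + 2 <= hh;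
    d + g1 + g + 1 <= hh].

(** All values of [gmax] are multiplied by 5, and the additive constants stand on the smaller sides
    only. Starting from [t.+1] avoids the exception in [gmaxS5]. *)
Lemma gmax_ineqs_t p t h : gmax_ineqs p t.+1 h -> gmax_ineqs p t.+3 h.
Proof.
by rewrite /gmax_ineqs (@gmaxS5 _ t.+3) ?(@gmaxS5 _ t.+2) ?(@gmaxS5 _ t.+1) ?andbF //=; lia.
Qed.

Lemma gmax_ineqs_h p t h : gmax_ineqs p t h.+1 -> gmax_ineqs p t h.+3.
Proof.
rewrite /gmax_ineqs !(@gmaxS17 _ _ h.+3) ?orbT // !(@gmaxS17 _ _ h.+2) ?orbT //.
by rewrite !(@gmaxS17 _ _ h.+1) ?orbT //=; lia.
Qed.

Lemma gmax_ineqsP p t h : gmax_ineqs p t h.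
Proof.
(* The value 0 lies outside the periodic range, so the base consists of 0 and one full period 1, 2
   in each variable. *)
have base t0 h0 : t0 < 3 -> h0 < 3 -> gmax_ineqs p t0 h0.
  by case: t0 => [|[|[|//]]] _; case: h0 => [|[|[|//]]] _; case: p; vm_compute.
have row t0 : t0 < 3 -> forall h0, gmax_ineqs p t0 h0.
  move=> lt h0; have [n] := ubnP h0; elim: n h0 => // n IH h0.
  case: (ltnP h0 3) => [l3 _|]; first exact: base.
  by case: h0 => [|[|[|h0]]] // _ lt0; apply/gmax_ineqs_h/IH; lia.
have [n] := ubnP t; elim: n t => // n IH t.
case: (ltnP t 3) => [l3 _|]; first exact: row.
by case: t => [|[|[|t]]] // _ lt0; apply/gmax_ineqs_t/IH; lia.
Qed.

(** Bound for the end of the peeling: two vertices are left and each of the [h] colours of type H3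
    has been peeled at most once. *)
Lemma gmax_ge p t h : [|| p, 0 < t | 0 < h] -> h.+2 <= gmax p t h.
Proof.
have [n] := ubnP h; elim: n h => // n IH h lt.
case: h lt => [|[|h]] lt pth.
- have := gmax_ineqsP false t.-1 0; have := gmax_ineqsP true t 0.
  rewrite /gmax_ineqs /=; clear IH lt; case: p pth => /= [_|]; first lia.
  by rewrite orbF => t0; rewrite (prednK t0); lia.
- have := gmax_ineqsP p t 0; rewrite /gmax_ineqs /=; lia.
have := gmax_ineqsP p t h; rewrite /gmax_ineqs /= => ine.
have : h.+1 <= n by lia.
case: h ine lt {pth} => [|h] ine lt hn; first lia.
have := IH h.+1 hn; rewrite !orbT => /(_ isT); lia.
Qed.

Section Coloring.

Variables (T : finType) (C : eqType) (c : T -> T -> C).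
Hypothesis csym : forall x y, c x y = c y x.
Hypothesis gal : forall x y z, x != y -> y != z -> x != z ->
  [|| c x y == c y z, c y z == c x z | c x y == c x z].

Implicit Types (S : {set T}) (r b : C).

(** * Gallai partitions *)

Definition two_coloured r b x y := (c x y == r) || (c x y == b).

Lemma gal_two_coloured r b x y z : x != y -> y != z -> x != z -> ~~ two_coloured r b x y ->
  two_coloured r b x z -> two_coloured r b y z -> c x z = c y z.
Proof.
move=> xy yz xz; rewrite /two_coloured => /norP[nr nb].
case/or3P: (gal xy yz xz) => /eqP E; rewrite ?E //.
  by move=> _; rewrite -E (negbTE nr) (negbTE nb).
by rewrite -E (negbTE nr) (negbTE nb).
Qed.

(** For suitable [r] and [b] this graph is disconnected, which is the form of Gallai's theorem
    proved below; its components are the parts. *)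
Definition other (S : {set T}) r b : rel T :=
  fun x y => [&& x \in S, y \in S, x != y & ~~ two_coloured r b x y].

Definition component (S : {set T}) r b x : {set T} := [set y | connect (other S r b) x y].

Lemma other_sym S r b : symmetric (other S r b).
Proof. by move=> x y; rewrite /other /two_coloured csym andbCA eq_sym. Qed.

Lemma other_csym S r b : connect_sym (other S r b).
Proof. exact/sym_connect_sym/other_sym. Qed.

Lemma component_refl S r b x : x \in component S r b x.
Proof. by rewrite inE connect0. Qed.

Lemma component_sym S r b x y : (y \in component S r b x) = (x \in component S r b y).
Proof. by rewrite !inE other_csym. Qed.

Lemma component_eq S r b x y : y \in component S r b x -> component S r b y = component S r b x.
Proof.
rewrite inE => xy; apply/setP => z; rewrite !inE.
by rewrite (same_connect (@other_csym S r b) xy).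
Qed.

Lemma component_sub S r b x : x \in S -> component S r b x \subset S.
Proof.
move=> xS; apply/subsetP => y; rewrite inE => /connectP[p].
by elim: p x xS => [x xS _ ->//|z p IH x xS /= /andP[/and4P[_ zS _ _] zp]]; apply: IH.
Qed.

Lemma component_sep S r b (A : {set T}) x w : x \in A -> w \notin A ->
  {in A & S, forall u v, v \notin A -> two_coloured r b u v} -> w \notin component S r b x.
Proof.
move=> xA wA h; rewrite inE; apply: contra wA => xw.
have cA : closed (other S r b) (mem A).
  apply: intro_closed; first exact: other_csym.
  move=> u v /and4P[uS vS uv nt] uA; apply: contraNT nt => vA; exact: h.
by rewrite -(closed_connect cA xw).
Qed.

Lemma component_tc S r b x w : x \in S -> w \in S -> w \notin component S r b x -> two_coloured r
  b x w.
Proof.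
move=> xS wS nw; have xw : x != w by apply: contraNneq nw => <-; apply: component_refl.
move: nw; rewrite inE; apply: contraNT => nt; apply: connect1.
by rewrite /other xS wS xw.
Qed.

(** At an edge coloured neither [r] nor [b], the two edges to [w] have colours among [r] and [b], so
    a triangle without three colours forces them to agree; this propagates along paths. *)
Lemma component_homog S r b x y w : x \in S -> w \in S -> y \in component S r b x ->
  w \notin component S r b x -> c y w = c x w.
Proof.
move=> xS wS; rewrite [y \in _]inE => /connectP[p pth ->] {y} nw.
elim: p x xS nw pth => //= z p IH x xS nw /andP[xz pth].
have zx : z \in component S r b x by rewrite inE connect1.
have zS : z \in S by case/and4P: xz.
have nwz : w \notin component S r b z by rewrite (component_eq zx).
rewrite IH //; case/and4P: xz => _ _ xz nt; apply/esym; apply: (gal_two_coloured xz _ _ nt).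
- by apply: contraNneq nwz => <-; apply: component_refl.
- by apply: contraNneq nw => <-; apply: component_refl.
- exact: component_tc nw.
- exact: component_tc nwz.
Qed.

(** Induction, adding a vertex [x] to a cut set [S']. A component that sees [x] in [r] and [b] only
    remains separated. If there is none, all edges at [x] of other colours share one colour [g], and
    [x] alone is cut off by [g] together with [r] or [b]. The two colours returned may coincide. *)
Lemma gallai_cut S : 1 < #|S| ->
  exists r b x w, [/\ x \in S, w \in S & w \notin component S r b x].
Proof.
have [n] := ubnP #|S|; elim: n S => // n IH S leS S1.
have /card_gt0P[x xS] : 0 < #|S| by apply: ltnW.
pose S' := S :\ x; have sz : #|S| = #|S'|.+1 by rewrite (cardsD1 x) xS.
have cut1 g d w : w \in S' -> {in S', forall y, two_coloured g d x y} ->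
    exists r b x w, [/\ x \in S, w \in S & w \notin component S r b x].
  move=> wS' h; exists g, d, x, w; split=> //; first by move: wS'; rewrite inE => /andP[].
  apply: (component_sep (A := [set x])); rewrite ?inE ?eqxx //.
    by move: wS'; rewrite !inE => /andP[].
  by move=> u v; rewrite !inE => /eqP-> vS vx; apply: h; rewrite !inE vx.
have [S'1|S'1] := leqP #|S'| 1.
  have /cards1P[w S'w] : #|S'| == 1 by rewrite eqn_leq S'1; lia.
  apply: (cut1 (c x w) (c x w) w); rewrite S'w ?inE //.
  by move=> y; rewrite inE => /eqP->; rewrite /two_coloured eqxx.
have [r [b [y0 [w0 [y0S w0S nw0]]]]] := IH S' (ltac:(lia)) S'1.
have sS y : y \in S' -> y \in S /\ y != x by rewrite !inE => /andP[].
have [all|] := boolP [forall y in S', [exists z in component S' r b y, ~~ two_coloured r b x z]];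
  last first.
  case/forall_inPn => y yS' /exists_inPn h.
  exists r, b, y, x; split=> //; first by case: (sS _ yS').
  apply: (component_sep (A := component S' r b y)); first exact: component_refl.
    by apply/negP => /(subsetP (component_sub r b yS')); rewrite !inE eqxx.
  move=> u v uy vS vy; have [->|vx] := eqVneq v x.
    by have := h _ uy; rewrite negbK /two_coloured csym.
  have vS' : v \in S' by rewrite !inE vx.
  have uS' := subsetP (component_sub r b yS') _ uy.
  by apply: (@component_tc S'); rewrite ?(component_eq uy).
have nbr y : y \in S' -> exists2 z, z \in component S' r b y & ~~ two_coloured r b x z.
  by move=> yS'; apply/exists_inP; move/forall_inP: all; apply.
have two y : y \in S' -> exists2 w, w \in S' & w \notin component S' r b y.
  move=> yS'; case: (boolP (y0 \in component S' r b y)) => [y0y|]; last by exists y0.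
  by exists w0 => //; rewrite -(component_eq y0y).
(* Between two components only [r] and [b] occur, so the other two sides of the triangle with [x]
   must be equal. *)
have same z1 z2 : z1 \in S' -> z2 \in S' -> z2 \notin component S' r b z1 ->
    ~~ two_coloured r b x z1 -> ~~ two_coloured r b x z2 -> c x z1 = c x z2.
  move=> z1S z2S nz n1 n2; have t12 := component_tc z1S z2S nz.
  have [[_ x1] [_ x2]] := (sS _ z1S, sS _ z2S).
  have z12 : z1 != z2 by apply: contraNneq nz => <-; apply: component_refl.
  rewrite eq_sym in x1; rewrite eq_sym in x2.
  case/or3P: (gal x1 z12 x2) => /eqP // E; first by move: n1;
    rewrite /two_coloured E -/(two_coloured r b z1 z2) t12.
  by move: n2; rewrite /two_coloured -E -/(two_coloured r b z1 z2) t12.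
have [g0 g0S ng0] := nbr _ y0S.
have g0S' := subsetP (component_sub r b y0S) _ g0S.
have gcol z : z \in S' -> ~~ two_coloured r b x z -> c x z = c x g0.
  move=> zS nz; case: (boolP (z \in component S' r b g0)) => [zg|ng]; last first.
    by apply/esym; apply: same.
  have [w wS nw] := two _ g0S'; have [h hw nh] := nbr _ wS.
  have hS := subsetP (component_sub r b wS) _ hw.
  have nhg : h \notin component S' r b g0.
    by rewrite component_sym -(component_eq hw) in nw *; rewrite component_sym.
  rewrite (same z h) // ?(component_eq zg) //; apply/esym; exact: same.
pose g := c x g0.
(* Every other component contains some [h] with [c x h] neither [r] nor [b]; the triangle on [x],
   [y], [h] gives [c y h = c x y = d], and homogeneity spreads this over the component. *)
have far y d : y \in S' -> two_coloured r b x y -> c x y = d ->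
    {in S', forall w, w \notin component S' r b y -> c y w = d}.
  move=> yS ty yd w wS nw; have [h hw nh] := nbr _ wS.
  have hS := subsetP (component_sub r b wS) _ hw.
  have nhy : h \notin component S' r b y.
    by rewrite component_sym -(component_eq hw) in nw *; rewrite component_sym.
  have <- : c y h = c y w.
    rewrite csym [RHS]csym; apply: component_homog hw _ => //; by rewrite component_sym.
  have tyh := component_tc yS hS nhy.
  have [[_ x1] [_ x2]] := (sS _ yS, sS _ hS).
  have yh : y != h by apply: contraNneq nhy => <-; apply: component_refl.
  rewrite eq_sym in x1; rewrite eq_sym in x2.
  rewrite -yd; apply/esym; rewrite [RHS]csym; apply: (gal_two_coloured x2 _ _ nh) => //.
    by rewrite eq_sym.
  by rewrite /two_coloured csym.
have [/exists_inP[y yS /eqP yr]|nr] := boolP [exists y in S', c x y == r]; last first.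
  apply: (cut1 g b y0) => // y yS; have := exists_inPn nr y yS.
  rewrite /two_coloured => nyr; case: (boolP (two_coloured r b x y));
    first by rewrite /two_coloured (negbTE nyr) => /= ->; rewrite orbT.
  by move/(gcol _ yS)=> ->; rewrite eqxx.
have [/exists_inP[z zS /eqP zb]|nb] := boolP [exists y in S', c x y == b]; last first.
  apply: (cut1 g r y0) => // z zS; have := exists_inPn nb z zS.
  rewrite /two_coloured => nzb; case: (boolP (two_coloured r b x z));
    first by rewrite /two_coloured (negbTE nzb) orbF => ->; rewrite orbT.
  by move/(gcol _ zS)=> ->; rewrite eqxx.
have ty : two_coloured r b x y by rewrite /two_coloured yr eqxx.
have tz : two_coloured r b x z by rewrite /two_coloured zb eqxx orbT.
have Fy := far y r yS ty yr; have Fz := far z b zS tz zb.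
suff rb : r = b.
  apply: (cut1 g r y0) => // u uS; case: (boolP (two_coloured r b x u)).
    by rewrite /two_coloured -rb orbb => ->; rewrite orbT.
  by move/(gcol _ uS)=> E; rewrite /two_coloured E eqxx.
(* In one component, [y] and [z] see an outside vertex [w] in the same colour, which is [r] for [y]
   and [b] for [z]; in different components, the edge between them has both colours. *)
case: (boolP (z \in component S' r b y)) => [zy|nz].
  have [w wS nw] := two _ yS.
  by have := component_homog yS wS zy nw; rewrite (Fz w) ?(component_eq zy) // (Fy w).
by have := csym y z; rewrite (Fy z) // (Fz y) // component_sym.
Qed.

End Coloring.

(** * Constraints on one colour and their behaviour under joins *)

Section Free.

Variables (T : finType) (k : nat) (c : T -> T -> 'I_k).
Hypothesis csym : forall x y, c x y = c y x.
Implicit Types (S A B X Y : {set T}) (i j : 'I_k).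

Definition colour_rel S i : rel T := fun x y => [&& x \in S, y \in S, x != y & c x y == i].

(* Levels 0, 1, 2, 3 stand for no edge, no P3, no K3, no H3 in colour [i] on [S]. *)
Definition free (l : nat) i S : Prop :=
  match l with
  | 0 => forall x y, colour_rel S i x y -> False
  | 1 => forall x y z, colour_rel S i x y -> colour_rel S i x z -> y = z
  | 2 => K3_free (colour_rel S i)
  | _ => H3_free (colour_rel S i)
  end.

Lemma cr_sym S i : symmetric (colour_rel S i).
Proof. by move=> x y; rewrite /colour_rel csym eq_sym andbCA. Qed.

Lemma cr_irr S i : irreflexive (colour_rel S i).
Proof. by move=> x; rewrite /colour_rel eqxx !andbF. Qed.

Lemma cr_sub S S' i x y : S \subset S' -> colour_rel S i x y -> colour_rel S' i x y.
Proof. by move=> /subsetP h /and4P[/h xS /h yS xy cxy]; apply/and4P. Qed.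

Lemma free_ext l i S S' : (forall x y, colour_rel S i x y -> colour_rel S' i x y) ->
  free l i S' -> free l i S.
Proof.
move=> h; case: l => [|[|[|l]]] /= fr.
- by move=> x y /h /fr.
- by move=> x y z /h xy /h xz; apply: (fr x).
- by move=> x y z /h xy /h xz /h yz; apply: (fr x y z).
move=> x y z u w /h xy /h xz /h yz /h xu /h yu /h zu /h xw /h yw /h zw.
exact: (fr x y z).
Qed.

Lemma free_sub l i S S' : S \subset S' -> free l i S' -> free l i S.
Proof. by move=> sub; apply: free_ext => x y; apply: cr_sub. Qed.

Lemma freeS l i S : free l i S -> free l.+1 i S.
Proof.
case: l => [|[|[|l]]] //= fr.
- by move=> x y z /fr.
- move=> x y z xy xz yz; move: (fr _ _ _ xy xz) => E.
  by move: yz; rewrite E cr_irr.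
exact: (diamond_H3_free (@cr_sym S i) (K3_diamond_free fr)).
Qed.

Lemma free_le l l' i S : l <= l' -> free l i S -> free l' i S.
Proof. by move=> /subnKC <-; elim: (l' - l) => [|n IH]; rewrite ?addn0 // addnS => /IH /freeS. Qed.

Lemma free0P i S : free 0 i S \/ exists x y, colour_rel S i x y.
Proof.
have [/existsP[x /existsP[y h]]|/existsPn h] := boolP [exists x, exists y, colour_rel S i x y].
  by right; exists x, y.
by left=> x y xy; move: (h x) => /existsPn/(_ y); rewrite xy.
Qed.

Lemma free1P i S : free 1 i S \/ exists x y z, [/\ colour_rel S i x y, colour_rel S i x z & y != z].
Proof.
have [/existsP[x /existsP[y /existsP[z /and3P[? ? ?]]]]|/existsPn h] :=
    boolP [exists x, exists y, exists z, [&& colour_rel S i x y, colour_rel S i x z & y != z]].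
  by right; exists x, y, z.
left=> x y z xy xz; apply/eqP; move: (h x) => /existsPn/(_ y)/existsPn/(_ z).
by rewrite xy xz negbK.
Qed.

Definition joined i A B : Prop := {in A & B, forall x y, x != y /\ c x y = i}.

Lemma joined_sym i A B : joined i A B -> joined i B A.
Proof. by move=> h x y xB yA; rewrite eq_sym csym; apply: h. Qed.

Section Join.

Variables (i : 'I_k) (S A B : {set T}).
Hypotheses (AS : A \subset S) (BS : B \subset S) (AB : joined i A B).

Lemma joined_cr x y : x \in A -> y \in B -> colour_rel S i x y.
Proof.
move=> xA yB; have [xy cxy] := AB xA yB; apply/and4P; split; rewrite ?cxy //.
  exact: (subsetP AS).
exact: (subsetP BS).
Qed.

Lemma joined_cr' x y : x \in A -> y \in B -> colour_rel S i y x.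
Proof. by move=> xA yB; rewrite cr_sym; apply: joined_cr. Qed.

Lemma cr_mem X x y : colour_rel X i x y -> x \in X /\ y \in X.
Proof. by case/and4P. Qed.

(** This and the next two lemmas list the ways H3 splits along a join: two vertices and a triangle,
    an edge and a P3, a P3 and an edge. *)
Lemma join2 : free 3 i S -> 1 < #|A| -> free 2 i B.
Proof.
move=> fr /card_gt1P[a [a' [aA aA' /eqP aa']]] x y z xy xz yz; apply: aa'.
have [[xB yB] [_ zB]] := (cr_mem xy, cr_mem xz).
apply: (fr x y z); first [exact: joined_cr | exact: joined_cr' | exact: (cr_sub BS) | exact:
  (cr_sub AS)].
Qed.

Lemma join1 : free 3 i S -> (exists x y, colour_rel A i x y) -> free 1 i B.
Proof.
move=> fr [a [a' aa']] x y z xy xz.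
have [[xB yB] [_ zB]] := (cr_mem xy, cr_mem xz); have [aA aA'] := cr_mem aa'.
apply: (fr a a' x); first [exact: joined_cr | exact: joined_cr' | exact: (cr_sub BS) | exact:
  (cr_sub AS)].
Qed.

Lemma join0 : free 3 i S -> (exists x y z, [/\ colour_rel A i x y, colour_rel A i x z & y != z]) ->
  free 0 i B.
Proof.
move=> fr [a [b [d [ab ad /eqP bd]]]] x y xy; apply: bd.
have [xB yB] := cr_mem xy; have [[aA bA] [_ dA]] := (cr_mem ab, cr_mem ad).
apply: (fr a x y); first [exact: joined_cr | exact: joined_cr' | exact: (cr_sub BS) | exact:
  (cr_sub AS)].
Qed.

Lemma join_K3 : free 2 i S -> A != set0 -> free 0 i B.
Proof.
move=> fr /set0Pn[a aA] x y xy; have [xB yB] := cr_mem xy.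
apply: (fr a x y); first [exact: joined_cr | exact: joined_cr' | exact: (cr_sub BS) | exact:
  (cr_sub AS)].
Qed.

End Join.

(** In each alternative the levels on the two sides add up to 2. *)
Definition join_alt i A B : Prop :=
  [\/ free 2 i A /\ free 0 i B, free 0 i A /\ free 2 i B | free 1 i A /\ free 1 i B].

Lemma join_H3 i S A B : A \subset S -> B \subset S -> joined i A B ->
  free 3 i S -> 1 < #|A| -> 1 < #|B| -> join_alt i A B.
Proof.
move=> AS BS AB fr A1 B1; have BA := joined_sym AB.
have [A0|Ae] := free0P i A.
  by apply: Or32; split=> //; apply: (join2 AS BS AB).
have fB1 := join1 AS BS AB fr Ae.
have [fA1|Ap] := free1P i A; first by apply: Or33.
apply: Or31; split; first exact: (join2 BS AS BA).
exact: (join0 AS BS AB).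
Qed.

Implicit Types (s : 'I_k -> nat).

Definition respects s S : Prop := forall i, free (s i) i S.

Definition gmax_of s : nat :=
  gmax (0 < #|[pred i | s i == 1]|) #|[pred i | s i == 2]| #|[pred i | s i == 3]|.

(* [gmax1] and [gmax2] are the extremal numbers when the levels of one colour or two
   colours are changed to given values. *)
Definition cnt1 j s l := #|[predD1 [pred i | s i == l] & j]|.
Definition gmax1 j s x : nat :=
  gmax ((x == 1) || (0 < cnt1 j s 1)) ((x == 2) + cnt1 j s 2) ((x == 3) + cnt1 j s 3).

Definition recolour j x s : 'I_k -> nat := fun i => if i == j then x else s i.

Lemma cnt_upd j s x l : #|[pred i | recolour j x s i == l]| = (x == l) + cnt1 j s l.
Proof.
rewrite (cardD1 j) inE /recolour eqxx; congr (_ + _); apply: eq_card => i.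
by rewrite !inE; case: (i =P j).
Qed.

Lemma gmax_upd j s x : gmax_of (recolour j x s) = gmax1 j s x.
Proof. by rewrite /gmax_of !cnt_upd addn_gt0 lt0b. Qed.

Lemma gmax1E j s : gmax_of s = gmax1 j s (s j).
Proof.
rewrite -gmax_upd /gmax_of.
suff E l : #|[pred i | s i == l]| = #|[pred i | recolour j (s j) s i == l]| by rewrite !E.
by apply: eq_card => i; rewrite !inE /recolour; case: (i =P j) => [->|].
Qed.

Definition cnt2 r b s l := #|[predD1 [predD1 [pred i | s i == l] & b] & r]|.
Definition gmax2 r b s x y : nat :=
  gmax [|| x == 1, y == 1 | 0 < cnt2 r b s 1] ((x == 2) + ((y == 2) + cnt2 r b s 2))
    ((x == 3) + ((y == 3) + cnt2 r b s 3)).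

Lemma gmax_upd2 r b s x y : r != b -> gmax_of (recolour r x (recolour b y s)) = gmax2 r b s x y.
Proof.
move=> rb; rewrite gmax_upd /gmax1 /gmax2.
suff E l : cnt1 r (recolour b y s) l = (y == l) + cnt2 r b s l.
  by rewrite !E addn_gt0 lt0b.
rewrite /cnt1 (cardD1 b) !inE eq_sym rb /recolour eqxx; congr (_ + _); apply: eq_card => i.
by rewrite !inE; case: eqP; rewrite ?andbF.
Qed.

Lemma gmax2E r b s : r != b -> gmax_of s = gmax2 r b s (s r) (s b).
Proof.
move=> rb; rewrite -gmax_upd2 // (gmax1E r) gmax_upd; rewrite /gmax1 /cnt1.
have E l : #|[predD1 [pred i | recolour b (s b) s i == l] & r]| = #|[predD1 [pred i | s i == l] &
  r]|.
  by apply: eq_card => i; rewrite !inE /recolour; case: (i =P b) => [->|].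
by rewrite !E.
Qed.

End Free.

(** * The upper bound *)

(* [lia] is slow in the large contexts below, so irrelevant hypotheses are cleared. *)
Ltac nat_lia :=
  repeat match goal with
  | H : ?P |- _ => lazymatch P with
      | is_true (leq _ _) => fail
      | is_true (andb _ _) => fail
      | is_true (orb _ _) => fail
      | @eq nat _ _ => fail
      | or _ _ => fail
      | nat => fail
      | _ => clear H
      end
  end; lia.

Lemma join_alt_ext (T : finType) k (c : T -> T -> 'I_k) i (A A' B B' : {set T}) :
  (forall x y, colour_rel c A' i x y -> colour_rel c A i x y) ->
  (forall x y, colour_rel c B' i x y -> colour_rel c B i x y) ->
  join_alt c i A B -> join_alt c i A' B'.
Proof.
by move=> hA hB [] [a b]; [apply: Or31 | apply: Or32 | apply: Or33]; split;
  first [apply: free_ext hA a | apply: free_ext hB b].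
Qed.

(** These are the inequalities that a join requires: no edge on either side for K3, and the
    alternatives of [join_alt] for H3. *)
Lemma gmax1_ineqs k j (s : 'I_k -> nat) :
  [/\ 2 * gmax1 j s 0 <= gmax1 j s 2, gmax1 j s 0 + gmax1 j s 2 <= gmax1 j s 3
    & 2 * gmax1 j s 1 <= gmax1 j s 3].
Proof.
pose p := 0 < cnt1 j s 1; pose t := cnt1 j s 2; pose h := cnt1 j s 3.
have -> : gmax1 j s 0 = gmax p t h by [].
have -> : gmax1 j s 1 = gmax true t h by [].
have -> : gmax1 j s 2 = gmax p t.+1 h by [].
have -> : gmax1 j s 3 = gmax p t h.+1 by [].
have := gmax_ineqsP p t h; rewrite /gmax_ineqs /= => ine.
by split; lia.
Qed.

Lemma gmax2C k r b (s : 'I_k -> nat) x y : gmax2 b r s y x = gmax2 r b s x y.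
Proof.
have E l : cnt2 b r s l = cnt2 r b s l.
  by apply: eq_card => i; rewrite !inE andbCA.
by rewrite /gmax2 !E orbCA !(addnCA (y == _)).
Qed.

Lemma gmax2_vals k r b (s : 'I_k -> nat) : exists p t h,
  [/\ gmax2 r b s 0 0 = gmax p t h, [/\ gmax2 r b s 1 0 = gmax true t h, gmax2 r b s 0 1 = gmax
    true t h & gmax2 r b s 1 1 = gmax true t h],
    [/\ gmax2 r b s 2 0 = gmax p t.+1 h, gmax2 r b s 0 2 = gmax p t.+1 h, gmax2 r b s 2 2 = gmax p
      t.+2 h,
        gmax2 r b s 1 2 = gmax true t.+1 h & gmax2 r b s 2 1 = gmax true t.+1 h],
    [/\ gmax2 r b s 3 0 = gmax p t h.+1, gmax2 r b s 0 3 = gmax p t h.+1, gmax2 r b s 1 3 = gmax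
      true t h.+1
      & gmax2 r b s 3 1 = gmax true t h.+1] &
    [/\ gmax2 r b s 2 3 = gmax p t.+1 h.+1, gmax2 r b s 3 2 = gmax p t.+1 h.+1 & gmax2 r b s 3 3 =
      gmax p t h.+2]].
Proof. by exists (0 < cnt2 r b s 1), (cnt2 r b s 2), (cnt2 r b s 3). Qed.

Ltac gmax_lia r b s :=
  let p := fresh "p" in let t := fresh "t" in let h := fresh "h" in
  let ine := fresh "ine" in
  have [p [t [h [? [? ? ?] [? ? ? ? ?] [? ? ? ?] [? ? ?]]]]] := gmax2_vals r b s;
  have ine := gmax_ineqsP p t h; rewrite /gmax_ineqs /= in ine; nat_lia.

Section Step.

Variables (T : finType) (k : nat) (c : T -> T -> 'I_k).
Hypothesis csym : forall x y, c x y = c y x.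
Hypothesis gal : forall x y z, x != y -> y != z -> x != z ->
  [|| c x y == c y z, c y z == c x z | c x y == c x z].
Variables (S : {set T}) (s : 'I_k -> nat).
Hypothesis fr : respects c s S.
Hypothesis s3 : forall i, s i <= 3.
Hypothesis IH : forall (Y : {set T}) s', (forall i, s' i <= 3) -> #|Y| < #|S| ->
  respects c s' Y -> #|Y| <= gmax_of s'.

Local Notation colour_rel := (colour_rel c).
Local Notation free := (free c).

Lemma bound1 j x (Y : {set T}) : x <= 3 -> Y \subset S -> #|Y| < #|S| -> free x j Y ->
  #|Y| <= gmax1 j s x.
Proof.
move=> x3 YS lt fx; rewrite -gmax_upd; apply: IH => // i; rewrite /recolour.
  by case: eqP.
by case: eqP => [->//|_]; apply: free_sub YS (fr i).
Qed.

Lemma bound2 r b x y (Y : {set T}) : r != b -> x <= 3 -> y <= 3 -> Y \subset S ->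
  #|Y| < #|S| -> free x r Y -> free y b Y -> #|Y| <= gmax2 r b s x y.
Proof.
move=> rb x3 y3 YS lt fx fy; rewrite -gmax_upd2 //; apply: IH => // i; rewrite /recolour.
  by case: eqP => // _; case: eqP.
by case: eqP => [->//|_]; case: eqP => [->//|_]; apply: free_sub YS (fr i).
Qed.

Lemma join_bound j (A B : {set T}) :
  A \subset S -> B \subset S -> #|A| < #|S| -> #|B| < #|S| ->
  [/\ s j = 2, free 0 j A & free 0 j B] \/ s j = 3 /\ join_alt c j A B ->
  #|A| + #|B| <= gmax_of s.
Proof.
move=> AS BS ltA ltB h; rewrite (gmax1E j); have [i1 i2 i3] := gmax1_ineqs j s.
case: h => [[-> a b]|[-> []] [a b]].
- by have := bound1 (isT : 0 <= 3) AS ltA a; have := bound1 (isT : 0 <= 3) BS ltB b; nat_lia.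
- by have := bound1 (isT : 2 <= 3) AS ltA a; have := bound1 (isT : 0 <= 3) BS ltB b; nat_lia.
- by have := bound1 (isT : 0 <= 3) AS ltA a; have := bound1 (isT : 2 <= 3) BS ltB b; nat_lia.
by have := bound1 (isT : 1 <= 3) AS ltA a; have := bound1 (isT : 1 <= 3) BS ltB b; nat_lia.
Qed.

(** * Peeled vertices and joins of the remaining set *)

Section Peel.

Variables (U : {set T}) (io : T -> 'I_k).
Let R := S :\: U.
(* [U] consists of the peeled vertices, [io u] being the colour of all edges from [u] to
   [R]; [no_peel] excludes peeling another vertex, for which the bound is known by
   induction. *)
Hypothesis US : U \subset S.
Hypothesis P1 : {in U & R, forall u x, c u x = io u}.
Hypothesis P2 : {in U &, forall u v, u != v -> c u v = io u \/ c u v = io v}.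
Hypothesis P3 : {in U &, injective io}.
Hypothesis P4 : {in U, forall u, s (io u) = 3}.
Hypothesis R3 : 2 < #|R|.
Hypothesis no_peel : forall w (j : 'I_k), w \in R -> {in U, forall u, io u != j} -> s j = 3 ->
  {in R :\ w, forall x, c w x = j} -> #|S| <= gmax_of s.

Lemma R_sub : R \subset S. Proof. exact: subsetDl. Qed.

Lemma cardSR : #|S| = #|R| + #|U|.
Proof. by rewrite /R -(cardsID U S) addnC (setIidPr US). Qed.

Lemma card_RU (X W : {set T}) : X \subset R -> W \subset U -> #|X :|: W| = #|X| + #|W|.
Proof.
move=> XR WU; rewrite cardsU; suff -> : X :&: W = set0 by rewrite cards0 subn0.
apply/setP => x; rewrite !inE; apply/negP => /andP[/(subsetP XR)].
by rewrite inE => /andP[/negP xU _] /(subsetP WU).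
Qed.

Lemma sub_RU (X W : {set T}) : X \subset R -> W \subset U -> X :|: W \subset S.
Proof. by move=> XR WU; rewrite subUset (subset_trans XR R_sub) (subset_trans WU US). Qed.

(** An edge from a peeled vertex to [R] has its colour, and an edge between two peeled vertices has
    the colour of one of them. So peeled vertices of colours other than [j] bring no edge of colour
    [j], which is what makes adding them free. *)
Lemma peel_cr j (X W : {set T}) : X \subset R -> W \subset U -> {in W, forall u, io u != j} ->
  forall x y, colour_rel (X :|: W) j x y -> colour_rel X j x y.
Proof.
move=> XR WU Wj.
have key x y : x \in W -> y \in X :|: W -> x != y -> c x y != j.
  move=> xW yXW xy; have xU := subsetP WU _ xW.
  case: (boolP (y \in W)) => [yW|yW].
    by have [->|->] := P2 xU (subsetP WU _ yW) xy; apply: Wj.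
  by rewrite P1 ?Wj //; apply: (subsetP XR); move: yXW; rewrite inE (negbTE yW) orbF.
move=> x y /and4P[xX yX xy cxy]; apply/and4P; split=> //.
  case: (boolP (x \in W)) => [xW|xW]; first by rewrite (negbTE (key _ _ xW yX xy)) in cxy.
  by move: xX; rewrite inE (negbTE xW) orbF.
case: (boolP (y \in W)) => [yW|yW].
  by have := key _ _ yW xX; rewrite eq_sym xy csym cxy => /(_ isT).
by move: yX; rewrite inE (negbTE yW) orbF.
Qed.

Definition U1 j := [set u in U | io u != j].

Lemma U1U j : U1 j \subset U.
Proof. by apply/subsetP => u; rewrite inE => /andP[]. Qed.

Lemma U1j j : {in U1 j, forall u, io u != j}.
Proof. by move=> u; rewrite inE => /andP[]. Qed.

Lemma card_U1 j v : v \in U -> io v = j -> #|U| = (#|U1 j|).+1.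
Proof.
move=> vU vj; rewrite (cardsD1 v) vU add1n; congr _.+1; apply: eq_card => u.
rewrite !inE andbC; case uU: (u \in U) => //=; congr negb.
by apply/eqP/eqP => [->//|uj]; apply: P3; rewrite ?uj.
Qed.

Lemma v_joined v (X : {set T}) : v \in U -> X \subset R -> joined c (io v) [set v] X.
Proof.
move=> vU /subsetP XR x y; rewrite inE => /eqP-> /XR yR; split; last exact: P1.
by apply: contraTneq yR => <-; rewrite inE vU.
Qed.

Lemma joinedU i (A A' B : {set T}) : joined c i A B -> joined c i A' B -> joined c i (A :|: A') B.
Proof. by move=> h h' x y; rewrite inE => /orP[xA|xA] yB; [apply: h | apply: h']. Qed.

(** Only the smaller side [A] can be a single vertex. If [j] has been peeled, the peeled vertex
    joins [A] and gives it a second vertex; otherwise a single vertex in [A] can itself be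
    peeled. *)
Lemma join_case_aux j (A B : {set T}) : A :|: B = R -> [disjoint A & B] -> A != set0 ->
  joined c j A B -> #|A| <= #|B| -> #|S| <= gmax_of s.
Proof.
move=> ABR dis A0 AB le.
have AR : A \subset R by rewrite -ABR subsetUl.
have BR : B \subset R by rewrite -ABR subsetUr.
have [AS BS] := (subset_trans AR R_sub, subset_trans BR R_sub).
have cR : #|R| = #|A| + #|B| by rewrite -ABR cardsU disjoint_setI0 // cards0 subn0.
have A1 : 0 < #|A| by rewrite card_gt0.
have B2 : 1 < #|B| by nat_lia.
have cS := cardSR.
have [a aA] := set0Pn _ A0.
have [b [b' [bB bB' bb']]] := card_gt1P B2.
have jcr := joined_cr AS BS AB.
have nI j' : s j' != 3 -> {in U, forall u, io u != j'}.
  by move=> nj u uU; apply: contraNneq nj => <-; rewrite P4.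
have AUp : {in U, forall u, io u != j} -> s j = 2 /\ free 0 j A /\ free 0 j B \/
    s j = 3 /\ join_alt c j A B -> #|S| <= gmax_of s.
  move=> Uj h; have E := card_RU AR (subxx U).
  have -> : #|S| = #|A :|: U| + #|B| by rewrite E; nat_lia.
  have ext := peel_cr AR (subxx U) Uj.
  apply: (@join_bound j); rewrite ?sub_RU // ?E; try nat_lia.
  case: h => [[-> [fA fB]]|[-> alt]]; [left|right]; split=> //.
    exact: free_ext ext fA.
  exact: join_alt_ext ext _ alt.
have [j0|j1|j2|j3] : [\/ s j = 0, s j = 1, s j = 2 | s j = 3].
  by move: (s3 j); case: (s j) => [|[|[|[|]]]] // _;
    [apply: Or41|apply: Or42|apply: Or43|apply: Or44].
- by have := fr j; rewrite j0 /= => /(_ a b); case; apply: jcr.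
- by have := fr j; rewrite j1 /= => /(_ a b b' (jcr _ _ aA bB) (jcr _ _ aA bB')) E;
  rewrite E eqxx in bb'.
- apply: AUp; first by apply: nI; rewrite j2.
  have f2 : free 2 j S by rewrite -j2; apply: fr.
  left; split=> //; split; last exact: (join_K3 AS BS AB).
  by apply: (join_K3 BS AS (joined_sym csym AB)) => //; apply/set0Pn; exists b.
have f3 : free 3 j S by rewrite -j3; apply: fr.
have [/exists_inP[v vU /eqP vj]|/exists_inPn nv] := boolP [exists u in U, io u == j].
  have AvS : A :|: [set v] \subset S by rewrite sub_RU // sub1set.
  have cAv : #|A :|: [set v]| = #|A|.+1 by rewrite card_RU ?sub1set // cards1 addn1.
  have jv : joined c j (A :|: [set v]) B.
    by apply: joinedU => //; rewrite -vj; apply: v_joined.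
  have alt := join_H3 csym AvS BS jv f3 (_ : 1 < #|A :|: [set v]|) B2.
  have E := card_RU BR (U1U j).
  have cU := card_U1 vU vj.
  (* The vertex [v] is counted with [A], the peeled vertices of all other colours with [B]. *)
  have -> : #|S| = #|A :|: [set v]| + #|B :|: U1 j| by rewrite E cAv; nat_lia.
  apply: (@join_bound j); rewrite ?sub_RU ?U1U ?sub1set //; try (rewrite ?E ?cAv; nat_lia).
  right; split=> //; apply: join_alt_ext _ (peel_cr BR (U1U j) (@U1j j)) (alt _) => //.
  by rewrite cAv.
have [A1'|A2] := leqP #|A| 1.
  apply: (@no_peel a j) => //; first exact: (subsetP AR).
  move=> x; rewrite !inE => /andP[xa xR]; have : x \in A :|: B by rewrite ABR inE.
  rewrite inE => /orP[xA|xB]; last by have [_] := AB _ _ aA xB.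
  have /cards1P[a' Aa] : #|A| == 1 by rewrite eqn_leq A1' A1.
  by move: aA xA xa; rewrite Aa !inE => /eqP-> ->.
apply: AUp => //; right; split=> //.
exact: (join_H3 csym AS BS AB f3).
Qed.

Lemma join_case j (A B : {set T}) : A :|: B = R -> [disjoint A & B] -> A != set0 ->
  B != set0 -> joined c j A B -> #|S| <= gmax_of s.
Proof.
move=> ABR dis A0 B0 AB; case: (leqP #|A| #|B|) => [le|/ltnW le].
  exact: join_case_aux AB le.
apply: (join_case_aux _ _ B0 (joined_sym csym AB) le); first by rewrite setUC ABR.
by rewrite disjoint_sym.
Qed.

Hypothesis big : gmax_of s < #|S|.

Lemma no_join j (A B : {set T}) : A :|: B = R -> [disjoint A & B] -> A != set0 ->
  B != set0 -> joined c j A B -> False.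
Proof. by move=> E D A0 B0 J; move: (join_case E D A0 B0 J); rewrite leqNgt big. Qed.

(** * Gallai partitions of the remaining set *)

Record gallai_partition (r b : 'I_k) (cls : T -> {set T}) : Prop := GallaiPartition {
  parts_neq : r != b;
  parts_refl : {in R, forall x, x \in cls x};
  parts_sub : {in R, forall x, cls x \subset R};
  parts_eq : forall x y, y \in cls x -> cls y = cls x;
  parts_col : {in R &, forall x y, y \notin cls x -> c x y = r \/ c x y = b};
  parts_hom : forall x x' y, x \in R -> y \in R -> x' \in cls x -> y \notin cls x ->
    c x' y = c x y;
  parts_two : {in R, forall x, exists2 y, y \in R & y \notin cls x}
}.

Lemma parts_sym r b cls : gallai_partition r b cls -> gallai_partition b r cls.
Proof.
case=> rb C1 C2 C3 C4 C5 two; split=> //; first by rewrite eq_sym.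
by move=> x y xR yR /(C4 _ _ xR yR) []; [right | left].
Qed.

Section Parts.

Variables (r b : 'I_k) (cls : T -> {set T}).
Hypothesis pr : gallai_partition r b cls.
Let rb := parts_neq pr.
Let C1 := parts_refl pr.
Let C2 := parts_sub pr.
Let C3 := parts_eq pr.
Let C4 := parts_col pr.
Let C5 := parts_hom pr.
Let two := parts_two pr.

Definition nb q x := [set y in R | (y \notin cls x) && (c x y == q)].

Lemma nb_sub q x : nb q x \subset R.
Proof. by apply/subsetP => y; rewrite inE => /andP[]. Qed.

Lemma nb_joined q x : x \in R -> joined c q (cls x) (nb q x).
Proof.
move=> xR x' y x'x; rewrite inE => /and3P[yR yx /eqP cxy]; split.
  by apply: contraNneq yx => <-.
by rewrite (C5 xR).
Qed.

Lemma nb_split x : x \in R -> R = cls x :|: (nb r x :|: nb b x).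
Proof.
move=> xR; apply/setP => y; rewrite !inE; case yx: (y \in cls x) => /=.
  by have := subsetP (C2 xR) _ yx; rewrite inE.
case yR: ((y \notin U) && (y \in S)) => //=; apply/esym.
have yR' : y \in R by rewrite inE.
by case: (C4 xR yR'); rewrite ?yx // => ->; rewrite eqxx ?orbT.
Qed.

Lemma nb_disj x : nb r x :&: nb b x = set0.
Proof.
apply/setP => y; rewrite !inE; apply/negP => /andP[/and3P[_ _ /eqP->]].
by rewrite (negbTE rb) !andbF.
Qed.

Lemma cls_nb_disj q x : cls x :&: nb q x = set0.
Proof. by apply/setP => y; rewrite !inE; case: (y \in cls x); rewrite ?andbF. Qed.

Lemma card_nb x : x \in R -> #|R| = #|cls x| + #|nb r x| + #|nb b x|.
Proof.
move=> xR; rewrite {1}(nb_split xR) cardsU cardsU nb_disj setIUr !cls_nb_disj setU0.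
by rewrite !cards0 !subn0 addnA.
Qed.

Lemma cls_neq0 x : x \in R -> cls x != set0.
Proof. by move=> xR; apply/set0Pn; exists x; apply: C1. Qed.

Lemma nb_r_neq0 x : x \in R -> nb r x != set0.
Proof.
move=> xR; apply/negP => /eqP N0; have E := nb_split xR; rewrite N0 set0U in E.
apply: (@no_join b (cls x) (nb b x)) => //.
- by rewrite -setI_eq0 cls_nb_disj.
- exact: cls_neq0.
- have [y yR yx] := two xR; apply/set0Pn; exists y.
  by move: (yR); rewrite {1}E inE (negbTE yx).
- exact: nb_joined.
Qed.

Lemma nb_b_neq0 x : x \in R -> nb b x != set0.
Proof.
move=> xR; apply/negP => /eqP N0; have E := nb_split xR; rewrite N0 setU0 in E.
apply: (@no_join r (cls x) (nb r x)) => //.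
- by rewrite -setI_eq0 cls_nb_disj.
- exact: cls_neq0.
- have [y yR yx] := two xR; apply/set0Pn; exists y.
  by move: (yR); rewrite {1}E inE (negbTE yx).
- exact: nb_joined.
Qed.

Lemma cls_proper x : x \in R -> #|cls x| < #|R|.
Proof.
by move=> xR; rewrite (card_nb xR) -addnA -[X in X < _]addn0 ltn_add2l addn_gt0
  !card_gt0 nb_r_neq0.
Qed.

Lemma nb_r_proper x : x \in R -> #|nb r x| < #|R|.
Proof.
move=> xR; rewrite (card_nb xR); have := cls_neq0 xR; rewrite -card_gt0; nat_lia.
Qed.

Lemma nb_b_proper x : x \in R -> #|nb b x| < #|R|.
Proof.
move=> xR; rewrite (card_nb xR); have := cls_neq0 xR; rewrite -card_gt0; nat_lia.
Qed.

Lemma nb_cls q x y : y \in nb q x -> x \in R -> cls y \subset nb q x.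
Proof.
rewrite inE => /and3P[yR yx /eqP cxy] xR; apply/subsetP => z zy; rewrite inE.
have xy : x \notin cls y by apply: contra yx => xy; rewrite (C3 xy) C1.
rewrite (subsetP (C2 yR) _ zy) /= csym (C5 yR xR zy xy) csym cxy eqxx andbT.
by apply: contra yx => zx; rewrite -(C3 zx) (C3 zy) C1.
Qed.

(** If colour [r] had no P3, two classes joined in [r] would be single vertices [x] and [y] without
    further edges of colour [r], and [[set x; y]] would be joined to the rest of [R] in colour
    [b]. *)
Lemma s_ge2 : 2 <= s r.
Proof.
have [x xR] : exists x, x \in R by apply/card_gt0P; apply: ltnW (ltnW R3).
have [y yN] := set0Pn _ (nb_r_neq0 xR).
have yR := subsetP (nb_sub _ _) _ yN.
have jS z u : z \in R -> u \in R -> z != u -> c z u = r -> colour_rel S r z u.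
  by move=> /(subsetP R_sub) zS /(subsetP R_sub) uS zu <-; apply/and4P.
have [xy cxy] : x != y /\ c x y = r by apply: (nb_joined xR) => //; apply: C1.
have frr := fr r; case: (s r) frr => [|[|//]] /= f.
  by case: (f x y); apply: jS.
have clsx z u : z \in R -> u \in nb r z -> cls z = [set z].
  move=> zR uN; apply/setP => z'; rewrite inE; apply/idP/eqP => [z'z|->]; last exact: C1.
  have uR := subsetP (nb_sub _ _) _ uN.
  have [zu czu] := nb_joined zR (C1 zR) uN; have [z'u cz'u] := nb_joined zR z'z uN.
  by apply: (f u); apply: jS; rewrite 1?eq_sym 1?csym //; apply: (subsetP (C2 zR)).
have xN : x \in nb r y.
  rewrite inE xR csym cxy eqxx andbT /=; move: yN; rewrite inE => /and3P[_ yx _].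
  by apply: contra yx => xy'; rewrite (C3 xy') C1.
have cx := clsx _ _ xR yN; have cy := clsx _ _ yR xN.
case: (@no_join b [set x; y] (R :\: [set x; y])).
- by apply/setP => z; rewrite !inE; case: eqP => [->|_]; case: eqP => [->|_] //=; move: xR yR;
  rewrite !inE.
- by rewrite -setI_eq0; apply/eqP/setP => z; rewrite !inE; case: (_ || _).
- by apply/set0Pn; exists x; rewrite !inE eqxx.
- rewrite -card_gt0 cardsD; have := subset_leq_card (subsetIr R [set x; y]).
  by rewrite cards2; move: R3; case: (x != y) => /=; nat_lia.
move=> u z uxy; rewrite !inE negb_or -!andbA => /and4P[zx zy zU zS].
have zR : z \in R by rewrite inE zU.
have [uR [cu [u' [u'R uu' cuu']]]] : u \in R /\ cls u = [set u] /\
    exists u', [/\ u' \in [set x; y], u != u' & colour_rel S r u u'].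
  have [->|->] : u = x \/ u = y.
    by move: uxy; rewrite !inE => /orP[]/eqP; [left | right].
    split; [exact: xR | split; [exact: cx | exists y; split]].
    - by rewrite !inE eqxx orbT.
    - exact: xy.
    - exact: jS.
  split; [exact: yR | split; [exact: cy | exists x; split]].
  - by rewrite !inE eqxx.
  - by rewrite eq_sym.
  - by apply: jS; rewrite 1?eq_sym 1?csym.
have uz : u != z by move: uxy; rewrite !inE => /orP[/eqP->|/eqP->]; rewrite eq_sym.
split=> //; case: (C4 uR zR) => //; first by rewrite cu inE eq_sym.
move=> cuz; have := f u u' z cuu' (jS _ _ uR zR uz cuz) => E.
by move: u'R; rewrite E !inE (negbTE zx) (negbTE zy).
Qed.

Lemma nb_rS q x : nb q x \subset S.
Proof. exact: subset_trans (nb_sub q x) R_sub. Qed.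

Lemma clsS x : x \in R -> cls x \subset S.
Proof. by move=> xR; apply: subset_trans (C2 xR) R_sub. Qed.

Lemma s_r23 : s r = 2 \/ s r = 3.
Proof.
by have := s_ge2; have := s3 r; case: (s r) => [|[|[|[|]]]] //; [left | right].
Qed.

(* If the class of x has exactly one b-neighbour y, then y can be moved into the class
   without changing its colour-r graph, and R becomes a join in colour r. *)
Lemma fat_nb_b x : x \in R -> 1 < #|cls x| -> 1 < #|nb b x|.
Proof.
move=> xR fat; rewrite ltnNge; apply/negP => le1.
have := nb_b_neq0 xR; rewrite -card_gt0 => gt0.
have /cards1P[y Ny] : #|nb b x| == 1 by rewrite eqn_leq le1 gt0.
have yN : y \in nb b x by rewrite Ny inE.
have yR := subsetP (nb_sub b x) _ yN.
pose X := cls x :|: [set y]; pose Y := nb r x.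
have XR : X \subset R by rewrite subUset C2 // sub1set.
have YR : Y \subset R := nb_sub r x.
have cX : #|X| = #|cls x|.+1.
  by rewrite -addn1 -(cards1 y) -Ny /X -Ny cardsU cls_nb_disj cards0 subn0.
have cR : #|R| = #|X| + #|Y| by rewrite (card_nb xR) Ny cards1 cX addn1 addSn.
have Xr u v : colour_rel X r u v -> colour_rel (cls x) r u v.
  have key w : w \in cls x -> c w y != r.
    move=> wx; have [_ ->] := nb_joined xR wx yN; by rewrite eq_sym.
  move=> /and4P[uX vX uv cuv]; apply/and4P; split=> //.
    move: uX; rewrite inE => /orP[//|]; rewrite inE => /eqP uy.
    move: vX; rewrite inE => /orP[vx|]; last by rewrite inE -uy eq_sym (negbTE uv).
    by have := key v vx; rewrite csym -uy cuv.
  move: vX; rewrite inE => /orP[//|]; rewrite inE => /eqP vy.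
  move: uX; rewrite inE => /orP[ux|]; last by rewrite inE -vy (negbTE uv).
  by have := key u ux; rewrite -vy cuv.
have J := nb_joined xR (q := r).
have [Sx SY] := (clsS xR, subset_trans YR R_sub).
have Y0 : 0 < #|Y| by rewrite card_gt0; apply: nb_r_neq0.
have cS := cardSR.
have done1 : {in U, forall u, io u != r} ->
    [/\ s r = 2, free 0 r (cls x) & free 0 r Y] \/ s r = 3 /\ join_alt c r (cls x) Y -> False.
  move=> Ur h; have E := card_RU XR (subxx U).
  suff : #|X :|: U| + #|Y| <= gmax_of s by rewrite E; move: big; nat_lia.
  have ext u v : colour_rel (X :|: U) r u v -> colour_rel (cls x) r u v.
    by move/(peel_cr XR (subxx U) Ur)/Xr.
  apply: (@join_bound r).
  - exact: sub_RU.
  - exact: SY.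
  - by rewrite E; nat_lia.
  - by nat_lia.
  case: h => [[-> fA fB]|[-> alt]]; [left|right]; split=> //.
    exact: free_ext ext fA.
  exact: join_alt_ext ext _ alt.
case: s_r23 => sr.
  have f2 : free 2 r S by rewrite -sr; apply: fr.
  apply: done1; first by move=> u uU; apply/eqP => ur; move: sr; rewrite -ur P4.
  left; split; first exact: sr.
    by apply: (join_K3 SY Sx (joined_sym csym J)) => //; rewrite -card_gt0.
  by apply: (join_K3 Sx SY J) => //; apply: cls_neq0.
have f3 : free 3 r S by rewrite -sr; apply: fr.
have [/exists_inP[v vU /eqP vr]|/exists_inPn nv] := boolP [exists u in U, io u == r].
  have YvS : Y :|: [set v] \subset S by rewrite sub_RU // sub1set.
  have cYv : #|Y :|: [set v]| = #|Y|.+1 by rewrite card_RU ?sub1set // cards1 addn1.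
  have jv : joined c r (Y :|: [set v]) (cls x).
    by apply: joinedU; [apply: joined_sym | rewrite -vr; apply: v_joined (C2 xR)].
  have Yv2 : 1 < #|Y :|: [set v]| by rewrite cYv ltnS.
  have alt := join_H3 csym Sx YvS (joined_sym csym jv) f3 fat Yv2.
  have E := card_RU XR (U1U r); have cU := card_U1 vU vr.
  suff : #|X :|: U1 r| + #|Y :|: [set v]| <= gmax_of s.
    by rewrite E cYv; move: big; nat_lia.
  apply: (@join_bound r).
  - exact: sub_RU XR (U1U r).
  - exact: YvS.
  - by rewrite E; nat_lia.
  - by rewrite cYv; move: fat; nat_lia.
  right; split=> //; apply: join_alt_ext alt => u w //.
  by move/(peel_cr XR (U1U r) (@U1j r))/Xr.
(* If [Y] were a single vertex [z], then [R] would be the class together with [z] and [y]. According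
   to the colour of the edge [z y], either [z] has only edges of colour [r] or [y] has only edges of
   colour [b], and this is a join. *)
have Y2 : 1 < #|Y|.
  rewrite ltnNge; apply/negP => Y1.
  have /cards1P[z Yz] : #|Y| == 1 by rewrite eqn_leq Y1 Y0.
  have zY : z \in nb r x by rewrite -/Y Yz inE.
  have zR := subsetP YR _ zY.
  have zy : z != y.
    apply: contraTneq zY => ->; apply/negP => yr.
    have : y \in nb r x :&: nb b x by rewrite in_setI yr yN.
    by rewrite nb_disj inE.
  have Rz w : w \in R -> w \in cls x \/ w = z \/ w = y.
    rewrite {1}(nb_split xR) !in_setU => /or3P[h|h|h]; [by left| |].
      by right; left; move: h; rewrite -/Y Yz inE => /eqP.
    by right; right; move: h; rewrite Ny inE => /eqP.
  have single p q g : p \in R -> {in R :\ p, forall w, c p w = g} -> q \in R -> q != p -> False.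
    move=> pR h qR qp; apply: (@no_join g [set p] (R :\ p)).
    - by rewrite setD1K.
    - by rewrite -setI_eq0; apply/eqP/setP => w; rewrite !inE; case: eqP.
    - by apply/set0Pn; exists p; rewrite inE.
    - by apply/set0Pn; exists q; rewrite in_setD1 qp.
    move=> w1 w2; rewrite inE => /eqP-> w2R; split; last exact: h.
    by move: w2R; rewrite in_setD1 eq_sym => /andP[].
  have yz : y \notin cls z.
    apply/negP => yz'; have [_ E1] := nb_joined xR (C1 xR) yN.
    have [_ E2] := nb_joined xR (C1 xR) zY.
    have xz : x \notin cls z.
      move: zY; rewrite inE => /and3P[_ zx _]; apply: contra zx => xz.
      by rewrite (C3 xz) C1.
    by move: rb; rewrite -E1 -E2 csym [X in _ != X]csym (C5 zR xR yz' xz) eqxx.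
  case: (C4 zR yR yz) => czy.
    apply: (single z y r) => //; last by rewrite eq_sym.
    move=> w; rewrite in_setD1 => /andP[wz /Rz[wx|[E|->]]] //; last by rewrite E eqxx in wz.
    by have [_] := nb_joined xR wx zY; rewrite csym.
  apply: (single y z b) => //.
  move=> w; rewrite in_setD1 => /andP[wy /Rz[wx|[->|E]]]; last by rewrite E eqxx in wy.
    by have [_] := nb_joined xR wx yN; rewrite csym.
  by rewrite csym.
apply: done1 => //; right; split=> //; exact: (join_H3 csym Sx SY J).
Qed.

End Parts.

(** * Bounds for classes and for their neighbourhoods *)

Section Pieces.

Variables (r b : 'I_k) (cls : T -> {set T}).
Hypothesis pr : gallai_partition r b cls.
Let rb := parts_neq pr.
Let C1 := parts_refl pr.
Let C2 := parts_sub pr.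
Let C3 := parts_eq pr.
Let C4 := parts_col pr.
Let C5 := parts_hom pr.
Local Notation nb := (nb cls).
Local Notation G := (gmax2 r b s).

Definition U2 := [set u in U | (io u != r) && (io u != b)].

(* The constraint on a peeled colour is tighter on [R]: a diamond there closes an H3. *)
Definition peeled j := [exists u in U, io u == j].

Lemma card_peeled j : #|[set u in U | io u == j]| <= peeled j.
Proof.
case: (boolP (peeled j)) => [_|/exists_inPn no]; last first.
  by rewrite leqn0 cards_eq0; apply/eqP/setP => u; rewrite !inE; apply/negP => /andP[/no/negP].
apply/card_le1_eqP => u v; rewrite !inE => /andP[uU /eqP uj] /andP[vU /eqP vj].
by apply: P3; rewrite ?uj.
Qed.

Lemma card_U2 : #|U| <= #|U2| + peeled r + peeled b.
Proof.
have sub : U \subset U2 :|: [set u in U | io u == r] :|: [set u in U | io u == b].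
  by apply/subsetP => u uU; rewrite !inE uU /=; case: eqP; case: eqP.
have h1 := subset_leq_card sub.
have h2 := (leq_card_setU (U2 :|: [set u in U | io u == r]) [set u in U | io u == b]).1.
have h3 := (leq_card_setU U2 [set u in U | io u == r]).1.
have := card_peeled r; have := card_peeled b; move: h1 h2 h3; nat_lia.
Qed.

(** The colours of [U2] differ from [r] and [b], so [U2] is added to the piece for free. When [R] is
    cut into several pieces, one of them absorbs [U2] in this way. *)
Lemma piece x y (X : {set T}) : X \subset R -> #|X| < #|R| -> x <= 3 -> y <= 3 ->
  free x r X -> free y b X -> #|X| + #|U2| <= G x y.
Proof.
move=> XR lt x3 y3 fx fy.
have U2U : U2 \subset U by apply/subsetP => u; rewrite inE => /andP[].
have U2r : {in U2, forall u, io u != r} by move=> u; rewrite inE => /and3P[].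
have U2b : {in U2, forall u, io u != b} by move=> u; rewrite inE => /and3P[].
rewrite -(card_RU XR U2U); apply: bound2 => //.
- exact: sub_RU.
- by rewrite (card_RU XR U2U) cardSR; have := subset_leq_card U2U; nat_lia.
- exact: free_ext (peel_cr XR U2U U2r) fx.
exact: free_ext (peel_cr XR U2U U2b) fy.
Qed.

Lemma piece0 x y (X : {set T}) : X \subset R -> #|X| < #|R| -> x <= 3 -> y <= 3 ->
  free x r X -> free y b X -> #|X| <= G x y.
Proof. by move=> *; apply: leq_trans (leq_addr _ _) (piece _ _ _ _ _ _). Qed.

Lemma free_single q x : #|cls x| <= 1 -> free 0 q (cls x).
Proof.
by move/card_le1_eqP => h u v /and4P[ux vx /eqP uv _]; apply: uv; apply: h.
Qed.

Lemma class_K3 x : s r = 2 -> x \in R -> free 0 r (cls x).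
Proof.
move=> sr xR; have f2 : free 2 r S by rewrite -sr; apply: fr.
apply: (@join_K3 _ _ c r S (nb r x)) f2 (nb_r_neq0 pr xR).
- exact: nb_rS.
- exact: (clsS pr xR).
exact: (joined_sym csym (nb_joined pr xR)).
Qed.

(** A class with two vertices has two neighbours of colour [r] by [fat_nb_b], and these would
    complete a triangle in the class to an H3. *)
Lemma class_H3 x : s r = 3 -> x \in R -> free 2 r (cls x).
Proof.
move=> sr xR; have f3 : free 3 r S by rewrite -sr; apply: fr.
case: (leqP #|cls x| 1) => [le1|fat].
  by apply: (free_le csym (isT : 0 <= 2)); apply: free_single le1.
apply: (@join2 _ _ c csym r S (nb r x)) f3 (fat_nb_b (parts_sym pr) xR fat).
- exact: nb_rS.
- exact: (clsS pr xR).
exact: (joined_sym csym (nb_joined pr xR)).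
Qed.

(** The peeled vertex and two neighbours of the class form a P3 on the other side of a join with the
    class. *)
Lemma class_peeled x : peeled r -> x \in R -> free 0 r (cls x).
Proof.
move=> /exists_inP[v vU /eqP vr] xR; case: (leqP #|cls x| 1) => [le1|fat];
  first exact: free_single le1.
have sr : s r = 3 by rewrite -vr P4.
have f3 : free 3 r S by rewrite -sr; apply: fr.
have vN : nb r x :|: [set v] \subset S by rewrite sub_RU ?nb_sub // sub1set.
have J : joined c r (nb r x :|: [set v]) (cls x).
  by apply: joinedU; [apply/joined_sym/(nb_joined pr) | rewrite -vr; apply: v_joined (C2 xR)].
apply: (@join0 _ _ c csym r S _ (cls x) vN (clsS pr xR) J f3).
have /card_gt1P[y [z [yN zN yz]]] := fat_nb_b (parts_sym pr) xR fat.
have vcr w : w \in nb r x -> colour_rel (nb r x :|: [set v]) r v w.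
  move=> wN; have wR := subsetP (nb_sub cls r x) _ wN.
  apply/and4P; split; rewrite ?in_setU ?wN ?inE ?eqxx ?orbT //.
    by apply: contraTneq wR => <-; rewrite inE vU.
  by rewrite P1 // vr.
by exists v, y, z; split=> //; apply: vcr.
Qed.

Definition closed_set (N : {set T}) : Prop := {in N, forall x, cls x \subset N}.

(** A vertex outside a K4 joined to three of its vertices completes an H3, the missing edge being
    the one to the fourth. *)
Lemma clique_bound (N : {set T}) x1 x2 x3 x4 : s r = 3 -> N \subset R ->
  [/\ x1 \in N, x2 \in N, x3 \in N & x4 \in N] ->
  [/\ c x1 x2 = r, c x1 x3 = r & c x1 x4 = r] ->
  [/\ c x2 x3 = r, c x2 x4 = r & c x3 x4 = r] ->
  [/\ x1 != x2, x1 != x3 & x1 != x4] -> [/\ x2 != x3, x2 != x4 & x3 != x4] ->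
  {in N, forall y, exists i j l m, [/\ perm_eq [:: i; j; l; m] [:: x1; x2; x3; x4],
     c y j = r, c y l = r & c y m = r]} -> #|N| <= 4.
Proof.
move=> sr NR [n1 n2 n3 n4] [e12 e13 e14] [e23 e24 e34] [d12 d13 d14] [d23 d24 d34] h.
have f3 : free 3 r S by rewrite -sr; apply: fr.
have NS := subset_trans NR R_sub.
suff sub : N \subset [:: x1; x2; x3; x4].
  by apply: leq_trans (subset_leq_card sub) (card_size _).
have u4 : uniq [:: x1; x2; x3; x4] by rewrite /= !inE !negb_or d12 d13 d14 d23 d24 d34.
apply/subsetP => y yN; apply: contraT => ny.
have [i [j [l [m [pe yj yl ym]]]]] := h y yN.
have mem w : w \in [:: i; j; l; m] -> w \in [:: x1; x2; x3; x4] by rewrite (perm_mem pe).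
have inN w : w \in [:: x1; x2; x3; x4] -> w \in N.
  by rewrite !inE => /or4P[]/eqP->.
have E u w : u \in [:: i; j; l; m] -> w \in [:: i; j; l; m] -> u != w -> colour_rel S r u w.
  move=> /mem u' /mem w' uw; apply/and4P; split=> //; first exact: (subsetP NS _ (inN _ u')).
    exact: (subsetP NS _ (inN _ w')).
  by move: u' w' uw; rewrite !inE => /or4P[]/eqP-> /or4P[]/eqP->;
    rewrite ?eqxx // => _; apply/eqP; rewrite // csym.
have Ey w : w \in [:: i; j; l; m] -> c y w = r -> colour_rel S r w y.
  move=> /mem w' cw; apply/and4P; split; first exact: (subsetP NS _ (inN _ w')).
  - exact: (subsetP NS).
  - by apply: contraNneq ny => <-.
  by rewrite csym cw.
have : uniq [:: i; j; l; m] by rewrite (perm_uniq pe).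
rewrite /= !inE !negb_or => /and4P[/and3P[ij il im] /andP[jl jm] lm _].
have iy : i = y.
  apply: (f3 j l m); try (apply: Ey; rewrite ?inE ?eqxx ?orbT //);
    apply: E; rewrite ?inE ?eqxx ?orbT //; by rewrite eq_sym.
by move: ny; rewrite -iy mem // mem_head.
Qed.

Definition has_P3 q (X : {set T}) : Prop :=
  exists x y z, [/\ colour_rel X q x y, colour_rel X q x z & y != z].

Lemma G_small : [/\ 1 <= G 0 0, 2 <= G 1 0, G 0 0 <= G 1 0, G 1 0 <= G 2 0 &
  [/\ 2 * G 0 0 <= G 2 0, G 0 1 = G 1 0, G 1 1 = G 1 0 & G 0 2 = G 2 0]].
Proof.
by split; [| | | | split]; gmax_lia r b s.
Qed.

Lemma P3_fat q X : has_P3 q X -> 1 < #|X|.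
Proof.
move=> [x [y [_ [/and4P[xX yX xy _] _ _]]]]; apply/card_gt1P; by exists x, y.
Qed.

Lemma set_pick (N X : {set T}) : X \subset N -> N = X \/ exists2 y, y \in N & y \notin X.
Proof.
move=> XN; have [NX|/subsetPn[y yN yX]] := boolP (N \subset X); last by right; exists y.
by left; apply/eqP; rewrite eqEsubset NX.
Qed.

Section Mutual.

Variable N : {set T}.
Hypotheses (NR : N \subset R) (Nlt : #|N| < #|R|) (Ncl : closed_set N) (sr : s r = 3).
Hypothesis Nr : {in N &, forall x y, y \notin cls x -> c x y = r}.

Let f3 : free 3 r S. Proof. by rewrite -sr; apply: fr. Qed.
Let NRx x : x \in N -> x \in R. Proof. exact: (subsetP NR). Qed.

Lemma mutual_sub x : x \in N -> cls x \subset S.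
Proof. by move=> xN; apply: subset_trans (Ncl xN) (subset_trans NR R_sub). Qed.

Lemma not_cls x y x' y' : x \in R -> y \in R -> y \notin cls x ->
  x' \in cls x -> y' \in cls y -> y' \notin cls x'.
Proof.
move=> xR yR yx x'x y'y; rewrite (C3 x'x); apply: contra yx => y'x.
by rewrite -(C3 y'x) (C3 y'y) C1.
Qed.

Lemma mutual_joined x y : x \in N -> y \in N -> y \notin cls x -> joined c r (cls x) (cls y).
Proof.
move=> xN yN yx u v ux vy; have vu := not_cls (NRx xN) (NRx yN) yx ux vy.
have uN := subsetP (Ncl xN) _ ux; have vN := subsetP (Ncl yN) _ vy.
split; last exact: Nr.
by apply: contraNneq vu => <-; apply: C1; apply: NRx.
Qed.

Lemma mutual_bound l x : x \in N -> l <= 3 -> free 0 b (cls x) -> free l r (cls x) ->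
  #|cls x| <= G l 0.
Proof.
move=> xN l3 fb fl; apply: piece0 => //; first exact: (C2 (NRx xN)).
exact: (cls_proper pr (NRx xN)).
Qed.

Lemma mutual_two x y : x \in N -> y \in N -> y \notin cls x -> has_P3 r (cls x) ->
  free 0 r (cls y).
Proof.
move=> xN yN yx P; exact: (@join0 _ _ c csym r S (cls x) _ (mutual_sub xN)
  (mutual_sub yN) (mutual_joined xN yN yx) f3 P).
Qed.

Lemma mutual_three x y z : x \in N -> y \in N -> z \in N -> y \notin cls x ->
  z \notin cls x -> z \notin cls y -> (exists u v, colour_rel (cls x) r u v) ->
  [/\ free 1 r (cls x), #|cls y| <= 1 & #|cls z| <= 1].
Proof.
move=> xN yN zN yx zx zy ed.
have [Sx Sy Sz] := And3 (mutual_sub xN) (mutual_sub yN) (mutual_sub zN).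
have SU : cls y :|: cls z \subset S by rewrite subUset Sy.
have J : joined c r (cls y :|: cls z) (cls x).
  by apply: joinedU; apply: joined_sym => //; apply: mutual_joined.
have f1 : free 1 r (cls y :|: cls z).
  exact: (@join1 _ _ c r S (cls x) _ Sx SU (joined_sym csym J) f3 ed).
have yz u v : u \in cls y -> v \in cls z -> colour_rel (cls y :|: cls z) r u v.
  move=> uy vz; have [uv cuv] := mutual_joined yN zN zy uy vz.
  by apply/and4P; rewrite !inE uy vz orbT cuv.
have [y0 z0] := (C1 (NRx yN), C1 (NRx zN)); split.
- apply: (@join1 _ _ c r S (cls y :|: cls z) _ SU Sx J f3).
  by exists y, z; apply: yz.
- apply/card_le1_eqP => u v uy vy.
  by apply: (f1 z); rewrite (cr_sym csym); apply: yz.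
by apply/card_le1_eqP => u v uz vz; apply: (f1 y); apply: yz.
Qed.

(** By the number of classes. With two, a P3 in one leaves no edge in the other; with three, an edge
    in one makes the others single vertices; with four, there is a K4 and [clique_bound] applies.
    When a class contains a P3, the structure of [N] is recorded too, because [case_H3_P3] needs
    more than its size. *)
Lemma mutual : {in N, forall x, free 0 b (cls x)} ->
  #|N| <= maxn (2 * G 1 0) (3 * G 0 0) \/
  exists x, [/\ x \in N, has_P3 r (cls x) & #|N| <= (G 2 0).+1 \/
    exists y, [/\ y \in N, y \notin cls x, 1 < #|cls y|, N = cls x :|: cls y &
      #|cls y| <= G 0 0 /\ #|cls x| <= G 2 0]].
Proof.
move=> fb; have [g1 g2 g3 g4 _] := G_small.
have bnd l x : x \in N -> l <= 3 -> free l r (cls x) -> #|cls x| <= G l 0.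
  by move=> xN l3; apply: mutual_bound => //; apply: fb.
have bnd2 x : x \in N -> #|cls x| <= G 2 0.
  by move=> xN; apply: bnd => //; apply: (class_H3 sr (NRx xN)).
have [->|[x1 n1]] := set_0Vmem N; first by left; rewrite cards0.
have [E|[x2 n2 x21]] := set_pick (Ncl n1).
  have [f1|P] := free1P c r (cls x1).
    by left; have := bnd 1 x1 n1 isT f1; rewrite -E; nat_lia.
  by right; exists x1; split=> //; left; rewrite {1}E; apply: leq_trans (bnd2 _ n1) _.
have x12 : x1 \notin cls x2 by apply: contra x21 => /C3 ->; apply: C1; apply: NRx.
have s12 : cls x1 :|: cls x2 \subset N by rewrite subUset (Ncl n1) (Ncl n2).
have two_case x y : x \in N -> y \in N -> y \notin cls x -> N = cls x :|: cls y ->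
    has_P3 r (cls x) -> exists x, [/\ x \in N, has_P3 r (cls x) & #|N| <= (G 2 0).+1 \/
    exists y, [/\ y \in N, y \notin cls x, 1 < #|cls y|, N = cls x :|: cls y &
      #|cls y| <= G 0 0 /\ #|cls x| <= G 2 0]].
  move=> xN yN yx E P; exists x; split=> //; have f0 := mutual_two xN yN yx P.
  have le := (leq_card_setU (cls x) (cls y)).1; rewrite -E in le.
  have := bnd2 x xN; have := bnd 0 y yN isT f0.
  case: (leqP #|cls y| 1) => [y1|fat] h1 h2; [left; nat_lia|right].
  by exists y.
have [E|[x3 n3]] := set_pick s12.
  have le := (leq_card_setU (cls x1) (cls x2)).1; rewrite -E in le.
  have [f1|Q1] := free1P c r (cls x1); last by right; apply: two_case E Q1.
  have [f2|Q2] := free1P c r (cls x2); last by right; apply: (two_case x2 x1) => //; rewrite setUC.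
  by left; have := bnd 1 x1 n1 isT f1; have := bnd 1 x2 n2 isT f2; nat_lia.
rewrite in_setU negb_or => /andP[x31 x32].
have x13 : x1 \notin cls x3 by apply: contra x31 => /C3 ->; apply: C1; apply: NRx.
have x23 : x2 \notin cls x3 by apply: contra x32 => /C3 ->; apply: C1; apply: NRx.
have s123 : cls x1 :|: cls x2 :|: cls x3 \subset N by rewrite subUset s12 (Ncl n3).
left; have [E|[x4 n4]] := set_pick s123.
  have le : #|N| <= #|cls x1| + #|cls x2| + #|cls x3|.
    have := (leq_card_setU (cls x1 :|: cls x2) (cls x3)).1; rewrite -E.
    by have := (leq_card_setU (cls x1) (cls x2)).1; nat_lia.
  have three x y z : x \in N -> y \in N -> z \in N -> y \notin cls x ->
     z \notin cls x -> z \notin cls y -> (exists u v, colour_rel (cls x) r u v) ->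
     #|cls x| + #|cls y| + #|cls z| <= 2 * G 1 0.
    move=> xN yN zN yx zx zy ed; have [f1 h1 h2] := mutual_three xN yN zN yx zx zy ed.
    by have := bnd 1 x xN isT f1; nat_lia.
  have [f1|e1] := free0P c r (cls x1); last by have := three _ _ _ n1 n2 n3 x21 x31 x32 e1; nat_lia.
  have [f2|e2] := free0P c r (cls x2); last by have := three _ _ _ n2 n1 n3 x12 x32 x31 e2; nat_lia.
  have [f3'|e3] := free0P c r (cls x3); last by have := three _ _ _ n3 n1 n2 x13 x23 x21 e3;
    nat_lia.
  have := bnd 0 x1 n1 isT f1; have := bnd 0 x2 n2 isT f2; have := bnd 0 x3 n3 isT f3'.
  by nat_lia.
rewrite !in_setU !negb_or -andbA => /and3P[x41 x42 x43].
suff : #|N| <= 4 by nat_lia.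
have ne x y : x \in N -> y \notin cls x -> x != y.
  by move=> xN; apply: contraNneq => <-; apply: C1; apply: NRx.
apply: (@clique_bound N x1 x2 x3 x4) => //; try (split; first [exact: Nr | exact: ne]).
move=> y yN.
have far x z : x \in N -> z \in N -> y \in cls x -> z \notin cls x -> c y z = r.
  by move=> xN zN yx zx; apply: Nr => //; rewrite (C3 yx).
have sym x z : x \in N -> z \in N -> z \notin cls x -> x \notin cls z.
  by move=> xN zN; apply: contra => /C3 ->; apply: C1; apply: NRx.
case: (boolP (y \in cls x2)) => [y2|y2].
  exists x2, x1, x3, x4; split; try (by apply: (far x2)).
  by apply/permP => a /=; nat_lia.
case: (boolP (y \in cls x3)) => [y3|y3].
  exists x3, x1, x2, x4; split; try (by apply: (far x3)).
  by apply/permP => a /=; nat_lia.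
case: (boolP (y \in cls x4)) => [y4|y4].
  exists x4, x1, x2, x3; split; try (by apply: (far x4) => //; apply: sym).
  by apply/permP => a /=; nat_lia.
exists x1, x2, x3, x4; split=> //; rewrite csym; exact: Nr.
Qed.

End Mutual.

(** Colour [b] is a matching on [N], so a class with a [b]-neighbour outside is a single vertex.
    Hence [N] falls into blocks [K x], each a class or a matched pair, joined to each other in
    colour [r]. There are at most two blocks if [r] avoids K3; if it avoids H3, there are at most
    three blocks or at most four vertices. *)
Lemma edge_bound (N : {set T}) : N \subset R -> #|N| < #|R| -> closed_set N -> free 1 b N ->
  {in N, forall x, free 1 r (cls x)} -> #|N| <= (if s r == 2 then 2 else 3) * G 1 0.
Proof.
move=> NR Nlt Ncl fb fr1; have [g1 g2 g3 g4 [_ _ g11 _]] := G_small.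
have NRx x : x \in N -> x \in R by apply: (subsetP NR).
have NSx x : x \in N -> x \in S by move/NRx/(subsetP R_sub).
pose K x := cls x :|: [set y in N | (y \notin cls x) && (c x y == b)].
have KN x : x \in N -> K x \subset N.
  by move=> xN; rewrite subUset (Ncl _ xN) /=; apply/subsetP => y; rewrite inE => /andP[].
have Kr x y : x \in N -> y \in N -> y \notin K x -> c x y = r.
  move=> xN yN; rewrite !inE yN /= negb_or negb_and => /andP[yx]; rewrite yx /= => cb.
  by case: (C4 (NRx _ xN) (NRx _ yN) yx) => // E; rewrite E eqxx in cb.
have crN x y : x \in N -> y \in N -> y \notin cls x -> c x y = b -> colour_rel N b x y.
  move=> xN yN yx cb; apply/and4P; split=> //; last exact/eqP.
  by apply: contraNneq yx => <-; apply: C1; apply: NRx.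
have Kle x : x \in N -> #|K x| <= G 1 0.
  move=> xN; have [/set0Pn[y]|] := boolP ([set y in N | (y \notin cls x) && (c x y == b)] != set0).
    rewrite inE => /and3P[yN yx /eqP cb].
    have xE x' : x' \in cls x -> x' = x.
      move=> x'x; apply: (fb y); rewrite (cr_sym csym) crN //.
        exact: (subsetP (Ncl _ xN)).
        by rewrite (C3 x'x).
      by rewrite (C5 (NRx _ xN) (NRx _ yN) x'x yx).
    have sub : K x \subset [set x; y].
      apply/subsetP => z; rewrite !in_setU !inE => /orP[/xE->|/and3P[zN zx /eqP zb]].
        by rewrite eqxx.
      by rewrite (fb x z y (crN _ _ xN zN zx zb) (crN _ _ xN yN yx cb)) eqxx orbT.
    have := subset_leq_card sub; rewrite cards2; case: (x != y) => /=; nat_lia.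
  rewrite negbK => /eqP E; rewrite /K E setU0 -g11; apply: piece0 => //.
  - exact: (C2 (NRx _ xN)).
  - exact: (cls_proper pr (NRx _ xN)).
  - exact: fr1.
  exact: (free_sub (Ncl _ xN) fb).
have [->|[x1 n1]] := set_0Vmem N; first by rewrite cards0.
have [E|[x2 n2 x21]] := set_pick (KN _ n1).
  by have := Kle _ n1; rewrite -E; case: (s r == 2); nat_lia.
have s12 : K x1 :|: K x2 \subset N by rewrite subUset !KN.
have [E|[x3 n3]] := set_pick s12.
  have := (leq_card_setU (K x1) (K x2)).1; rewrite -E.
  by have := Kle _ n1; have := Kle _ n2; case: (s r == 2); nat_lia.
rewrite in_setU negb_or => /andP[x31 x32].
have ne x y : x \in N -> y \notin K x -> x != y.
  by move=> xN; apply: contraNneq => <-; rewrite in_setU C1 // NRx.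
have crS x y : x \in N -> y \in N -> y \notin K x -> colour_rel S r x y.
  by move=> xN yN yx; apply/and4P; rewrite !NSx // ne //; split=> //; apply/eqP/Kr.
case: (s_r23 pr) => sr.
  have f2 : free 2 r S by rewrite -sr; apply: fr.
  by case: (f2 x1 x2 x3); apply: crS.
rewrite sr /=.
have s123 : K x1 :|: K x2 :|: K x3 \subset N by rewrite subUset s12 KN.
have [E|[x4 n4]] := set_pick s123.
  have := (leq_card_setU (K x1 :|: K x2) (K x3)).1; rewrite -E.
  have := (leq_card_setU (K x1) (K x2)).1.
  by have := Kle _ n1; have := Kle _ n2; have := Kle _ n3; nat_lia.
move=> n4'; have [x41 x42 x43] : [/\ x4 \notin K x1, x4 \notin K x2 & x4 \notin K x3].
  split; apply: contra n4'; apply/subsetP.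
  - exact: subset_trans (subsetUl _ _) (subsetUl _ _).
  - exact: subset_trans (subsetUr _ _) (subsetUl _ _).
  exact: subsetUr.
suff : #|N| <= 4 by nat_lia.
have cK x y : y \notin K x -> y \notin cls x by rewrite in_setU negb_or => /andP[].
apply: (@clique_bound N x1 x2 x3 x4) => //; try (split; first [exact: Kr | exact: ne]).
move=> y yN.
have cs x z : z \in N -> z \notin cls x -> x \notin cls z.
  by move=> zN; apply: contra => /C3 ->; apply: C1; apply: NRx.
have far x z : x \in N -> z \in N -> y \in cls x -> z \notin cls x -> c x z = r -> c y z = r.
  by move=> xN zN yx zx <-; apply: C5 => //; apply: NRx.
case: (boolP (y \in cls x1)) => [y1|y1].
  exists x1, x2, x3, x4; split=> //; apply: (far x1) => //; by [apply: cK | apply: Kr].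
case: (boolP (y \in cls x2)) => [y2|y2].
  exists x2, x1, x3, x4; split; first by apply/permP => a /=; nat_lia.
  - by apply: (far x2) => //; [apply: cs => //; apply: cK | rewrite csym; apply: Kr].
  - by apply: (far x2) => //; [apply: cK | apply: Kr].
  by apply: (far x2) => //; [apply: cK | apply: Kr].
case: (boolP (y \in cls x3)) => [y3|y3].
  exists x3, x1, x2, x4; split; first by apply/permP => a /=; nat_lia.
  - by apply: (far x3) => //; [apply: cs => //; apply: cK | rewrite csym; apply: Kr].
  - by apply: (far x3) => //; [apply: cs => //; apply: cK | rewrite csym; apply: Kr].
  by apply: (far x3) => //; [apply: cK | apply: Kr].
case: (boolP (y \in cls x4)) => [y4|y4].
  exists x4, x1, x2, x3; split; first by apply/permP => a /=; nat_lia.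
  - by apply: (far x4) => //; [apply: cs => //; apply: cK | rewrite csym; apply: Kr].
  - by apply: (far x4) => //; [apply: cs => //; apply: cK | rewrite csym; apply: Kr].
  by apply: (far x4) => //; [apply: cs => //; apply: cK | rewrite csym; apply: Kr].
(* Now [y] lies in none of the four classes; the matching allows it one edge of colour [b] towards
   [x1], ..., [x4], which leaves three of colour [r]. *)
have yc x : x \in N -> y \notin cls x -> c y x = r \/ colour_rel N b y x.
  move=> xN yx; case: (C4 (NRx _ yN) (NRx _ xN) (cs _ _ yN yx)) => E; first by left.
  by right; apply: crN => //; apply: cs.
have one x z : x != z -> colour_rel N b y x -> c y z = r \/ colour_rel N b y z -> c y z = r.
  by move=> xz yx [//|yz]; case/eqP: xz; apply: (fb y).
have [d12 d13 d14] := And3 (ne _ _ n1 x21) (ne _ _ n1 x31) (ne _ _ n1 x41).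
have [d23 d24 d34] := And3 (ne _ _ n2 x32) (ne _ _ n2 x42) (ne _ _ n3 x43).
case: (yc _ n2 y2) => [r2|b2]; last first.
  exists x2, x1, x3, x4; split; first by apply/permP => a /=; nat_lia.
  - by apply: (one x2) => //; [rewrite eq_sym | apply: yc].
  - by apply: (one x2) => //; apply: yc.
  by apply: (one x2) => //; apply: yc.
case: (yc _ n3 y3) => [r3|b3]; last first.
  exists x3, x1, x2, x4; split=> //; first by apply/permP => a /=; nat_lia.
  - by apply: (one x3) => //; [rewrite eq_sym | apply: yc].
  by apply: (one x3) => //; apply: yc.
case: (yc _ n4 y4) => [r4|b4]; last first.
  exists x4, x1, x2, x3; split=> //; first by apply/permP => a /=; nat_lia.
  by apply: (one x4) => //; [rewrite eq_sym | apply: yc].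
by exists x1, x2, x3, x4.
Qed.

(** [pick] depends only on the class as a set, so all its members get the same representative. The
    representatives span a complete graph in the colours [r] and [b], to which the Ramsey bounds
    apply. *)
Definition rep x := odflt x [pick y in cls x].
Definition reps (X : {set T}) := [set rep x | x in X].

Lemma rep_cls x : x \in R -> rep x \in cls x.
Proof. by move=> xR; rewrite /rep; case: pickP => //= /(_ x); rewrite C1. Qed.

Lemma rep_eq x y : x \in R -> y \in cls x -> rep y = rep x.
Proof. by move=> xR yx; rewrite /rep (C3 yx); case: pickP => //= /(_ x); rewrite C1. Qed.

Section Reps.

Variable X : {set T}.
Hypotheses (XR : X \subset R) (Xcl : closed_set X).

Lemma reps_sub : reps X \subset X.
Proof.
apply/subsetP => _ /imsetP[x xX ->]; apply: (subsetP (Xcl xX)).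
by apply/rep_cls/(subsetP XR).
Qed.

Lemma reps_neq : {in reps X &, forall x y, x != y -> y \notin cls x}.
Proof.
move=> _ _ /imsetP[x xX ->] /imsetP[y yX ->]; apply: contraNN => yx.
have [xR yR] := (subsetP XR _ xX, subsetP XR _ yX).
have h1 := rep_cls xR; have h2 := rep_cls yR; apply/eqP.
have E : cls x = cls y by rewrite -(C3 h1) -(C3 yx) (C3 h2).
by apply: (rep_eq yR); rewrite -E C1.
Qed.

Lemma reps_col : {in reps X &, forall x y, x != y ->
  colour_rel (reps X) b x y = ~~ colour_rel (reps X) r x y}.
Proof.
move=> x y xQ yQ xy; rewrite /colour_rel xQ yQ xy /=.
have [xX yX] := (subsetP reps_sub _ xQ, subsetP reps_sub _ yQ).
case: (C4 (subsetP XR _ xX) (subsetP XR _ yX) (reps_neq xQ yQ xy)) => ->; rewrite eqxx.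
  exact/negbTE.
by rewrite eq_sym rb.
Qed.

Lemma reps_cover : #|X| <= \sum_(q in reps X) #|cls q|.
Proof.
have sub : X \subset \bigcup_(q in reps X) cls q.
  apply/subsetP => x xX; apply/bigcupP; exists (rep x); first exact: imset_f.
  have xR := subsetP XR _ xX; by rewrite (C3 (rep_cls xR)) C1.
apply: leq_trans (subset_leq_card sub) _.
elim/big_rec2: _ => [|q n A _ le]; first by rewrite cards0.
by apply: leq_trans (leq_card_setU _ _).1 _; rewrite leq_add2l.
Qed.

(* Ten parts can occur (R(K3, H3) = 11), but nine of them contain a K4 of colour [b], whose
   parts are singletons: then at most six parts have size up to [a] and four size 1. *)
Lemma weighted_reps_le (w : T -> nat) a : s b = 3 -> K3_free (colour_rel (reps X) r) -> 2 <= a ->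
  {in reps X, forall q, w q <= a} -> {in reps X, forall q, #|cls q| <= 1 -> w q <= 1} ->
  \sum_(q in reps X) w q <= 8 * a.
Proof.
move=> sb f2 a2 wa w1; set Q := reps X in f2 wa w1 *.
have f3 : free 3 b S by rewrite -sb; apply: fr.
have QS : Q \subset S := subset_trans reps_sub (subset_trans XR R_sub).
have fH : H3_free (colour_rel Q b) := free_sub QS f3.
have es q := cr_sym csym Q q; have ei q := @cr_irr _ _ c Q q.
have Q10 : #|Q| <= 10 := ramsey_K3_H3 (es r) (es b) (ei r) (ei b) reps_col f2 fH.
have weighted_sum (Y : {set T}) m : {in Y, forall q, w q <= m} -> \sum_(q in Y) w q <= #|Y| * m.
  by move=> h; rewrite -sum_nat_const; apply: leq_sum.
case: (leqP #|Q| 8) => [Q8|Q9].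
  by apply: leq_trans (weighted_sum _ _ wa) _; rewrite leq_mul2r Q8 orbT.
have [x [y [z [v [[xQ yQ zQ vQ] [xy xz xv] [yz yv zv]]]]]] :=
  ramsey_K3_K4 (es r) (es b) (ei r) (ei b) reps_col f2 fH Q9.
have single p q1 q2 q3 : p \in Q -> colour_rel Q b p q1 -> colour_rel Q b p q2 -> colour_rel Q b p
  q3 ->
    colour_rel Q b q1 q2 -> colour_rel Q b q1 q3 -> colour_rel Q b q2 q3 -> w p <= 1.
  move=> pQ c1 c2 c3 c12 c13 c23; apply: w1 => //; apply/card_le1_eqP => u u' up u'p.
  have pR : p \in R by apply: (subsetP XR); apply: (subsetP reps_sub).
  have key q t : colour_rel Q b p q -> t \in cls p -> colour_rel S b q t.
    move=> /and4P[_ qQ pq /eqP cb] tp.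
    have qR : q \in R by apply: (subsetP XR); apply: (subsetP reps_sub).
    have np := reps_neq pQ qQ pq.
    rewrite (cr_sym csym); apply/and4P; split; last by rewrite (C5 pR qR tp np) cb.
    - exact: (subsetP (clsS pr pR)).
    - exact: (subsetP QS).
    by apply: contraNneq np => <-.
  have QSb q q' : colour_rel Q b q q' -> colour_rel S b q q' by apply: cr_sub.
  apply: (f3 q1 q2 q3); try (exact: QSb); by apply: key.
pose F := [set x; y] :|: [set z; v].
have nq p q : colour_rel Q b p q -> p != q by case/and4P.
have FQ : F \subset Q by rewrite !subUset !sub1set xQ yQ zQ vQ.
have F4 : #|F| = 4.
  rewrite cardsU !cards2 (nq _ _ xy) (nq _ _ zv); suff -> : [set x; y] :&: [set z; v] = set0.
    by rewrite cards0.
  apply/setP => u; rewrite !inE; apply/negP => /andP[/orP[]/eqP-> /orP[]].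
  - by apply/negP/nq.
  - by apply/negP/nq.
  - by apply/negP/nq.
  by apply/negP/nq.
have wF : {in F, forall q, w q <= 1}.
  move=> q; rewrite !inE -orbA => /or4P[]/eqP->.
  - exact: (single x y z v).
  - by apply: (single y x z v) => //; rewrite es.
  - by apply: (single z x y v) => //; rewrite es.
  by apply: (single v x y z) => //; rewrite es.
rewrite (big_setID F) (setIidPr FQ) /=.
have h1 := weighted_sum F 1 wF; have h2 : \sum_(q in Q :\: F) w q <= #|Q :\: F| * a.
  by apply: weighted_sum => q; rewrite inE => /andP[_ /wa].
have h3 : #|Q :\: F| <= 6 by rewrite cardsD (setIidPr FQ) F4; nat_lia.
have h4 : #|Q :\: F| * a <= 6 * a by rewrite leq_mul2r h3 orbT.
by move: h1 h2 h4; rewrite F4; nat_lia.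
Qed.

End Reps.

(** [U2] is added to the class of one representative only, so it costs no extra term. *)
Lemma weight_sum n : {in R, forall x, free 0 r (cls x) /\ free 0 b (cls x)} ->
  #|reps R| <= n -> #|R| + #|U2| <= n * G 0 0.
Proof.
move=> f00 Qn; have Rcl : closed_set R by move=> x; apply: C2.
have [x xR] : exists x, x \in R by apply/card_gt0P; apply: ltnW (ltnW R3).
have QR := reps_sub (subxx R) Rcl.
have pc q : q \in R -> #|cls q| + #|U2| <= G 0 0.
  move=> qR; have [h1 h2] := f00 q qR; apply: piece => //; first exact: (C2 qR).
  exact: (cls_proper pr qR).
have qQ : rep x \in reps R by apply: imset_f.
have := reps_cover (subxx R); rewrite (bigD1 (rep x)) //= => le.
have h : \sum_(q in reps R | q != rep x) #|cls q| <= (#|reps R|).-1 * G 0 0.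
  have -> : (#|reps R|).-1 = #|reps R :\ rep x| by rewrite (cardsD1 (rep x)) qQ.
  rewrite -sum_nat_const (eq_bigl (fun q => q \in reps R :\ rep x)); last first.
    by move=> q; rewrite !inE andbC.
  apply: leq_sum => q; rewrite in_setD1 => /andP[_ /(subsetP QR) qR].
  by apply: leq_trans (leq_addr _ _) (pc _ qR).
have Q0 : 0 < #|reps R| by apply/card_gt0P; exists (rep x).
have := pc _ (subsetP QR _ qQ); move=> h1.
have h2 : (#|reps R|).-1 * G 0 0 + G 0 0 = #|reps R| * G 0 0.
  by rewrite -[in RHS](prednK Q0) mulSn addnC.
have h3 : #|reps R| * G 0 0 <= n * G 0 0 by rewrite leq_mul2r Qn orbT.
by move: le h h1 h2 h3; nat_lia.
Qed.

Lemma nb_closed q x : x \in R -> closed_set (nb q x).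
Proof. by move=> xR y yN; apply: (nb_cls pr yN). Qed.

Lemma nb_free2 x : s r = 3 -> x \in R -> 1 < #|cls x| -> free 2 r (nb r x).
Proof.
move=> sr xR fat; have f3 : free 3 r S by rewrite -sr; apply: fr.
exact: (@join2 _ _ c csym r S (cls x) _ (clsS pr xR) (nb_rS _ _ _) (nb_joined pr xR) f3 fat).
Qed.

Lemma nb_free1 x : s r = 3 -> x \in R -> (exists u v, colour_rel (cls x) r u v) -> free 1 r (nb r
  x).
Proof.
move=> sr xR e; have f3 : free 3 r S by rewrite -sr; apply: fr.
exact: (@join1 _ _ c r S (cls x) _ (clsS pr xR) (nb_rS _ _ _) (nb_joined pr xR) f3 e).
Qed.

Lemma nb_free0 x : s r = 3 -> x \in R -> has_P3 r (cls x) -> free 0 r (nb r x).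
Proof.
move=> sr xR e; have f3 : free 3 r S by rewrite -sr; apply: fr.
exact: (@join0 _ _ c csym r S (cls x) _ (clsS pr xR) (nb_rS _ _ _) (nb_joined pr xR) f3 e).
Qed.

Lemma nb_free0_K3 x : s r = 2 -> x \in R -> free 0 r (nb r x).
Proof.
move=> sr xR; have f2 : free 2 r S by rewrite -sr; apply: fr.
exact: (@join_K3 _ _ c r S (cls x) _ (clsS pr xR) (nb_rS _ _ _) (nb_joined pr xR) f2
  (cls_neq0 pr xR)).
Qed.

Lemma edge_fat q X : (exists u v, colour_rel X q u v) -> 1 < #|X|.
Proof. by move=> [u [v /and4P[uX vX uv _]]]; apply/card_gt1P; exists u, v. Qed.

Lemma nb_free0_peeled x : peeled r -> x \in R -> 1 < #|cls x| -> free 0 r (nb r x).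
Proof.
move=> /exists_inP[v vU /eqP vr] xR /card_gt1P[y [z [yx zx yz]]].
have sr : s r = 3 by rewrite -vr P4.
have f3 : free 3 r S by rewrite -sr; apply: fr.
have vN : cls x :|: [set v] \subset S by rewrite sub_RU ?C2 // sub1set.
have J : joined c r (cls x :|: [set v]) (nb r x).
  by apply: joinedU; [apply: (nb_joined pr xR) | rewrite -vr; apply: v_joined (nb_sub _ _ _)].
apply: (@join0 _ _ c csym r S _ (nb r x) vN (nb_rS _ _ _) J f3).
have vcr w : w \in cls x -> colour_rel (cls x :|: [set v]) r v w.
  move=> wN; have wR := subsetP (C2 xR) _ wN.
  apply/and4P; split; rewrite ?in_setU ?wN ?inE ?eqxx ?orbT //.
    by apply: contraTneq wR => <-; rewrite inE vU.
  by rewrite P1 // vr.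
by exists v, y, z; split=> //; apply: vcr.
Qed.

Lemma no_colour (N : {set T}) : N \subset R -> free 0 b N ->
  {in N &, forall x y, y \notin cls x -> c x y = r}.
Proof.
move=> NR fb x y xN yN yx; have [xR yR] := (subsetP NR _ xN, subsetP NR _ yN).
case: (C4 xR yR yx) => // cb; case: (fb x y); apply/and4P; split=> //; last exact/eqP.
by apply: contraNneq yx => <-; apply: C1.
Qed.

Lemma mutual_le (N : {set T}) : N \subset R -> #|N| < #|R| -> closed_set N -> s r = 3 ->
  free 0 b N ->
  [|| #|N| <= 2 * G 1 0, #|N| <= 3 * G 0 0, #|N| <= (G 2 0).+1 | #|N| <= G 0 0 + G 2 0].
Proof.
move=> NR Nlt Ncl sr fb.
have f0 : {in N, forall x, free 0 b (cls x)} by move=> x xN; apply: free_sub (Ncl _ xN) fb.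
have [h|[x [xN _ [h|[y [_ _ _ E [h1 h2]]]]]]] := mutual NR Nlt Ncl sr (no_colour NR fb) f0.
- by move: h; nat_lia.
- by move: h; nat_lia.
have := (leq_card_setU (cls x) (cls y)).1; rewrite -E; move: h1 h2; nat_lia.
Qed.

(** Three classes joined in colour [r] would contain a K3 of that colour. *)
Lemma two_bound (N : {set T}) : N \subset R -> #|N| < #|R| -> closed_set N -> s r = 2 ->
  free 0 b N -> #|N| <= 2 * G 0 0.
Proof.
move=> NR Nlt Ncl sr fb; have f2 : free 2 r S by rewrite -sr; apply: fr.
have NRx x : x \in N -> x \in R by apply: (subsetP NR).
have bnd x : x \in N -> #|cls x| <= G 0 0.
  move=> xN; apply: piece0 => //; first exact: (C2 (NRx _ xN)).
  - exact: (cls_proper pr (NRx _ xN)).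
  - exact: (class_K3 sr (NRx _ xN)).
  exact: free_sub (Ncl _ xN) fb.
have [->|[x1 n1]] := set_0Vmem N; first by rewrite cards0.
have [E|[x2 n2 x21]] := set_pick (Ncl _ n1).
  by have := bnd _ n1; rewrite -E; nat_lia.
have s12 : cls x1 :|: cls x2 \subset N by rewrite subUset !Ncl.
have [E|[x3 n3]] := set_pick s12.
  have := (leq_card_setU (cls x1) (cls x2)).1; rewrite -E.
  by have := bnd _ n1; have := bnd _ n2; nat_lia.
rewrite in_setU negb_or => /andP[x31 x32].
have crS x y : x \in N -> y \in N -> y \notin cls x -> colour_rel S r x y.
  move=> xN yN yx; apply/and4P; split; try (by apply: (subsetP R_sub); apply: NRx).
    by apply: contraNneq yx => <-; apply: C1; apply: NRx.
  by apply/eqP; apply: (no_colour NR fb).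
by case: (f2 x1 x2 x3); apply: crS.
Qed.

Lemma reps_diamond (X : {set T}) : X \subset R -> peeled r -> diamond_free (colour_rel X r).
Proof.
move=> XR /exists_inP[v vU /eqP vr] x y z w xy xz yz xw yw.
have sr : s r = 3 by rewrite -vr P4.
have f3 : free 3 r S by rewrite -sr; apply: fr.
have XS := subset_trans XR R_sub.
have vcr u : u \in X -> colour_rel S r v u.
  move=> uX; have uR := subsetP XR _ uX; apply/and4P; split.
  - exact: (subsetP US).
  - exact: (subsetP R_sub).
  - by apply: contraTneq uR => <-; rewrite inE vU.
  by rewrite P1 // vr.
have [[xX yX] [_ zX]] := (cr_mem xy, cr_mem xz); have [_ wX] := cr_mem xw.
by apply: (f3 v x y); try (exact: vcr); apply: (cr_sub XS).
Qed.

Lemma reps_K3 (X : {set T}) : X \subset R -> s r = 2 -> K3_free (colour_rel X r).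
Proof.
move=> XR sr; have f2 : free 2 r S by rewrite -sr; apply: fr.
exact: free_sub (subset_trans XR R_sub) f2.
Qed.

Lemma reps_H3 (X : {set T}) : X \subset R -> H3_free (colour_rel X r).
Proof.
move=> XR; have := free_le csym (s3 r) (fr r).
exact: free_sub (subset_trans XR R_sub).
Qed.

Lemma peel_total : #|S| <= #|R| + #|U2| + peeled r + peeled b.
Proof. by rewrite cardSR; have := card_U2; nat_lia. Qed.

Lemma peeled_H3 j : peeled j -> s j = 3.
Proof. by case/exists_inP => v vU /eqP <-; apply: P4. Qed.

Lemma no_fat : {in R, forall x, #|cls x| <= 1} -> #|R| <= #|reps R| /\ #|U2| < G 0 0.
Proof.
move=> one; split.
  apply: leq_trans (reps_cover (subxx R)) _; rewrite -sum1_card; apply: leq_sum => q.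
  have Rcl : closed_set R by move=> x; apply: C2.
  by move/(subsetP (reps_sub (subxx R) Rcl))/one.
have [x xR] : exists x, x \in R by apply/card_gt0P; apply: ltnW (ltnW R3).
have h : #|cls x| + #|U2| <= G 0 0.
  apply: piece => //; first exact: (C2 xR).
  - exact: (cls_proper pr xR).
  - exact: free_single (one _ xR).
  exact: free_single (one _ xR).
by have := cls_neq0 pr xR; rewrite -card_gt0; move: h; nat_lia.
Qed.

End Pieces.

(** * Cases according to the constraints on the two partition colours *)

Section Cases.

Variables (r b : 'I_k) (cls : T -> {set T}).
Hypothesis pr : gallai_partition r b cls.
Let rb := parts_neq pr.
Let pr' := parts_sym pr.
Let C2 := parts_sub pr.
Local Notation nb := (nb cls).
Local Notation G := (gmax2 r b s).

Let Rcl : closed_set cls R. Proof. by move=> x; apply: C2. Qed.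
Let esQ q (Q : {set T}) := cr_sym csym Q q.
Let eiQ q (Q : {set T}) := @cr_irr _ _ c Q q.
Let QR := reps_sub pr (subxx R) Rcl.
Let colQ := reps_col pr (subxx R) Rcl.

Lemma peeled_K3 q : s q = 2 -> peeled q = false.
Proof. by move=> sq; case E: (peeled q) => //; have := peeled_H3 E; rewrite sq. Qed.

Lemma case_K3_K3 : s r = 2 -> s b = 2 -> False.
Proof.
move=> sr sb; have nI := conj (peeled_K3 sr) (peeled_K3 sb).
have Q5 := ramsey_K3_K3 (esQ r _) (esQ b _) (eiQ r _) (eiQ b _) colQ
  (reps_K3 QR sr) (reps_K3 QR sb).
have h := weight_sum pr (fun x xR => conj (class_K3 pr sr xR) (class_K3 pr' sb xR)) Q5.
have := peel_total r b; have := gmax2E s rb; rewrite sr sb.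
by case: nI => -> ->; move: big h => bg h h1 h2; gmax_lia r b s.
Qed.

Lemma case_K3_peeled : s r = 2 -> peeled b -> False.
Proof.
move=> sr Ib; have sb := peeled_H3 Ib.
have fe : {in reps cls R &, forall x y, x != y ->
    colour_rel (reps cls R) r x y = ~~ colour_rel (reps cls R) b x y}.
  by move=> x y xQ yQ xy; rewrite colQ // negbK.
have Q6 := ramsey_diamond_K3 (esQ b _) (esQ r _) (eiQ b _) (eiQ r _) fe
  (reps_diamond QR Ib) (reps_K3 QR sr).
have h := weight_sum pr (fun x xR => conj (class_K3 pr sr xR) (class_peeled pr' Ib xR)) Q6.
have h1 := peel_total r b; have h2 := gmax2E s rb; rewrite sr sb in h2.
by rewrite (peeled_K3 sr) Ib in h1; have bg := big; gmax_lia r b s.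
Qed.

(** An edge or a P3 of colour [b] in a class restricts its [b]-neighbourhood so strongly that the
    class and its two neighbourhoods together are too small. Otherwise the classes have no edge of
    either colour and are counted through their representatives. *)
Lemma case_K3_H3 : s r = 2 -> s b = 3 -> peeled b = false -> False.
Proof.
move=> sr sb nIb; have h2 := gmax2E s rb; rewrite sr sb in h2.
have h1 := peel_total r b; rewrite (peeled_K3 sr) nIb !addn0 in h1; have bg := big.
have e10 : gmax2 b r s 1 0 = G 0 1 by apply: gmax2C.
have e00 : gmax2 b r s 0 0 = G 0 0 by apply: gmax2C.
have e20 : gmax2 b r s 2 0 = G 0 2 by apply: gmax2C.
have key x : x \in R -> (has_P3 b (cls x) -> False) /\ (free 0 b (cls x) \/ False).
  move=> xR.
  have cx := card_nb pr xR; have ltx := cls_proper pr xR.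
  have Nb := @nb_closed r b cls pr b x xR; have Nr := @nb_closed r b cls pr r x xR.
  have ltb := nb_b_proper pr xR; have ltr := nb_r_proper pr xR.
  have fr0 := nb_free0_K3 pr sr xR.
  have noP y : y \in R -> has_P3 b (cls y) -> False.
    move=> {x xR cx ltx Nb Nr ltb ltr fr0} yR P.
    have cx := card_nb pr yR; have ltx := cls_proper pr yR.
    have Nb := @nb_closed r b cls pr b y yR; have Nr := @nb_closed r b cls pr r y yR.
    have ltb := nb_b_proper pr yR; have ltr := nb_r_proper pr yR.
    have fr0 := nb_free0_K3 pr sr yR.
    have b1 : #|cls y| + #|U2 r b| <= G 0 2.
      by apply: (piece pr) => //; [apply: C2 | apply: (class_K3 pr) | apply: (class_H3 pr')].
    have b2 := two_bound pr (nb_sub _ _ _) ltb Nb sr (nb_free0 pr' sb yR P).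
    have := mutual_le pr' (nb_sub _ _ _) ltr Nr sb fr0.
    rewrite e10 e00 e20 => b3; gmax_lia r b s.
  split; first exact: noP.
  have [|e] := free0P c b (cls x); [by left | right].
  have f1 y : y \in R -> free 1 b (cls y).
    by move=> yR; have [//|P] := free1P c b (cls y); case: (noP y yR P).
  have b1 : #|cls x| + #|U2 r b| <= G 0 1.
    by apply: (piece pr) => //; [apply: C2 | apply: (class_K3 pr) | apply: f1].
  have b2 : #|nb b x| <= 2 * G 1 0.
    have := edge_bound pr (nb_sub _ _ _) ltb Nb (nb_free1 pr' sb xR e); rewrite sr /=; apply.
    move=> y yN; apply: (free_le csym (isT : 0 <= 1)); apply: (class_K3 pr sr).
    exact: (subsetP (nb_sub _ _ _) _ yN).
  have [|[y [yN P _]]] := mutual pr' (nb_sub _ _ _) ltr Nr sb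
    (no_colour pr' (nb_sub _ _ _) fr0) (fun y yN => class_K3 pr sr (subsetP (nb_sub _ _ _) y yN)).
    by rewrite e10 e00 => b3; gmax_lia r b s.
  by apply: (noP y) => //; apply: (subsetP (nb_sub _ _ _)) yN.
have f00 x : x \in R -> free 0 r (cls x) /\ free 0 b (cls x).
  by move=> xR; split; [apply: (class_K3 pr) | have [_ []] := key x xR].
have f3 := reps_H3 (r := b) QR.
have Q10 := ramsey_K3_H3 (esQ r _) (esQ b _) (eiQ r _) (eiQ b _) colQ (reps_K3 QR sr) f3.
have [/exists_inP[x xR fat]|/exists_inPn nofat] := boolP [exists x in R, 1 < #|cls x|]; last first.
  have [] := no_fat pr (cls := cls); last by move=> h3 h4; gmax_lia r b s.
  by move=> x xR; have := nofat x xR; rewrite -leqNgt.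
(* [U2] is charged to a class with two vertices, so that the single vertices keep weight 1. *)
pose q0 := rep cls x; pose w q := #|cls q| + (q == q0) * #|U2 r b|.
have q0c : q0 \in cls x := rep_cls pr xR.
have w1 : {in reps cls R, forall q, w q <= G 0 0}.
  move=> q /(subsetP QR) qR; have [f1 f2] := f00 q qR.
  have : #|cls q| + #|U2 r b| <= G 0 0.
    by apply: (piece pr) => //; [apply: C2 | apply: (cls_proper pr)].
  by rewrite /w; case: (q == q0) => /=; nat_lia.
have w2 : {in reps cls R, forall q, #|cls q| <= 1 -> w q <= 1}.
  move=> q _ le; rewrite /w; case: eqP => [E|_]; last by move: le; nat_lia.
  by move: le; rewrite E (parts_eq pr q0c); move: fat; nat_lia.
have a2 : 2 <= G 0 0.
  have [g1 g2] := f00 x xR; have : #|cls x| <= G 0 0.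
    by apply: (piece0 pr) => //; [apply: C2 | apply: (cls_proper pr)].
  by move: fat; nat_lia.
have := weighted_reps_le pr (subxx R) Rcl sb (reps_K3 QR sr) a2 w1 w2.
rewrite big_split /= => le; have := reps_cover pr (subxx R).
have q0Q : q0 \in reps cls R by apply: imset_f.
have : #|U2 r b| <= \sum_(q in reps cls R) (q == q0) * #|U2 r b|.
  by rewrite (bigD1 q0) //= eqxx mul1n leq_addr.
by move=> h3 h4; gmax_lia r b s.
Qed.

Lemma case_peeled_peeled : peeled r -> peeled b -> False.
Proof.
move=> Ir Ib; have [sr sb] := (peeled_H3 Ir, peeled_H3 Ib).
have Q12 := ramsey_diamond_H3 (esQ r _) (esQ b _) (eiQ r _) (eiQ b _) colQ
  (reps_diamond QR Ir) (reps_H3 QR).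
have h := weight_sum pr (fun x xR => conj (class_peeled pr Ir xR) (class_peeled pr' Ib xR)) Q12.
have h1 := peel_total r b; have h2 := gmax2E s rb; rewrite sr sb in h2.
by rewrite Ir Ib in h1; have bg := big; gmax_lia r b s.
Qed.

Lemma case_peeled_H3 : peeled r -> s b = 3 -> peeled b = false -> False.
Proof.
move=> Ir sb nIb; have sr := peeled_H3 Ir.
have h1 := peel_total r b; have h2 := gmax2E s rb; rewrite sr sb in h2.
rewrite Ir nIb in h1; have bg := big.
have f00 x : x \in R -> free 0 r (cls x) /\ free 0 b (cls x).
  move=> xR; split; first exact: (class_peeled pr Ir xR).
  have [//|e] := free0P c b (cls x).
  have cx := card_nb pr xR; have ltx := cls_proper pr xR.
  have ltb := nb_b_proper pr xR; have ltr := nb_r_proper pr xR.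
  have b1 : #|cls x| + #|U2 r b| <= G 0 2.
    by apply: (piece pr) => //; [apply: C2 | apply: (class_peeled pr) | apply: (class_H3 pr')].
  have b2 : #|nb b x| <= G 3 1.
    apply: (piece0 pr) => //; [exact: nb_sub | exact: (reps_H3 (nb_sub _ _ _)) |].
    exact: (nb_free1 pr').
  have b3 : #|nb r x| <= G 0 3.
    apply: (piece0 pr) => //; [exact: nb_sub | | exact: (reps_H3 (nb_sub _ _ _))].
    exact: (nb_free0_peeled pr Ir xR (edge_fat e)).
  by gmax_lia r b s.
have Q12 := ramsey_diamond_H3 (esQ r _) (esQ b _) (eiQ r _) (eiQ b _) colQ
  (reps_diamond QR Ir) (reps_H3 QR).
have h := weight_sum pr f00 Q12; gmax_lia r b s.
Qed.

Lemma case_H3_P3 x : s r = 3 -> s b = 3 -> peeled r = false -> peeled b = false ->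
  x \in R -> has_P3 b (cls x) -> False.
Proof.
move=> sr sb nIr nIb xR P.
have h1 := peel_total r b; have h2 := gmax2E s rb; rewrite sr sb in h2.
rewrite nIr nIb !addn0 in h1; have bg := big.
have e10 : gmax2 b r s 1 0 = G 0 1 by apply: gmax2C.
have e00 : gmax2 b r s 0 0 = G 0 0 by apply: gmax2C.
have e20 : gmax2 b r s 2 0 = G 0 2 by apply: gmax2C.
have cx := card_nb pr xR; have ltx := cls_proper pr xR.
have Nb := @nb_closed r b cls pr b x xR; have Nr := @nb_closed r b cls pr r x xR.
have ltb := nb_b_proper pr xR; have ltr := nb_r_proper pr xR.
have fb0 := nb_free0 pr' sb xR P; have fat := P3_fat P.
have mb := mutual_le pr (nb_sub _ _ _) ltb Nb sr fb0.
have pc i j : i <= 3 -> j <= 3 -> free i r (cls x) -> free j b (cls x) ->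
    #|cls x| + #|U2 r b| <= G i j.
  by move=> i3 j3 fi fj; apply: (piece pr) => //; apply: C2.
have pn i j : i <= 3 -> j <= 3 -> free i r (nb r x) -> free j b (nb r x) -> #|nb r x| <= G i j.
  by move=> i3 j3 fi fj; apply: (piece0 pr) => //; apply: nb_sub.
have fb2 : free 2 b (cls x) := class_H3 pr' sb xR.
have fb3 : free 3 b (nb r x) := reps_H3 (nb_sub _ _ _).
have [f0|e] := free0P c r (cls x); last first.
  have [f1|Pr] := free1P c r (cls x).
    have b1 := pc 1 2 isT isT f1 fb2.
    have b2 := pn 1 3 isT isT (nb_free1 pr sr xR e) fb3.
    by gmax_lia r b s.
  have b1 := pc 2 2 isT isT (class_H3 pr sr xR) fb2.
  have := mutual_le pr' (nb_sub _ _ _) ltr Nr sb (nb_free0 pr sr xR Pr).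
  by rewrite e10 e00 e20 => b2; gmax_lia r b s.
have b1 := pc 0 2 isT isT f0 fb2.
have b2 := pn 2 3 isT isT (nb_free2 pr sr xR fat) fb3.
have [le|[y [yN Py [le|[z [zN zy zfat E [lez ley]]]]]]] := mutual pr (nb_sub _ _ _) ltb Nb sr
    (no_colour pr (nb_sub _ _ _) fb0) (fun y yN => free_sub (Nb y yN) fb0).
- by clear mb; gmax_lia r b s.
- by clear mb; gmax_lia r b s.
(* Adding the bounds for the class of [x] and its two neighbourhoods would give [2 * d + a + k], in
   the notation of [gmax_ineqs]. This can exceed [hh]: for [p = true], [t = 0], [h = 1] it is 106
   against 102. A cover that also uses the neighbourhoods of [y], whose class contains a P3 of
   colour [r], is smaller. *)
have yR : y \in R := subsetP (nb_sub cls b x) _ yN.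
have zR : z \in R := subsetP (nb_sub cls b x) _ zN.
have Nry := @nb_closed r b cls pr r y yR.
have ltry := nb_r_proper pr yR; have ltby := nb_b_proper pr yR.
have yfat := P3_fat Py.
have := mutual_le pr' (nb_sub _ _ _) ltry Nry sb (nb_free0 pr sr yR Py).
rewrite e10 e00 e20 => b3.
have b4 : #|nb b y :&: nb r x| <= G 2 2.
  apply: (piece0 pr) => //.
  - exact: subset_trans (subsetIl _ _) (nb_sub _ _ _).
  - exact: leq_ltn_trans (subset_leq_card (subsetIl _ _)) ltby.
  - exact: free_sub (subsetIr _ _) (nb_free2 pr sr xR fat).
  exact: free_sub (subsetIl _ _) (nb_free2 pr' sb yR yfat).
have cyz : c y z = r by apply: (no_colour pr (nb_sub _ _ _) fb0).
have zNy : z \in nb r y by rewrite inE zR zy cyz eqxx.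
have sub : R \subset cls x :|: (cls y :|: (nb r y :|: (nb b y :&: nb r x))).
  rewrite {1}(nb_split pr xR) !subUset subsetUl /=; apply/andP; split; apply/subsetP => w wN.
    have wR := subsetP (nb_sub cls r x) _ wN.
    have : w \in cls y :|: (nb r y :|: nb b y) by rewrite -(nb_split pr yR).
    rewrite in_setU in_setU => /or3P[h|h|h].
    - by rewrite in_setU in_setU h orbT.
    - by rewrite in_setU in_setU in_setU h !orbT.
    by rewrite in_setU in_setU in_setU in_setI h wN !orbT.
  move: wN; rewrite E in_setU => /orP[h|h]; first by rewrite in_setU in_setU h orbT.
  by rewrite in_setU in_setU in_setU (subsetP (nb_cls pr zNy yR) _ h) !orbT.
have c1 := subset_leq_card sub.
have c2 := (leq_card_setU (cls x) (cls y :|: (nb r y :|: (nb b y :&: nb r x)))).1.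
have c3 := (leq_card_setU (cls y) (nb r y :|: (nb b y :&: nb r x))).1.
have c4 := (leq_card_setU (nb r y) (nb b y :&: nb r x)).1.
by clear mb b2 cx; gmax_lia r b s.
Qed.

Lemma case_H3_edge x : s r = 3 -> s b = 3 -> peeled r = false -> peeled b = false ->
  {in R, forall y, free 1 r (cls y) /\ free 1 b (cls y)} ->
  x \in R -> (exists u v, colour_rel (cls x) b u v) -> False.
Proof.
move=> sr sb nIr nIb f11 xR e.
have h1 := peel_total r b; have h2 := gmax2E s rb; rewrite sr sb in h2.
rewrite nIr nIb !addn0 in h1; have bg := big.
have e10 : gmax2 b r s 1 0 = G 0 1 by apply: gmax2C.
have cx := card_nb pr xR; have ltx := cls_proper pr xR.
have Nb := @nb_closed r b cls pr b x xR; have Nr := @nb_closed r b cls pr r x xR.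
have ltb := nb_b_proper pr xR; have ltr := nb_r_proper pr xR.
have fat := edge_fat e; have [f1r f1b] := f11 x xR.
have sub1 q (N : {set T}) : N \subset R -> {in N, forall y, q = r \/ q = b -> free 1 q (cls y)}.
  by move=> NR y yN [->|->]; have [] := f11 y (subsetP NR _ yN).
have b1 : #|nb b x| <= 3 * G 1 0.
  have := edge_bound pr (nb_sub _ _ _) ltb Nb (nb_free1 pr' sb xR e); rewrite sr /=; apply.
  by move=> y yN; apply: (sub1 r _ (nb_sub _ _ _) y yN); left.
have [f0|er] := free0P c r (cls x).
  have b2 : #|cls x| + #|U2 r b| <= G 0 1 by apply: (piece pr) => //; apply: C2.
  have b3 : #|nb r x| <= G 2 3.
    apply: (piece0 pr) => //; [exact: nb_sub | exact: (nb_free2 pr sr xR fat) |].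
    exact: (reps_H3 (nb_sub _ _ _)).
  by gmax_lia r b s.
have b2 : #|cls x| + #|U2 r b| <= G 1 1 by apply: (piece pr) => //; apply: C2.
have b3 : #|nb r x| <= 3 * G 0 1.
  have := edge_bound pr' (nb_sub _ _ _) ltr Nr (nb_free1 pr sr xR er); rewrite sb /= e10; apply.
  by move=> y yN; apply: (sub1 b _ (nb_sub _ _ _) y yN); right.
by gmax_lia r b s.
Qed.

(** The source of 17 = 1 + 8 + 8: next to a class with two vertices, the representatives in each
    neighbourhood have no triangle of the joining colour, so each neighbourhood has at most 8 times
    the size of a class. If all classes are single vertices, there are at most 21 of them. *)
Lemma case_H3_free : s r = 3 -> s b = 3 -> peeled r = false -> peeled b = false ->
  {in R, forall y, free 0 r (cls y) /\ free 0 b (cls y)} -> False.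
Proof.
move=> sr sb nIr nIb f00.
have h1 := peel_total r b; have h2 := gmax2E s rb; rewrite sr sb in h2.
rewrite nIr nIb !addn0 in h1; have bg := big.
have [/exists_inP[x xR fat]|/exists_inPn nofat] := boolP [exists x in R, 1 < #|cls x|]; last first.
  have Q21 := ramsey_H3_H3 (esQ r _) (esQ b _) (eiQ r _) (eiQ b _) colQ
    (reps_H3 QR) (reps_H3 QR).
  have [] := no_fat pr (cls := cls); last by move=> h3 h4; gmax_lia r b s.
  by move=> x xR; have := nofat x xR; rewrite -leqNgt.
have pc y : y \in R -> #|cls y| + #|U2 r b| <= G 0 0.
  move=> yR; have [f1 f2] := f00 y yR.
  by apply: (piece pr) => //; [apply: C2 | apply: (cls_proper pr)].
have b1 := pc x xR; have a2 : 2 <= G 0 0 by move: fat b1; nat_lia.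
have b2 : #|nb b x| <= 8 * G 0 0.
  have Nb := @nb_closed r b cls pr b x xR; have NR := nb_sub cls b x.
  have sub := reps_sub pr NR Nb.
  apply: leq_trans (reps_cover pr NR) _.
  apply: (weighted_reps_le pr' NR Nb sr _ a2) => // [|q qN].
    exact: free_sub sub (nb_free2 pr' sb xR fat).
  by apply: leq_trans (leq_addr _ _) (pc _ (subsetP NR _ (subsetP sub _ qN))).
have b3 : #|nb r x| <= 8 * G 0 0.
  have Nr := @nb_closed r b cls pr r x xR; have NR := nb_sub cls r x.
  have sub := reps_sub pr NR Nr.
  apply: leq_trans (reps_cover pr NR) _.
  apply: (weighted_reps_le pr NR Nr sb _ a2) => // [|q qN].
    exact: free_sub sub (nb_free2 pr sr xR fat).
  by apply: leq_trans (leq_addr _ _) (pc _ (subsetP NR _ (subsetP sub _ qN))).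
by have cx := card_nb pr xR; gmax_lia r b s.
Qed.

End Cases.

Lemma parts_absurd r b cls : gallai_partition r b cls -> False.
Proof.
move=> pr; have pr' := parts_sym pr.
case: (s_r23 pr) (s_r23 pr') => sr [] sb.
- exact: (case_K3_K3 pr).
- case Ib: (peeled b); [exact: (case_K3_peeled pr) | exact: (case_K3_H3 pr)].
- case Ir: (peeled r); [exact: (case_K3_peeled pr') | exact: (case_K3_H3 pr')].
case Ir: (peeled r); case Ib: (peeled b).
- exact: (case_peeled_peeled pr).
- exact: (case_peeled_H3 pr).
- exact: (case_peeled_H3 pr').
have f11 : {in R, forall y, free 1 r (cls y) /\ free 1 b (cls y)}.
  move=> y yR; split.
    by have [//|P] := free1P c r (cls y); case: (case_H3_P3 pr' sb sr Ib Ir yR P).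
  by have [//|P] := free1P c b (cls y); case: (case_H3_P3 pr sr sb Ir Ib yR P).
have f11' : {in R, forall y, free 1 b (cls y) /\ free 1 r (cls y)}.
  by move=> y /f11 [].
apply: (case_H3_free pr) => // y yR; split.
  by have [//|e] := free0P c r (cls y); case: (case_H3_edge pr' sb sr Ib Ir f11' yR e).
by have [//|e] := free0P c b (cls y); case: (case_H3_edge pr sr sb Ir Ib f11 yR e).
Qed.

Lemma unpeelable_absurd : False.
Proof.
have [r [b [x [w [xR wR nw]]]]] := gallai_cut csym gal (ltnW R3).
have colour u v : u \in R -> v \in R -> v \notin component c R r b u -> c u v = r \/ c u v = b.
  move=> uR vR nuv; have := component_tc uR vR nuv; rewrite /two_coloured => /orP[]/eqP;
    by [left | right].
(* If the two colours coincide, a component is joined to the rest of [R] in a single colour. *)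
have [E|rb] := eqVneq r b.
  have AR := component_sub c r b xR.
  apply: (@no_join r (component c R r b x) (R :\: component c R r b x)).
  - by rewrite -[RHS](setID R (component c R r b x)) (setIidPr AR).
  - by rewrite -setI_eq0; apply/eqP/setP => z; rewrite in_setI in_setD in_set0; case: (z \in _).
  - by apply/set0Pn; exists x; apply: component_refl.
  - by apply/set0Pn; exists w; rewrite in_setD nw.
  move=> u v ux; rewrite in_setD => /andP[vx vR].
  have uR := subsetP AR _ ux.
  have vu : v \notin component c R r b u by rewrite (component_eq csym ux).
  split; first by apply: contraNneq vu => <-; apply: component_refl.
  by case: (colour u v uR vR vu) => ->.
apply: (@parts_absurd r b (component c R r b)); split=> //.
- by move=> y _; apply: component_refl.
- by move=> y; apply: component_sub.
- by move=> y z; apply: component_eq.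
- by move=> u u' v uR vR; apply: (component_homog csym gal).
move=> y yR; case: (boolP (w \in component c R r b y)) => [wy|]; last by exists w.
exists x => //; rewrite -(component_eq csym wy) (component_sym csym).
by apply: contra nw => wx.
Qed.

End Peel.

(** Induction on the number of vertices not yet peeled. Injectivity of [io] bounds the peeled
    vertices by the number of H3 colours, so [gmax_ge] applies when two vertices remain; before
    that, any vertex that can be peeled is moved to [U]. *)
Lemma peel_bound m : forall (U : {set T}) (io : T -> 'I_k),
  #|S :\: U| <= m -> U \subset S ->
  {in U & S :\: U, forall u x, c u x = io u} ->
  {in U &, forall u v, u != v -> c u v = io u \/ c u v = io v} ->
  {in U &, injective io} -> {in U, forall u, s (io u) = 3} -> 1 < #|S :\: U| ->
  #|S| <= gmax_of s.
Proof.
elim: m => [|m IHm] U io le US P1 P2 P3 P4 R2; first by move: R2 le; nat_lia.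
have cS : #|S| = #|S :\: U| + #|U| by rewrite -(cardsID U S) addnC (setIidPr US).
case: (leqP #|S :\: U| 2) => [le2|R3].
  have cU : #|U| <= #|[pred i | s i == 3]|.
    rewrite -(card_in_imset P3); apply: subset_leq_card; apply/subsetP => _ /imsetP[u uU ->].
    by rewrite inE P4.
  have : #|[pred i | s i == 3]|.+2 <= gmax_of s.
    apply: gmax_ge; have [x [y [xR yR xy]]] := card_gt1P R2.
    have xyS : colour_rel S (c x y) x y.
      by apply/and4P; move: xR yR; rewrite !inE => /andP[_ ->] /andP[_ ->]; rewrite xy eqxx.
    have ex l : s (c x y) = l -> 0 < #|[pred i | s i == l]|.
      by move=> sl; apply/card_gt0P; exists (c x y); rewrite inE sl.
    have := fr (c x y); have := s3 (c x y); move: (ex (s (c x y)) erefl).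
    case: (s (c x y)) => [|[|[|[|]]]] //= ; rewrite ?orbT //.
    - by move=> _ _ f; case: (f _ _ xyS).
    - by move=> -> _ _; rewrite ?orbT.
    - by move=> -> _ _; rewrite ?orbT.
    by move=> -> _ _; rewrite ?orbT.
  by move: cU; nat_lia.
rewrite leqNgt; apply/negP => big.
apply: (@unpeelable_absurd U io US P1 P2 P3 P4 R3 _ big) => w j wR Uj sj wj.
have wS : w \in S by move: wR; rewrite inE => /andP[].
have wU : w \notin U by move: wR; rewrite inE => /andP[].
have E : S :\: (w |: U) = (S :\: U) :\ w by rewrite setDDl setUC.
have cR : #|S :\: U| = #|(S :\: U) :\ w|.+1 by rewrite (cardsD1 w) wR.
have neq u : u \in U -> u != w by move=> uU; apply: contraNneq wU => <-.
apply: (IHm (w |: U) (fun x => if x == w then j else io x)).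
- by rewrite E; move: cR le; nat_lia.
- by rewrite subUset sub1set wS.
- move=> u x; rewrite E in_setU1 => /orP[/eqP->|uU] xR; first by rewrite eqxx wj.
  by rewrite (negbTE (neq _ uU)) P1 //; move: xR; rewrite in_setD1 => /andP[].
- move=> u v; rewrite !in_setU1 => /orP[/eqP->|uU] /orP[/eqP->|vU]; rewrite ?eqxx //.
  + by move=> _; right; rewrite (negbTE (neq _ vU)) csym P1.
  + by move=> _; left; rewrite (negbTE (neq _ uU)) P1.
  by rewrite (negbTE (neq _ uU)) (negbTE (neq _ vU)); apply: P2.
- move=> u v; rewrite !in_setU1 => /orP[/eqP->|uU] /orP[/eqP->|vU] //; rewrite ?eqxx.
  + by rewrite (negbTE (neq _ vU)) => jv; have := Uj v vU; rewrite -jv eqxx.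
  + by rewrite (negbTE (neq _ uU)) => ju; have := Uj u uU; rewrite ju eqxx.
  by rewrite (negbTE (neq _ uU)) (negbTE (neq _ vU)); apply: P3.
- move=> u; rewrite in_setU1 => /orP[/eqP->|uU]; first by rewrite eqxx.
  by rewrite (negbTE (neq _ uU)) P4.
by rewrite E; move: cR R3; nat_lia.
Qed.

End Step.

Theorem gallai_upper (T : finType) k (c : T -> T -> 'I_k) :
  (forall x y, c x y = c y x) ->
  (forall x y z, x != y -> y != z -> x != z ->
    [|| c x y == c y z, c y z == c x z | c x y == c x z]) ->
  forall (S : {set T}) s, (forall i, s i <= 3) -> respects c s S -> #|S| <= gmax_of s.
Proof.
move=> csym gal S; have [n] := ubnP #|S|; elim: n S => // n IH S lt s s3 fr.
case: (leqP #|S| 1) => [le1|S2].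
  apply: leq_trans le1 _; rewrite /gmax_of.
  have := gmax_ineqsP (0 < #|[pred i | s i == 1]|) #|[pred i | s i == 2]| #|[pred i | s i == 3]|.
  by rewrite /gmax_ineqs /= => /andP[].
have [x0 _] : exists x, x \in S by apply/card_gt0P; apply: ltnW.
(* Nothing is peeled at the start, and the colour given for the empty set is arbitrary. *)
apply: (@peel_bound T k c csym gal S s fr s3 _ #|S| set0 (fun=> c x0 x0)); rewrite ?setD0 //.
- move=> Y s' s3' ltY frY; apply: IH => //; exact: leq_trans ltY lt.
- exact: sub0set.
- by move=> u x; rewrite inE.
- by move=> u x; rewrite inE.
- by move=> u x; rewrite inE.
by move=> u; rewrite inE.
Qed.

(** * The lower bound *)

Definition good_colouring k (s : 'I_k -> nat) (T : finType) (c : T -> T -> 'I_k) : Prop :=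
  [/\ forall x y, c x y = c y x,
      forall x y z, x != y -> y != z -> x != z ->
        [|| c x y == c y z, c y z == c x z | c x y == c x z] &
      forall i, free c (s i) i [set: T]].

Definition realizes k (s : 'I_k -> nat) (n : nat) : Prop :=
  exists (T : finType) (c : T -> T -> 'I_k), good_colouring s c /\ #|T| = n.

(* In a lexicographic product over [e] of edgeless graphs, each with several vertices,
   H3 appears already when [e] contains a K4. *)
Definition K4_free (T : Type) (e : rel T) : Prop :=
  forall x y z u, e x y -> e x z -> e x u -> e y z -> e y u -> e z u -> False.

Definition product_free (l : nat) (T : Type) (e : rel T) : Prop :=
  (l = 2 /\ K3_free e) \/ (l = 3 /\ K4_free e).

(** Every colour is confined to one factor. A triangle over exactly two vertices of [V] has two
    equal sides, so no rainbow triangle arises; a clique of colour from [d] has its vertices in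
    different copies. *)
Lemma realizes_product k (s s' : 'I_k -> nat) (V : finType) (d : V -> V -> 'I_k) m :
  (forall v w, d v w = d w v) ->
  (forall x y z, x != y -> y != z -> x != z ->
    [|| d x y == d y z, d y z == d x z | d x y == d x z]) ->
  (forall q, (forall v w, v != w -> d v w != q) /\ s' q = s q \/
     s' q = 0 /\ product_free (s q) (colour_rel d [set: V] q)) ->
  realizes s' m -> realizes s (#|V| * m).
Proof.
move=> dsym dgal hq [T [c [[csym gal fr] Tm]]].
pose c' (x y : V * T) := if x.1 == y.1 then c x.2 y.2 else d x.1 y.1.
exists (V * T)%type, c'; split; last by rewrite card_prod Tm.
split.
- by move=> x y; rewrite /c' eq_sym; case: eqP => _; [apply: csym | apply: dsym].
- move=> [v x] [w y] [u z] /= xy yz xz; rewrite /c' /=.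
  have [vw|vw] := eqVneq v w; have [wu|wu] := eqVneq w u.
  + rewrite vw wu !eqxx; apply: gal.
    * by move: xy; rewrite vw xpair_eqE eqxx.
    * by move: yz; rewrite wu xpair_eqE eqxx.
    * by move: xz; rewrite vw wu xpair_eqE eqxx.
  + by rewrite vw (negbTE wu) eqxx orbT.
  + by rewrite -wu (negbTE vw) eqxx !orbT.
  have [vu|vu] := eqVneq v u; last exact: dgal.
  by rewrite -vu (dsym w v) eqxx.
move=> q; case: (hq q) => [[dq <-]|[s0 bl]].
  have E (x y : V * T) : colour_rel c' [set: _] q x y -> x.1 = y.1 /\ colour_rel c [set: T] q x.2
    y.2.
    case/and4P => _ _ xy; rewrite /c'; case: (x.1 =P y.1) => [E cq|/eqP ne]; last first.
      by rewrite (negbTE (dq _ _ ne)).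
    split=> //; apply/and4P; split; rewrite ?inE //.
    by apply: contra xy => /eqP E2; rewrite [x]surjective_pairing [y]surjective_pairing E E2.
  have := fr q; case: (s' q) => [|[|[|l]]] /= f.
  - by move=> x y /E[_ /f].
  - move=> x y z /E[e1 xy] /E[e2 xz]; have := f _ _ _ xy xz; move: e1 e2.
    by case: x y z {xy xz} => [? ?] [? ?] [? ?] /= <- <- ->.
  - by move=> x y z /E[_ xy] /E[_ xz] /E[_ yz]; apply: (f _ _ _ xy xz yz).
  move=> x y z u w /E[_ xy] /E[_ xz] /E[_ yz] /E[_ xu] /E[_ yu] /E[e1 zu] /E[_ xw] /E[_ yw] /E[e2
    zw].
  have := f _ _ _ _ _ xy xz yz xu yu zu xw yw zw; move: e1 e2.
  by case: (z) (u) (w) => [? ?] [? ?] [? ?] /= <- <- ->.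
have E (x y : V * T) : colour_rel c' [set: _] q x y -> colour_rel d [set: V] q x.1 y.1.
  case/and4P => _ _ xy; rewrite /c'; case: (x.1 =P y.1) => [E cq|/eqP ne cq]; last first.
    by apply/and4P; rewrite !inE.
  have := fr q; rewrite s0 /= => /(_ x.2 y.2) []; apply/and4P; split; rewrite ?inE //.
  by apply: contra xy => /eqP E2; rewrite [x]surjective_pairing [y]surjective_pairing E E2.
case: bl => [[-> f]|[-> f]] /=.
  by move=> x y z /E xy /E xz /E yz; apply: (f _ _ _ xy xz yz).
move=> x y z u w /E xy /E xz /E yz /E xu /E yu /E zu _ _ _.
by case: (f _ _ _ _ xy xz xu yz yu zu).
Qed.

(** * Checking small colourings by computation *)

Fixpoint all_below (n : nat) (p : nat -> bool) : bool :=
  if n is n'.+1 then if p n' then all_below n' p else false else true.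

Lemma all_belowP n p : all_below n p -> forall i, i < n -> p i.
Proof.
elim: n => //= n IH; case: ifP => // pn /IH h i; rewrite ltnS leq_eqVlt.
by case/orP => [/eqP->|/h].
Qed.

Section Check.

Variables (n : nat) (g : nat -> nat -> bool).

(** Complements enter as [~~ g i j], which may hold on the diagonal. *)
Let e i j := if eqn i j then false else g i j.

Definition check_sym := all_below n (fun i => all_below n (fun j => g i j == g j i)).

Definition check_edges (p : nat -> nat -> bool) :=
  all_below n (fun x => all_below n (fun y => if e x y then p x y else true)).

Definition check_P3 := check_edges (fun x y => all_below n (fun z => if e x z then eqn y z else
  true)).

Definition check_K3 := check_edges (fun x y => all_below n (fun z => if e x z then ~~ e y z else
  true)).

Definition check_triangles (p : nat -> nat -> nat -> bool) :=
  check_edges (fun x y => all_below n (fun z =>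
    if e x z then if e y z then p x y z else true else true)).

Definition common x y z u := if e x u then if e y u then e z u else false else false.

Definition check_K4 := check_triangles (fun x y z => all_below n (fun u => ~~ common x y z u)).

Definition check_H3 := check_triangles (fun x y z =>
  all_below n (fun u => if common x y z u then
    all_below n (fun w => if common x y z w then eqn u w else true) else true)).

Definition check l :=
  match l with 1 => check_P3 | 2 => check_K3 | 3 => check_H3 | _ => false end.

Definition check_product l :=
  match l with 2 => check_K3 | 3 => check_K4 | _ => false end.

Variables (k : nat) (q : 'I_k) (d : 'I_n -> 'I_n -> 'I_k).
Hypothesis dE : forall i j : 'I_n, i != j -> (d i j == q) = g i j.

Lemma check_cr i j : colour_rel d [set: 'I_n] q i j -> e i j.
Proof. by case/and4P => _ _ ij; rewrite dE // /e eqnE; case: eqP => // E; case/eqP: ij;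
  apply: val_inj. Qed.

Lemma check_edgesP p i j : check_edges p -> colour_rel d [set: 'I_n] q i j -> p i j.
Proof. by move=> /all_belowP/(_ i (ltn_ord i))/all_belowP/(_ j (ltn_ord j)) h /check_cr ij;
  rewrite ij in h. Qed.

Lemma check_trianglesP p i j l : check_triangles p -> colour_rel d [set: 'I_n] q i j ->
  colour_rel d [set: 'I_n] q i l -> colour_rel d [set: 'I_n] q j l -> p i j l.
Proof.
move=> /check_edgesP h /h /all_belowP/(_ l (ltn_ord l)) {}h /check_cr il /check_cr jl.
by rewrite il jl in h.
Qed.

Lemma commonP x y z u : colour_rel d [set: 'I_n] q x u -> colour_rel d [set: 'I_n] q y u ->
  colour_rel d [set: 'I_n] q z u -> common x y z u.
Proof. by rewrite /common => /check_cr -> /check_cr -> /check_cr ->. Qed.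

Lemma checkP l l' : l <= l' -> (forall i j : 'I_n, d i j = d j i) -> check l ->
  free d l' q [set: 'I_n].
Proof.
move=> ll dsym h; apply: (free_le dsym ll); case: l h {ll} => [|[|[|[|//]]]] //= h.
- move=> x y z /(check_edgesP h)/all_belowP/(_ z (ltn_ord z)) {}h /check_cr xz.
  by apply/val_inj/eqP; rewrite xz in h.
- move=> x y z /(check_edgesP h)/all_belowP/(_ z (ltn_ord z)) {}h /check_cr xz /check_cr yz.
  by rewrite xz yz in h.
move=> x y z u w xy xz yz xu yu zu xw yw zw.
have /all_belowP/(_ u (ltn_ord u)) := check_trianglesP h xy xz yz.
rewrite (commonP xu yu zu) => /all_belowP/(_ w (ltn_ord w)).
by rewrite (commonP xw yw zw) => /eqP/val_inj.
Qed.

Lemma check_productP l : check_product l -> product_free l (colour_rel d [set: 'I_n] q).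
Proof.
case: l => [|[|[|[|//]]]] //= h; [left | right]; split=> //.
  move=> x y z /(check_edgesP h)/all_belowP/(_ z (ltn_ord z)) {}h /check_cr xz /check_cr yz.
  by rewrite xz yz in h.
move=> x y z u xy xz xu yz yu zu.
have /all_belowP/(_ u (ltn_ord u)) := check_trianglesP h xy xz yz.
by rewrite (commonP xu yu zu).
Qed.

End Check.

Section TwoColours.

Variables (k n : nat) (g : nat -> nat -> bool) (r b : 'I_k).
Hypotheses (rb : r != b) (gs : check_sym n g).

Definition two_col (i j : 'I_n) := if g i j then r else b.

Lemma two_col_sym i j : two_col i j = two_col j i.
Proof. by rewrite /two_col (eqP (all_belowP (all_belowP gs (ltn_ord i)) (ltn_ord j))). Qed.

Lemma two_col_r i j : i != j -> (two_col i j == r) = g i j.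
Proof. by rewrite /two_col; case: (g i j); rewrite ?eqxx // (eq_sym b) (negbTE rb). Qed.

Lemma two_col_b i j : i != j -> (two_col i j == b) = ~~ g i j.
Proof. by rewrite /two_col; case: (g i j); rewrite ?eqxx // (negbTE rb). Qed.

Lemma two_col_gal (x y z : 'I_n) : x != y -> y != z -> x != z ->
  [|| two_col x y == two_col y z, two_col y z == two_col x z | two_col x y == two_col x z].
Proof.
by move=> _ _ _; rewrite /two_col; case: (g x y); case: (g y z); case: (g x z); rewrite ?eqxx ?orbT.
Qed.

Lemma two_col_other q i j : q != r -> q != b -> two_col i j != q.
Proof. by rewrite /two_col => qr qb; case: (g i j); rewrite eq_sym. Qed.

Lemma realizes_base (s : 'I_k -> nat) l l' : check n g l -> l <= s r ->
  check n (fun i j => ~~ g i j) l' -> l' <= s b -> realizes s n.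
Proof.
move=> hr lr hb lb; exists 'I_n, two_col; split; last exact: card_ord.
split; [exact: two_col_sym | exact: two_col_gal | move=> q].
have [->|qr] := eqVneq q r; first exact: (checkP two_col_r lr two_col_sym hr).
have [->|qb] := eqVneq q b; first exact: (checkP two_col_b lb two_col_sym hb).
apply: (free_le two_col_sym (leq0n _)) => x y /and4P[_ _ _].
by rewrite (negbTE (two_col_other _ _ qr qb)).
Qed.

Lemma realizes_two_product (s : 'I_k -> nat) m : check_product n g (s r) ->
  check_product n (fun i j => ~~ g i j) (s b) ->
  realizes (recolour r 0 (recolour b 0 s)) m -> realizes s (n * m).
Proof.
move=> hr hb re; rewrite -[n in n * m]card_ord.
apply: (realizes_product (d := two_col)) re; [exact: two_col_sym | exact: two_col_gal |].
move=> q; rewrite /recolour; have [->|qr] := eqVneq q r.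
  by right; split=> //; apply: (check_productP two_col_r).
have [E|qb] := eqVneq q b.
  by right; split=> //; rewrite E; apply: (check_productP (g := fun i j => ~~ g i j) two_col_b hb).
by left; split=> // v w _; apply: two_col_other.
Qed.

End TwoColours.

Lemma realizes_double k (s : 'I_k -> nat) r m : s r = 2 ->
  realizes (recolour r 0 s) m -> realizes s (2 * m).
Proof.
move=> sr re; rewrite -[2]card_bool.
apply: (realizes_product (d := fun _ _ : bool => r)) re => // [x y z|q].
  by rewrite eqxx.
rewrite /recolour; have [->|qr] := eqVneq q r; last by left; split=> // v w _; rewrite eq_sym.
right; split=> //; left; split=> // x y z /and4P[_ _ xy _] /and4P[_ _ xz _] /and4P[_ _ yz _].
by case: x y z xy xz yz => [] [] [].
Qed.

Lemma realizes_clique k (s : 'I_k -> nat) (r : 'I_k) n l :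
  check n (fun _ _ => true) l -> l <= s r -> realizes s n.
Proof.
move=> h lr; exists 'I_n, (fun _ _ => r); split; last exact: card_ord.
split=> // [x y z|q]; first by rewrite eqxx.
have [->|qr] := eqVneq q r; first by apply: (checkP _ lr _ h) => // i j _; rewrite eqxx.
apply: (@free_le _ _ (fun _ _ => r) _ _ _ _ _ (leq0n _)) => // x y /and4P[_ _ _].
by rewrite eq_sym (negbTE qr).
Qed.

(** * The small colourings *)

Definition circulant n (D : seq nat) (i j : nat) : bool := ((j + n - i) %% n) \in D.

(* Two circulant graphs on 10 vertices joined by a circulant bipartite graph, with a
   further vertex adjacent to the second one; found by computer search. *)
Definition graph21 (i j : nat) : bool :=
  let h i j := if j < 10 then circulant 10 [:: 1; 4; 5; 6; 9] i j
    else if j < 20 then if i < 10 then circulant 10 [:: 1; 5; 7; 8; 9] i j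
      else circulant 10 [:: 2; 3; 7; 8] i j
    else 10 <= i in
  if i < j then h i j else h j i.

(** The pentagon, extremal for R(K3, K3) = 6. *)
Lemma check5 : [&& check_sym 5 (circulant 5 [:: 1; 4]), check_product 5 (circulant 5 [:: 1; 4]) 2
  & check_product 5 (fun i j => ~~ circulant 5 [:: 1; 4] i j) 2].
Proof. by vm_compute. Qed.

(** The Wagner graph, triangle-free without four independent vertices: extremal for R(K3, K4) =
    9. *)
Lemma check8 : let g := circulant 8 [:: 1; 4; 7] in
  [&& check_sym 8 g, check_product 8 g 2 & check_product 8 (fun i j => ~~ g i j) 3].
Proof. by vm_compute. Qed.

(** The Paley graph on the squares modulo 17, extremal for R(K4, K4) = 18. *)
Lemma check17 : let g := circulant 17 [:: 1; 2; 4; 8; 9; 13; 15; 16] in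
  [&& check_sym 17 g, check_product 17 g 3 & check_product 17 (fun i j => ~~ g i j) 3].
Proof. by vm_compute. Qed.

(** A perfect matching, whose complement is the octahedron. *)
Lemma check6 : let g := circulant 6 [:: 3] in
  [&& check_sym 6 g, check 6 g 1 & check 6 (fun i j => ~~ g i j) 3].
Proof. by vm_compute. Qed.

(** The pentagon with each vertex replaced by two non-adjacent ones. *)
Definition graph10 (i j : nat) : bool := circulant 5 [:: 1; 4] i./2 j./2.

Lemma check10 : [&& check_sym 10 graph10, check 10 graph10 2
  & check 10 (fun i j => ~~ graph10 i j) 3].
Proof. by vm_compute. Qed.

Lemma check21 : [&& check_sym 21 graph21, check 21 graph21 3
  & check 21 (fun i j => ~~ graph21 i j) 3].
Proof. by vm_compute. Qed.

(** The second case is the passage from 16 to 32. *)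
Lemma gmax_double p t h : ~~ odd t && ~~ odd h || [&& p, t == 1 & odd h] ->
  gmax p t.+1 h = 2 * gmax p t h.
Proof.
case: (boolP (odd t)) => ot /=; last first.
  rewrite andbC; case: eqP ot => [->//|_] ot /=; rewrite orbF => oh.
  by rewrite /gmax /= uphalf_half (negbTE ot) (negbTE oh) add0n; case: p => /=;
    rewrite ?mul1n !mulnA.
by case/and3P => -> /eqP-> oh; rewrite /gmax /= oh /= !mulnA.
Qed.

Lemma gmax_eight h : ~~ odd h -> gmax true 1 h.+1 = 8 * gmax true 0 h.
Proof. by move=> oh; rewrite /gmax /= uphalf_half (negbTE oh) add0n /= !mulnA. Qed.

Lemma colour_of k (s : 'I_k -> nat) l : 0 < #|[pred i | s i == l]| -> exists i, s i = l.
Proof. by case/card_gt0P => i; rewrite inE => /eqP; exists i. Qed.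

Lemma colours_of k (s : 'I_k -> nat) l : 1 < #|[pred i | s i == l]| ->
  exists i j, [/\ i != j, s i = l & s j = l].
Proof. by case/card_gt1P => i [j []]; rewrite !inE => /eqP ? /eqP ? ?; exists i, j. Qed.

Section Realize.

Variables (k : nat) (s : 'I_k -> nat).
Local Notation cnt l := #|[pred i | s i == l]|.
Local Notation pos := (0 < cnt 1).

Lemma cnt1E r l : s r = l -> cnt l = (cnt1 r s l).+1.
Proof. by move=> sr; rewrite (cardD1 r) inE sr eqxx. Qed.

Lemma cnt1N r l : s r != l -> cnt l = cnt1 r s l.
Proof. by move=> sr; rewrite (cardD1 r) inE (negbTE sr). Qed.

Lemma realize_double r : s r = 2 ->
  ~~ odd (cnt 2).-1 && ~~ odd (cnt 3) || [&& pos, (cnt 2).-1 == 1 & odd (cnt 3)] ->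
  realizes (recolour r 0 s) (gmax_of (recolour r 0 s)) -> realizes s (gmax_of s).
Proof.
move=> sr cond; rewrite gmax_upd /gmax1 /= !add0n => re.
rewrite (cnt1E sr) (@cnt1N r 3) ?sr // (@cnt1N r 1) ?sr //= in cond.
rewrite /gmax_of (cnt1E sr) (@cnt1N r 3) ?sr // (@cnt1N r 1) ?sr //.
by rewrite gmax_double //; apply: realizes_double re.
Qed.

Lemma cnt2EE r b l : r != b -> s r = l -> s b = l -> cnt l = (cnt2 r b s l).+2.
Proof.
move=> rb sr sb; rewrite (cardD1 b) inE sb eqxx (cardD1 r) !inE rb sr eqxx.
by [].
Qed.

Lemma cnt2NN r b l : s r != l -> s b != l -> cnt l = cnt2 r b s l.
Proof.
by move=> sr sb; rewrite (cardD1 b) inE (negbTE sb) (cardD1 r) !inE (negbTE sr) andbF.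
Qed.

Lemma cnt2EN r b l : r != b -> s r = l -> s b != l -> cnt l = (cnt2 r b s l).+1.
Proof.
by move=> rb sr sb; rewrite (cardD1 b) inE (negbTE sb) (cardD1 r) !inE rb sr eqxx.
Qed.

Lemma cnt2NE r b l : s r != l -> s b = l -> cnt l = (cnt2 r b s l).+1.
Proof.
by move=> sr sb; rewrite (cardD1 b) inE sb eqxx (cardD1 r) !inE (negbTE sr) andbF.
Qed.

Lemma realize_five r b : r != b -> s r = 2 -> s b = 2 -> ~~ [&& pos, cnt 2 == 2 & odd (cnt 3)] ->
  realizes (recolour r 0 (recolour b 0 s)) (gmax_of (recolour r 0 (recolour b 0 s))) -> realizes s
    (gmax_of s).
Proof.
move=> rb sr sb cond; rewrite gmax_upd2 // /gmax2 /= !add0n => re.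
have [e1 e2 e3] := And3 (cnt2NN (l := 1) (r := r) (b := b)) (cnt2EE rb sr sb) (cnt2NN (l := 3) (r
  := r) (b := b)).
rewrite /gmax_of e1 ?sr ?sb // e2 e3 ?sr ?sb // gmaxS5; last first.
  by move: cond; rewrite e1 ?sr ?sb // e2 e3 ?sr ?sb.
have /and3P[h1 h2 h3] := check5.
by apply: (realizes_two_product (r := r) (b := b) rb h1); rewrite ?sr ?sb.
Qed.

Lemma realize_seventeen r b : r != b -> s r = 3 -> s b = 3 -> pos || (cnt 3 != 2) ->
  realizes (recolour r 0 (recolour b 0 s)) (gmax_of (recolour r 0 (recolour b 0 s))) -> realizes s
    (gmax_of s).
Proof.
move=> rb sr sb cond; rewrite gmax_upd2 // /gmax2 /= !add0n => re.
have [e1 e2 e3] := And3 (cnt2NN (l := 1) (r := r) (b := b)) (cnt2EE rb sr sb) (cnt2NN (l := 2) (r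
  := r) (b := b)).
rewrite /gmax_of e1 ?sr ?sb // e2 e3 ?sr ?sb // gmaxS17; last first.
  by move: cond; rewrite e1 ?sr ?sb // e2.
have /and3P[h1 h2 h3] := check17.
by apply: (realizes_two_product (r := r) (b := b) rb h1); rewrite ?sr ?sb.
Qed.

Lemma realize_eight r b : s r = 2 -> s b = 3 -> pos -> cnt 2 = 1 -> odd (cnt 3) ->
  realizes (recolour r 0 (recolour b 0 s)) (gmax_of (recolour r 0 (recolour b 0 s))) -> realizes s
    (gmax_of s).
Proof.
move=> sr sb p1 t1 oh; have rb : r != b by apply/eqP => E; rewrite E sb in sr.
rewrite gmax_upd2 // /gmax2 /= !add0n => re.
have [e1 e2 e3] := And3 (cnt2NN (l := 1) (r := r) (b := b)) (cnt2EN (l := 2) rb sr) (cnt2NE (l :=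
  3) (r := r) (b := b)).
rewrite e1 ?sr ?sb // in p1; rewrite e2 ?sb // in t1; rewrite e3 ?sr ?sb // in oh.
case: t1 => t0; rewrite /gmax_of e1 ?sr ?sb // e2 ?sb // e3 ?sr ?sb // p1 t0 gmax_eight //.
rewrite p1 t0 in re; have /and3P[h1 h2 h3] := check8.
by apply: (realizes_two_product (r := r) (b := b) rb h1); rewrite ?sr ?sb.
Qed.

End Realize.

(** Factors 17, 2 and 5 are split off as long as [gmax] is multiplicative. There remain the values
    1, 2, 4, 6, 10 and 21, each with its own colouring, and 16 = 8 * 2. *)
Lemma realizes_gmax k (s : 'I_k -> nat) : 0 < k -> realizes s (gmax_of s).
Proof.
move=> k0; have [n] := ubnP (#|[pred i | s i == 2]| + #|[pred i | s i == 3]|).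
elim: n s => // n IH s lt.
have IH1 r : s r = 2 -> realizes (recolour r 0 s) (gmax_of (recolour r 0 s)).
  move=> sr; apply: IH; rewrite !cnt_upd /= !add0n.
  by move: lt; rewrite (cnt1E sr) (@cnt1N _ s r 3) ?sr //; lia.
have IH2 r b : r != b -> s r > 1 -> s b > 1 -> s r <= 3 -> s b <= 3 ->
    realizes (recolour r 0 (recolour b 0 s)) (gmax_of (recolour r 0 (recolour b 0 s))).
  move=> rb sr sb sr3 sb3; apply: IH; rewrite !cnt_upd /= !add0n.
  have E l : l > 0 -> cnt1 r (recolour b 0 s) l = cnt2 r b s l.
    move=> l0; apply: eq_card => i; rewrite !inE /recolour; case: (i =P b) => //= _.
    by rewrite andbF; apply/negbTE; rewrite negb_and negbK; case: l l0 => // l _; rewrite orbT.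
  rewrite !E //; move: lt.
  have D l : #|[pred i | s i == l]| = (s b == l) + ((s r == l) + cnt2 r b s l).
    by rewrite (cardD1 b) inE (cardD1 r) !inE rb.
  rewrite !D; case: (s r) sr sr3 => [|[|[|[|]]]] //; case: (s b) sb sb3 => [|[|[|[|]]]] //=; lia.
set p := 0 < #|[pred i | s i == 1]|.
set t := #|[pred i | s i == 2]|; set h := #|[pred i | s i == 3]|.
have [C|nC] := boolP ((1 < h) && (p || (h != 2))).
  case/andP: C => h2 C; have [r [b [rb sr sb]]] := colours_of h2.
  by apply: (realize_seventeen rb sr sb C); apply: IH2; rewrite ?sr ?sb.
have h3 : h <= 2 /\ (p -> h <= 1) by move: nC; case: (p) => /=; lia.
have [A|sizeA] := boolP ((0 < t) && (~~ odd t.-1 && ~~ odd h || [&& p, t.-1 == 1 & odd h])).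
  case/andP: A => t1 A; have [r sr] := colour_of t1.
  exact: (realize_double sr A (IH1 r sr)).
have [B|nB] := boolP (1 < t).
  have [r [b [rb sr sb]]] := colours_of B.
  have [B'|/negPn/and3P[p1 /eqP t2 oh]] := boolP (~~ [&& p, t == 2 & odd h]).
    by apply: (realize_five rb sr sb B'); apply: IH2; rewrite ?sr ?sb.
  by move: sizeA; rewrite t2 p1 oh.
have one : realizes s 1.
  exists unit, (fun _ _ => Ordinal k0); split; last by rewrite card_unit.
  split=> // i.
  by apply: (@free_le _ _ (fun _ _ : unit => Ordinal k0) _ _ _ _ _ (leq0n _)) => // -[] [] /and4P[].
have [p1|p0] := boolP p.
  have [w sw] := colour_of p1.
  have h1 : h <= 1 by case: h3 => _ /(_ p1).
  have [h0|hpos] := posnP h.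
    have t0 : t = 0 by move: sizeA nB; rewrite h0; case: (t) => [|[|?]].
    have -> : gmax_of s = 2 by rewrite /gmax_of -/p -/t -/h p1 t0 h0.
    by apply: (@realizes_clique _ s w 2 1); rewrite ?sw.
  have [q sq] := colour_of hpos; have h1' : h = 1 by lia.
  have [t0|tpos] := posnP t.
    have -> : gmax_of s = 6 by rewrite /gmax_of -/p -/t -/h p1 t0 h1'.
    have /and3P[g1 g2 g3] := check6.
    have wq : w != q by apply/eqP => E; rewrite E sq in sw.
    by apply: (realizes_base wq g1 g2 _ g3); rewrite ?sw ?sq.
  have [r sr] := colour_of tpos; have t1 : t = 1 by move: nB tpos; lia.
  apply: (realize_eight sr sq p1 t1); first by rewrite -/h h1'.
  by apply: IH2; rewrite ?sr ?sq //; apply/eqP => E; rewrite E sq in sr.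
have pf : p = false by apply/negbTE.
have [h0|hpos] := posnP h.
  have t0 : t = 0 by move: sizeA nB; rewrite h0; case: (t) => [|[|?]].
  have -> : gmax_of s = 1 by rewrite /gmax_of -/p -/t -/h pf t0 h0.
  exact: one.
have [q sq] := colour_of hpos.
have [h2|h1] : h = 2 \/ h = 1 by case: h3; lia.
  have t0 : t = 0 by move: sizeA nB; rewrite h2; case: (t) => [|[|?]].
  have -> : gmax_of s = 21 by rewrite /gmax_of -/p -/t -/h pf t0 h2.
  have [r [b [rb sr sb]]] : exists i j, [/\ i != j, s i = 3 & s j = 3].
    by apply: colours_of; rewrite -/h h2.
  have /and3P[g1 g2 g3] := check21.
  by apply: (realizes_base rb g1 g2 _ g3); rewrite ?sr ?sb.
have [t0|tpos] := posnP t.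
  have -> : gmax_of s = 4 by rewrite /gmax_of -/p -/t -/h pf t0 h1.
  by apply: (@realizes_clique _ s q 4 3); rewrite ?sq.
have [r sr] := colour_of tpos; have t1 : t = 1 by move: nB tpos; lia.
have -> : gmax_of s = 10 by rewrite /gmax_of -/p -/t -/h pf t1 h1.
have /and3P[g1 g2 g3] := check10.
have rq : r != q by apply/eqP => E; rewrite E sq in sr.
by apply: (realizes_base rq g1 g2 _ g3); rewrite ?sr ?sq.
Qed.

Definition level (k s r : nat) (i : 'I_k) : nat :=
  if i < r then 3 else if i < r + s then 2 else 1.

(** * Gallai-Ramsey numbers *)

Lemma card_ord_count k (P : pred nat) : #|[pred i : 'I_k | P i]| = count P (iota 0 k).
Proof.
rewrite cardE /enum_mem size_filter -enumT -val_enum_ord count_map.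
by apply: eq_count.
Qed.

Lemma count_interval k a b : b <= k -> count (fun i => a <= i < b) (iota 0 k) = b - a.
Proof.
elim: k b => [|k IH] b; first by rewrite leqn0 => /eqP->.
rewrite leq_eqVlt -addn1 iotaD count_cat /= addn0 add0n => /orP[/eqP->|].
  have -> : count (fun i => a <= i < k + 1) (iota 0 k) = count (fun i => a <= i < k) (iota 0 k).
    by apply: eq_in_count => i; rewrite mem_iota; lia.
  by rewrite IH //; lia.
by move=> bk; rewrite IH; lia.
Qed.

Lemma gmax_level k s r : s + r <= k -> gmax_of (@level k s r) = gmax (s + r < k) s r.
Proof.
move=> le; rewrite /gmax_of.
have E l a b : b <= k -> (forall i : 'I_k, (level s r i == l) = (a <= i < b)) ->
    #|[pred i | @level k s r i == l]| = b - a.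
  move=> bk h; rewrite -(count_interval _ bk) -card_ord_count.
  by apply: eq_card => i; rewrite !inE h.
have lev (i : 'I_k) : i < k by [].
rewrite (@E 1 (s + r) k) // => [|i]; last by move: (lev i); rewrite /level; case: ifP => ?;
  last case: ifP => ?; lia.
rewrite (@E 2 r (s + r)) // => [|i]; last by rewrite /level; case: ifP => ?; last case: ifP => ?;
  lia.
rewrite (@E 3 0 r) => [||i]; last by rewrite /level; case: ifP => ?; last case: ifP => ?; lia.
  by rewrite subn_gt0 addnK subn0.
lia.
Qed.

Import Order.TTheory GRing.Theory Num.Theory.

(** The exponent is -1 exactly for [r = 0], and truncation is then an integer division: 21 / 17, 42
    / 17 and 32 / 5 give the irregular values 1, 2 and 6. *)
Lemma truncn_half a b r : 0 < b -> ~~ odd r -> 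
  Num.truncn (a%:R%:Q * b%:R%:Q ^ ((r%:Z - 2) %/ 2)%Z)%R =
  if r == 0 then a %/ b else a * b ^ (r./2).-1.
Proof.
move=> b0 er; have -> : r = r./2 * 2 by rewrite muln2 even_halfK //.
rewrite muln2 doubleK double_eq0 -muln2 !mulrz_nat.
case: (r./2) => [|m] /=.
  rewrite mul0n.
  have -> : (((0%N%:Z - 2) %/ 2)%Z = -1)%R by [].
  rewrite exprN1; apply: truncn_def; rewrite ler_pdivlMr ?ltr0n // ltr_pdivrMr ?ltr0n //.
  by rewrite -!natrM ler_nat ltr_nat leq_divM ltn_ceil.
have -> : ((((m.+1 * 2)%N%:Z - 2) %/ 2)%Z = m)%R by lia.
by rewrite -exprnP -natrX -natrM natrK.
Qed.

Lemma GR_valueE k s r : s + r <= k -> GR_value k s r = (gmax (s + r < k) s r).+1.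
Proof.
move=> le; rewrite /GR_value /gmax (@ltn_neqAle (s + r)) le andbT.
have sub1 n : odd n -> (n - 1)./2 = n./2 by case: n => //= n on;
  rewrite subn1 /= uphalf_half (negbTE on).
case os: (odd s); case or: (odd r); case: eqP => E /=; rewrite ?sub1 ?addn1 //; congr S.
all: rewrite ?truncn_half ?os ?or //.
- by case: ifP => _; rewrite -?mulnA (mulnCA 2) // (mulnA 2).
by case: ifP => _; rewrite mul1n.
Qed.

(** * From missing copies to the constraints *)

Section Copies.

Variables (n k : nat) (c : edge_coloring n k).

Let cs (x y : 'I_n) := c [set x; y].

Lemma edge_sym x y : cs x y = cs y x.
Proof. by rewrite /cs setUC. Qed.

Lemma edge_gallai : gallai_coloring c -> forall x y z, x != y -> y != z -> x != z ->
  [|| cs x y == cs y z, cs y z == cs x z | cs x y == cs x z].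
Proof.
move=> gal x y z xy yz xz; apply: contraT => h; case: (gal x y z).
by split; rewrite /= !inE !negb_or ?xy ?yz ?xz // -!/(cs _ _); move: h;
  rewrite !negb_or => /and3P[-> -> ->].
Qed.

(** A boolean form of [mono_copy], for the case distinction on whether some colour contains its
    graph. *)
Definition has_copy (F : sgraph) (i : 'I_k) : bool :=
  [exists f : {ffun F -> 'I_n}, injectiveb f &&
    [forall u, forall v, adj u v ==> (c [set f u; f v] == i)]].

Lemma has_copyP F i : reflect (mono_copy c F i) (has_copy F i).
Proof.
apply: (iffP existsP) => [[f /andP[/injectiveP fi /forallP h]]|[f fi h]].
  by exists f => // u v uv; apply/eqP; have /forallP/(_ v)/implyP := h u; apply.
exists [ffun x => f x]; apply/andP; split.
  by apply/injectiveP => x y; rewrite !ffunE; apply: fi.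
by apply/forallP => u; apply/forallP => v; apply/implyP => /h; rewrite !ffunE => ->.
Qed.

Lemma copy_of_seq m (e : rel 'I_m) es ei x0 (xs : seq 'I_n) (q : 'I_k) :
  uniq xs -> size xs = m ->
  (forall i j : 'I_m, e i j -> cs (nth x0 xs i) (nth x0 xs j) = q) ->
  mono_copy c (@SGraph 'I_m e es ei) q.
Proof.
move=> u sz h; exists (fun i : 'I_m => nth x0 xs i) => // i j /eqP.
by rewrite nth_uniq ?sz // => /eqP/val_inj.
Qed.

Lemma cs_edge q x y : colour_rel cs [set: 'I_n] q x y -> [/\ x != y, cs x y = q & cs y x = q].
Proof. by case/and4P => _ _ xy /eqP E; split; rewrite // edge_sym. Qed.

Lemma no_P3 q : ~ mono_copy c P3 q -> free cs 1 q [set: 'I_n].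
Proof.
move=> no x y z /cs_edge[xy c1 c2] /cs_edge[xz c3 c4]; apply/eqP; apply: contraT => yz; case: no.
apply: (@copy_of_seq _ _ _ _ x [:: y; x; z]) => //=.
  by rewrite !inE !negb_or eq_sym xy yz xz.
by move=> [[|[|[|//]]] pi] [[|[|[|//]]] pj].
Qed.

Lemma no_K3 q : ~ mono_copy c K3 q -> free cs 2 q [set: 'I_n].
Proof.
move=> no x y z /cs_edge[xy c1 c2] /cs_edge[xz c3 c4] /cs_edge[yz c5 c6]; case: no.
apply: (@copy_of_seq _ _ _ _ x [:: x; y; z]) => //=.
  by rewrite !inE !negb_or xy xz yz.
by move=> [[|[|[|//]]] pi] [[|[|[|//]]] pj].
Qed.

Lemma no_H3 q : ~ mono_copy c H3 q -> free cs 3 q [set: 'I_n].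
Proof.
move=> no x y z u w /cs_edge[xy c1 c2] /cs_edge[xz c3 c4] /cs_edge[yz c5 c6].
move=> /cs_edge[xu c7 c8] /cs_edge[yu c9 c10] /cs_edge[zu c11 c12].
move=> /cs_edge[xw c13 c14] /cs_edge[yw c15 c16] /cs_edge[zw c17 c18].
apply/eqP; apply: contraT => uw; case: no.
(* The ends of the list carry the missing edge, as [H3] deletes the edge between its first and last
   vertices. *)
apply: (@copy_of_seq _ _ _ _ x [:: u; x; y; z; w]) => //=.
  by rewrite !inE !negb_or (eq_sym u x) (eq_sym u y) (eq_sym u z) xu yu zu uw xy xz xw yz yw zw.
move=> [[|[|[|[|[|//]]]]] pi] [[|[|[|[|[|//]]]]] pj] //= /eqP[];
  apply/setP => v; rewrite !inE -!val_eqE /=; first exact: erefl; by rewrite orbC.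
Qed.

End Copies.

Lemma GR_arrows_upper k s r : s + r <= k ->
  GR_arrows (@GR_family k s r) (gmax (s + r < k) s r).+1.
Proof.
move=> le c gal; have [/existsP[i /has_copyP h]|/existsPn no] :=
  boolP [exists i, has_copy c (@GR_family k s r i) i]; first by exists i.
have : #|[set: 'I_(gmax (s + r < k) s r).+1]| <= gmax_of (@level k s r).
  apply: (gallai_upper (@edge_sym _ _ c) (edge_gallai gal)) => i.
    by rewrite /level; case: ifP => // _; case: ifP.
  have := no i; rewrite /GR_family /level; case: ifP => _; last case: ifP => _; move=> /has_copyP.
  - exact: no_H3.
  - exact: no_K3.
  exact: no_P3.
by rewrite cardsT card_ord gmax_level // ltnn.
Qed.

(** * From extremal colourings to edge colourings of complete graphs *)

Section Restrict.

Variables (k : nat) (k0 : 0 < k) (T : finType) (c : T -> T -> 'I_k) (m : nat).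
Hypothesis csym : forall x y, c x y = c y x.
Variable g : 'I_m -> T.
Hypothesis gi : injective g.

(** An edge is an unordered pair, so some ordering of it is picked; the symmetry of [c] makes the
    choice irrelevant. Sets that are not edges get the first colour. *)
Definition set_colour : edge_coloring m k := fun A =>
  if [pick p : 'I_m * 'I_m | (A == [set p.1; p.2]) && (p.1 != p.2)] is Some p
  then c (g p.1) (g p.2) else Ordinal k0.

Lemma set_colourE x y : x != y -> set_colour [set x; y] = c (g x) (g y).
Proof.
move=> xy; rewrite /set_colour; case: pickP => [[a b] /= /andP[/eqP E ab]|/(_ (x, y))]; last first.
  by rewrite /= eqxx xy.
have := set21 a b; have := set22 a b; rewrite -E !inE => /orP[]/eqP ? /orP[]/eqP ?; subst => //.
- by rewrite eqxx in ab.
- by rewrite eqxx in ab.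
Qed.

Lemma copy_edge (F : sgraph) q (f : F -> 'I_m) : injective f ->
  (forall u v, adj u v -> set_colour [set f u; f v] = q) ->
  forall u v, adj u v -> colour_rel c [set: T] q (g (f u)) (g (f v)).
Proof.
move=> fi h u v uv; have nuv : u != v by apply: contraTneq uv => ->; rewrite adj_irr.
have nf : f u != f v by rewrite (inj_eq fi).
by apply/and4P; split; rewrite ?inE // ?(inj_eq gi) // -set_colourE // h.
Qed.

Lemma copy_P3 q : mono_copy set_colour P3 q -> free c 1 q [set: T] -> False.
Proof.
move=> [f fi /(copy_edge fi) h] fr.
pose v i (p : i < 3) : P3 := Ordinal p.
have := fr _ _ _ (h (@v 1 isT) (@v 0 isT) isT) (h (@v 1 isT) (@v 2 isT) isT).
by move=> /gi/fi.
Qed.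

Lemma copy_K3 q : mono_copy set_colour K3 q -> free c 2 q [set: T] -> False.
Proof.
move=> [f fi /(copy_edge fi) h] fr.
pose v i (p : i < 3) : K3 := Ordinal p.
exact: fr (h (@v 0 isT) (@v 1 isT) isT) (h (@v 0 isT) (@v 2 isT) isT)
  (h (@v 1 isT) (@v 2 isT) isT).
Qed.

Lemma H3_adj (i j : H3) : i != j -> 0 < (i : 'I_5) < 4 -> adj i j.
Proof.
move=> ij i03; rewrite /adj /= ij /=; apply/eqP => E.
by have := set21 i j; rewrite E !inE => /orP[]/eqP Ei; rewrite Ei in i03.
Qed.

Lemma copy_H3 q : mono_copy set_colour H3 q -> free c 3 q [set: T] -> False.
Proof.
move=> [f fi /(copy_edge fi) h] fr.
pose v i (p : i < 5) : H3 := Ordinal p.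
have e i j p p' : i != j -> 0 < i < 4 -> colour_rel c [set: T] q (g (f (@v i p))) (g (f (@v j p'))).
  by move=> ij i03; apply: h; apply: H3_adj.
have := fr _ _ _ _ _ (e 1 2 isT isT isT isT) (e 1 3 isT isT isT isT) (e 2 3 isT isT isT isT)
  (e 1 0 isT isT isT isT) (e 2 0 isT isT isT isT) (e 3 0 isT isT isT isT)
  (e 1 4 isT isT isT isT) (e 2 4 isT isT isT isT) (e 3 4 isT isT isT isT).
by move=> /gi/fi.
Qed.

End Restrict.

(** Avoiding colourings restrict to fewer vertices, so the extremal colouring excludes all [m] up to
    its size. *)
Lemma GR_arrows_lower k s r m : 0 < k -> s + r <= k ->
  GR_arrows (@GR_family k s r) m -> gmax (s + r < k) s r < m.
Proof.
move=> k0 le arr; rewrite ltnNge; apply/negP => mle.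
have [T [c [[csym gal fr] Tn]]] := realizes_gmax (@level k s r) k0.
rewrite gmax_level // in Tn.
have mT : m <= #|T| by rewrite Tn.
pose g (i : 'I_m) : T := enum_val (widen_ord mT i).
have gi : injective g by move=> i j /enum_val_inj/(congr1 val) E; apply: val_inj.
have [x y z [u1 u2]|i copy] := arr (set_colour k0 c g).
  move: u1 u2; rewrite /= !inE !negb_or andbT => /andP[/andP[xy xz] yz].
  rewrite !(set_colourE k0 csym) // andbT => /andP[/andP[h1 h2] h3].
  have := gal (g x) (g y) (g z); rewrite !(inj_eq gi) => /(_ xy yz xz).
  by rewrite (negbTE h1) (negbTE h2) (negbTE h3).
have := fr i; move: copy; rewrite /GR_family /level.
case: ifP => _; last case: ifP => _.
- exact: copy_H3.
- exact: copy_K3.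
exact: copy_P3.
Qed.

Theorem theorem1p5 (k s r : nat) (hk : 1 <= k) (hs : s <= k) (hr : r <= k)
    (hsr : s + r <= k) :
  is_GR (@GR_family k s r) (GR_value k s r).
Proof.
rewrite GR_valueE //; split; first exact: GR_arrows_upper.
by move=> m; apply: GR_arrows_lower.
Qed.
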